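(* Let $n\ge1$, $j\in\{1,\ldots,n\}$ and $\zeta\in T_j^n$. Then there exists a unique continuous, epi-translation invariant, rotation equivariant valuation $\mathrm{t}_{j,\zeta}\colon\mathrm{Conv}_{\mathrm{sc}}(\mathbb{R}^n)\to\mathbb{R}^n$ such that $$\mathrm{t}_{j,\zeta}(u)=\int_{\mathbb{R}^n}\zeta(|\nabla u(x)|)\,\nabla u(x)\,[\mathrm{D}^2u(x)]_{n-j}\,\mathrm{d}x$$ for every $u\in\mathrm{Conv}_{\mathrm{sc}}(\mathbb{R}^n)\cap C_+^2(\mathbb{R}^n)$. In addition, $\mathrm{t}_{j,\zeta}$ is $\mathrm{O}(n)$ equivariant.
   Context: $C_b((0,\infty))$ is the set of continuous functions $\zeta\colon(0,\infty)\to\mathbb{R}$ with bounded support, and for $j\in\{1,\ldots,n\}$, $T_j^n=\{\zeta\in C_b((0,\infty)):\lim_{s\to0^+}s^{n-j+1}\zeta(s)=0\}$ (integrands are considered almost everywhere). $[A]_i$ is the $i$th elementary symmetric function of the eigenvalues of a symmetric matrix $A$, with $[A]_0=1$. $C_+^2(\mathbb{R}^n)$ is the set of functions in $C^2(\mathbb{R}^n)$ whose Hessian matrix is everywhere positive definite. $\mathrm{Conv}_{\mathrm{sc}}(\mathbb{R}^n)$ is the set of lower semicontinuous convex functions $u\colon\mathbb{R}^n\to(-\infty,\infty]$ with $u\not\equiv\infty$ and $\lim_{|x|\to\infty}u(x)/|x|=\infty$, with the topology of epi-convergence: $u_k$ epi-converges to $u$ if for every $x$, $\liminf_k u_k(x_k)\ge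 u(x)$ for every sequence $x_k\to x$, and there is a sequence $x_k\to x$ with $u_k(x_k)\to u(x)$. A map $\mathrm{z}\colon\mathrm{Conv}_{\mathrm{sc}}(\mathbb{R}^n)\to\mathbb{R}^n$ is a valuation if $\mathrm{z}(u\vee w)+\mathrm{z}(u\wedge w)=\mathrm{z}(u)+\mathrm{z}(w)$ whenever $u,w$, their pointwise maximum $u\vee w$ and minimum $u\wedge w$ all belong to $\mathrm{Conv}_{\mathrm{sc}}(\mathbb{R}^n)$. It is epi-translation invariant if $\mathrm{z}(u\circ\tau^{-1}+c)=\mathrm{z}(u)$ for every $u$, every translation $\tau$ on $\mathbb{R}^n$ and every $c\in\mathbb{R}$; rotation equivariant if $\mathrm{z}(u\circ\vartheta^{-1})=\vartheta\,\mathrm{z}(u)$ for every $u$ and $\vartheta\in\mathrm{SO}(n)$; $\mathrm{O}(n)$ equivariant if this holds for every $\vartheta\in\mathrm{O}(n)$. *)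

(* Defs.v *)
From HB Require Import structures.
From mathcomp Require Import all_boot all_order all_algebra.
From mathcomp Require Import spectral complex.
From mathcomp Require Import all_classical all_reals all_analysis.

Set Implicit Arguments.
Unset Strict Implicit.
Unset Printing Implicit Defensive.

Import Order.TTheory GRing.Theory Num.Theory.
Import numFieldNormedType.Exports.

Local Open Scope classical_set_scope.
Local Open Scope ring_scope.

(* R^n is the space of row vectors 'rV[R]_n.  The library norm on 'rV[R]_n is *)
(* the sup norm; it is only used through the topology it induces, which is    *)
(* the usual one.                                                             *)
Definition enorm (R : realType) (n : nat) (x : 'rV[R]_n) : R :=
  Num.sqrt (\sum_(i < n) x 0 i ^+ 2).

Section cons_measure.
Context (R : realType) (n : nat).
Local Notation T := (measurableTypeR R).
Variable m : {sigma_finite_measure set (n.-tuple T) -> \bar R}.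

Let cons2 (p : T * n.-tuple T) : n.+1.-tuple T := [tuple of p.1 :: p.2].

Let measurable_cons2 : measurable_fun setT cons2.
Proof. exact: measurable_cons measurable_fst measurable_snd. Qed.

Definition cons_measure : set (n.+1.-tuple T) -> \bar R :=
  pushforward (@lebesgue_measure R \x m)%E cons2.

Let cons_measure0 : cons_measure set0 = 0%E.
Proof. by rewrite /cons_measure /pushforward preimage_set0 measure0. Qed.

Let cons_measure_ge0 A : (0 <= cons_measure A)%E.
Proof. exact: measure_ge0. Qed.

Let cons_measure_sigma_additive : semi_sigma_additive cons_measure.
Proof.
move=> F mF tF mUF; rewrite /cons_measure /pushforward preimage_bigcup.
apply: measure_semi_sigma_additive.
- by move=> k; rewrite -[X in measurable X]setTI; exact: measurable_cons2.
- apply/trivIsetP => /= i j _ _ ij; rewrite -preimage_setI.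
  by move/trivIsetP : tF => /(_ _ _ _ _ ij) ->//; rewrite preimage_set0.
- by rewrite -preimage_bigcup -[X in measurable X]setTI; exact: measurable_cons2.
Qed.

HB.instance Definition _ := isMeasure.Build _ _ _ cons_measure
  cons_measure0 cons_measure_ge0 cons_measure_sigma_additive.

Let uncons (t : n.+1.-tuple T) : T * n.-tuple T := (thead t, [tuple of behead t]).

Let measurable_uncons : measurable_fun setT uncons.
Proof.
apply/measurable_fun_pair; first exact: measurable_tnth.
exact: measurable_behead.
Qed.

Let cons2K : cancel cons2 uncons.
Proof. by case=> x t; congr pair; apply/val_inj. Qed.

Let cons_measure_sigma_finite : sigma_finite setT cons_measure.
Proof.
have /sigma_finiteP[F [FT ndF Foo]] := sigma_finiteT (@lebesgue_measure R).
have /sigma_finiteP[G [GT ndG Goo]] := sigma_finiteT m.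
exists (fun k => uncons @^-1` (F k `*` G k)).
  apply/seteqP; split => // t _.
  have [i _ Fi] : (\bigcup_k F k) (uncons t).1 by rewrite -FT.
  have [k _ Gk] : (\bigcup_k G k) (uncons t).2 by rewrite -GT.
  exists (maxn i k) => //; split.
    by move: Fi; exact/subsetPset/ndF/leq_maxl.
  by move: Gk; exact/subsetPset/ndG/leq_maxr.
move=> k; have [mF Fk] := Foo k; have [mG Gk] := Goo k; split.
  rewrite -[X in measurable X]setTI; apply: measurable_uncons => //.
  exact: measurableX.
rewrite /cons_measure /pushforward -comp_preimage.
rewrite (_ : _ \o _ = id); last by apply/funext => p /=; rewrite cons2K.
by rewrite preimage_id product_measure1E// lte_mul_pinfty// ge0_fin_numE.
Qed.

HB.instance Definition _ := Measure_isSigmaFinite.Build _ _ _ cons_measure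
  cons_measure_sigma_finite.

End cons_measure.

Section lebesgue_tuple.
Context (R : realType).
Local Notation T := (measurableTypeR R).

(* n-dimensional Lebesgue measure on the Borel sets of R^n *)
Fixpoint lebesgue_tuple (n : nat) :
    {sigma_finite_measure set (n.-tuple T) -> \bar R} :=
  if n is k.+1 then cons_measure (lebesgue_tuple k)
  else \d_([tuple] : 0.-tuple T).

Lemma lebesgue_tuple_box (n : nat) (A : 'I_n -> set T) :
  (forall i, measurable (A i)) ->
  lebesgue_tuple n [set t | forall i, A i (tnth t i)] =
  (\prod_(i < n) lebesgue_measure (A i))%E.
Proof.
elim: n A => [|n IH] A mA.
  rewrite big_ord0 /= diracE mem_set //; by case.
rewrite big_ord_recl -IH; last by move=> i; exact: mA.
rewrite /= /cons_measure /pushforward -product_measure1E //.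
  congr (_ _); apply/seteqP; split => -[x t] /=.
    move=> h; split; first exact: (h ord0).
    by move=> i; have := h (lift ord0 i); rewrite tnthS.
  by move=> [hx ht] i; case: (unliftP ord0 i) => [j|] ->; rewrite ?tnthS.
rewrite (_ : [set _ | _] = \big[setI/setT]_(i < n) ((@tnth _ T ^~ i) @^-1` A (lift ord0 i))).
  apply: bigsetI_measurable => i _.
  by rewrite -[X in measurable X]setTI; apply: measurable_tnth.
rewrite -bigcap_seq /=; apply/seteqP; split => t /= h i.
  by move=> _; exact: h.
by apply: (h i); rewrite /= mem_index_enum.
Qed.

End lebesgue_tuple.

Section vector_integral.
Context (R : realType) (n : nat).

Definition row_of_tuple (t : n.-tuple (measurableTypeR R)) : 'rV[R]_n :=
  \row_i tnth t i.

Definition vintegrable (F : 'rV[R]_n -> 'rV[R]_n) : Prop :=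
  forall i, (lebesgue_tuple R n).-integrable setT
    (fun t => (F (row_of_tuple t) 0 i)%:E).

Definition vintegral (F : 'rV[R]_n -> 'rV[R]_n) : 'rV[R]_n :=
  \row_i \int[lebesgue_tuple R n]_t F (row_of_tuple t) 0 i.

End vector_integral.

Section C2plus.
Context (R : realType) (n : nat).
Implicit Types (f : 'rV[R]_n -> R) (x : 'rV[R]_n).

Definition partial (i : 'I_n) f : 'rV[R]_n -> R := 'D_(delta_mx 0 i) f.

Definition gradient f x : 'rV[R]_n := \row_i partial i f x.

Definition hessian f x : 'M[R]_n := \matrix_(i, j) partial j (partial i f) x.

Definition C2 f : Prop :=
  [/\ continuous f,
      forall i, (forall x, derivable f x (delta_mx 0 i)) /\
                continuous (partial i f)
    & forall i j, (forall x, derivable (partial i f) x (delta_mx 0 j)) /\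
                  continuous (partial j (partial i f))].

Definition posdef (A : 'M[R]_n) : Prop :=
  A^T = A /\ forall v : 'rV[R]_n, v != 0 -> 0 < (v *m A *m v^T) 0 0.

Definition C2plus f : Prop := C2 f /\ forall x, posdef (hessian f x).

End C2plus.

Lemma char_poly_conj (F : fieldType) n (P D : 'M[F]_n) : P \in unitmx ->
  char_poly (invmx P *m D *m P) = char_poly D.
Proof.
move=> Pu; rewrite /char_poly.
have E : char_poly_mx (invmx P *m D *m P) =
    map_mx polyC (invmx P) *m char_poly_mx D *m map_mx polyC P.
  rewrite /char_poly_mx !map_mxM mulmxBr mulmxBl; congr (_ - _).
  by rewrite mul_mx_scalar -scalemxAl -map_mxM mulVmx// map_mx1 -mul_scalar_mx mulmx1.
by rewrite E !det_mulmx mulrC mulrA -det_mulmx -map_mxM mulmxV// map_mx1 det1 mul1r.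
Qed.

Lemma char_poly_sym (R : realType) n (A : 'M[R]_n) : A^T = A ->
  exists l : 'rV[R]_n, char_poly A = \prod_(i < n) ('X - (l 0 i)%:P).
Proof.
move=> AT; pose B := map_mx (real_complex R) A.
have Bh : B \is hermsymmx.
  apply/is_hermitianmxP; rewrite expr0 scale1r /B.
  by apply/matrixP => i j; rewrite !mxE -[in RHS]AT mxE; exact/esym/conjc_real.
have /hermitian_normalmx/orthomx_spectralP BE := Bh.
have /mxOverP rl := hermitian_spectral_diag_real Bh.
exists (map_mx (@complex.Re R) (spectral_diag B)).
apply: (map_poly_inj (real_complex R)).
rewrite map_char_poly -/B [in LHS]BE char_poly_conj ?spectral_unit//.
rewrite char_poly_trig ?diag_mx_is_trig// rmorph_prod; apply: eq_bigr => i _.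
rewrite rmorphB /= map_polyX map_polyC /= !mxE eqxx mulr1n; congr (_ - _%:P).
by rewrite RRe_real//; exact: rl.
Qed.

Section elementary_symmetric.
Context (R : realType) (n : nat).

(* The eigenvalues of A listed with multiplicity, when all of them are real;  *)
(* for a symmetric A this is always the case (see [eigenvalsP]).              *)
Definition eigenvals (A : 'M[R]_n) : 'rV[R]_n :=
  xget 0 [set l : 'rV[R]_n | char_poly A = \prod_(i < n) ('X - (l 0 i)%:P)].

Lemma eigenvalsP (A : 'M[R]_n) : A^T = A ->
  char_poly A = \prod_(i < n) ('X - (eigenvals A 0 i)%:P).
Proof. by move=> /char_poly_sym/(@xgetPex _ 0). Qed.

Definition esym_eig (A : 'M[R]_n) (k : nat) : R :=
  \sum_(I : {set 'I_n} | #|I| == k) \prod_(i in I) eigenvals A 0 i.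

End elementary_symmetric.

Section convex_functions.
Context (R : realType) (n : nat).
Local Open Scope ereal_scope.
Implicit Types (u w : 'rV[R]_n -> \bar R).

Definition supercoercive u : Prop :=
  forall M : R, exists r : R, forall x : 'rV[R]_n,
    (r < enorm x)%R -> M%:E <= u x * ((enorm x)^-1)%:E.

Definition conv_sc : set ('rV[R]_n -> \bar R) :=
  [set u | [/\ forall x, u x != -oo,
               exists x, u x != +oo,
               lower_semicontinuous u,
               forall (x y : 'rV[R]_n) (t : R), (0 < t < 1)%R ->
                 u (t *: x + (1 - t) *: y)%R
                   <= t%:E * u x + (1 - t)%:E * u y
             & supercoercive u]].

Definition epi_cvg (u_ : nat -> 'rV[R]_n -> \bar R) u : Prop :=
  forall x : 'rV[R]_n,
    (forall x_ : nat -> 'rV[R]_n, x_ @ \oo --> x ->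
       u x <= limn_einf (fun k => u_ k (x_ k))) /\
    (exists2 x_ : nat -> 'rV[R]_n, x_ @ \oo --> x &
       (fun k => u_ k (x_ k)) @ \oo --> u x).

End convex_functions.

Section vector_valuations.
Context (R : realType) (n : nat).

(* A map Conv_sc(R^n) -> R^n is represented by a total function on            *)
(* 'rV[R]_n -> \bar R of which only the values on [conv_sc] are constrained.  *)
Implicit Type z : ('rV[R]_n -> \bar R) -> 'rV[R]_n.

Definition valuation z : Prop :=
  forall u w, conv_sc u -> conv_sc w ->
    conv_sc (fun x => Order.max (u x) (w x)) ->
    conv_sc (fun x => Order.min (u x) (w x)) ->
    z (fun x => Order.max (u x) (w x)) + z (fun x => Order.min (u x) (w x)) =
    z u + z w.

(* The topology of epi-convergence on Conv_sc(R^n) is metrizable, so          *)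
(* continuity is sequential continuity.                                       *)
Definition epi_continuous z : Prop :=
  forall (u_ : nat -> 'rV[R]_n -> \bar R) (u : 'rV[R]_n -> \bar R),
    (forall k, conv_sc (u_ k)) -> conv_sc u -> epi_cvg u_ u ->
    (fun k => z (u_ k)) @ \oo --> z u.

Definition epi_translation_invariant z : Prop :=
  forall (u : 'rV[R]_n -> \bar R) (a : 'rV[R]_n) (c : R), conv_sc u ->
    z (fun x => u (x - a)%R + c%:E)%E = z u.

Definition On : set 'M[R]_n := [set Q | Q *m Q^T = 1%:M].

Definition SOn : set 'M[R]_n := [set Q | On Q /\ \det Q = 1].

(* Q acts on row vectors by x |-> x *m Q. *)
Definition equivariant (G : set 'M[R]_n) z : Prop :=
  forall u (Q : 'M[R]_n), conv_sc u -> G Q ->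
    z (fun x => u (x *m invmx Q)) = z u *m Q.

End vector_valuations.

(* C_b((0,oo)) and T^n_j: only the values of zeta on (0,oo) matter. *)
Definition Cb_pos (R : realType) (zeta : R -> R) : Prop :=
  (forall s, 0 < s -> {for s, continuous zeta}) /\
  exists M, forall s, M < s -> zeta s = 0.

Definition Tclass (R : realType) (n j : nat) (zeta : R -> R) : Prop :=
  Cb_pos zeta /\
  s ^+ (n - j + 1)%N * zeta s @[s --> (0 : R)^'+] --> (0 : R).

Definition tintegrand (R : realType) (n j : nat) (zeta : R -> R)
    (f : 'rV[R]_n -> R) (x : 'rV[R]_n) : 'rV[R]_n :=
  (zeta (enorm (gradient f x)) * esym_eig (hessian f x) (n - j)%N) *: gradient f x.

Definition is_t (R : realType) (n j : nat) (zeta : R -> R)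
    (z : ('rV[R]_n -> \bar R) -> 'rV[R]_n) : Prop :=
  [/\ valuation z, epi_continuous z, epi_translation_invariant z,
      equivariant (@SOn R n) z
    & forall f : 'rV[R]_n -> R, conv_sc (EFin \o f) -> C2plus f ->
        vintegrable (tintegrand j zeta f) /\
        z (EFin \o f) = vintegral (tintegrand j zeta f)].

(* Main.v *)
(* For u in Conv_sc and e > 0, let p_e(z) be the minimizer of u + e/2 |.|^2 - <z, .>, so     *)
(* that y_e(z) = z - e p_e(z) is a subgradient of u at p_e(z).  For a continuous compactly   *)
(* supported phi the integral of phi(y_e(z)) dz is a valuation in u, continuous under        *)
(* epi-convergence; for smooth u the substitution z = grad u(x) + e x turns it into the      *)
(* integral of phi(grad u) det(D^2 u + e), a polynomial in e whose coefficients are the      *)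
(* integrals of phi(grad u) [D^2 u]_(n-j).  Extracting a coefficient from the values at      *)
(* e = 1, ..., n+1 therefore defines, for every u, the functional of the statement as long   *)
(* as phi(y) = zeta(|y|) y_a is continuous.                                                  *)
(* Singular zeta are reached by truncation near 0, which needs a bound of the functional by  *)
(* sup s^(n-j+1) |zeta(s)|.  For smooth strongly convex u it is the integral of              *)
(* zeta(|y|) y_a [D h(y)]_j dy with h the inverse of grad u.  Since the volume of the image  *)
(* of h + e id is unchanged when a compactly supported field is added, a radial field with   *)
(* suitable coefficients trades this integral, up to a controlled factor, for the integral   *)
(* of a mixed discriminant of D h and the Hessian of |y|, which is dominated by the Jacobian *)
(* of a monotone map and hence by a volume.  The bound extends to all u because log-sum-exp  *)
(* smoothings of maxima of affine minorants of u are smooth, strongly convex, and            *)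
(* epi-converge to u; the same density gives uniqueness.                                     *)

Require Import Defs.
From mathcomp Require Import all_boot all_order all_algebra.
From mathcomp Require Import all_classical all_reals all_analysis measurable_realfun.
From mathcomp Require Import ring lra zify.

Set Implicit Arguments.
Unset Strict Implicit.
Unset Printing Implicit Defensive.

Import Order.TTheory GRing.Theory Num.Theory.
Import numFieldNormedType.Exports.

Local Open Scope classical_set_scope.
Local Open Scope ring_scope.

(** For [e > 0] and [u] in [conv_sc], every [z] splits uniquely as [z = y + e p] with [y] a
    subgradient of [u] at [p] ([proxP], [subgrad_prox_uniq]). For continuous [phi] of compact
    support, [proxint phi e u] integrates [phi y] over [z]. It is a valuation because at each [z]
    the proximal points of the maximum and minimum of [u], [w] are those of [u] and [w] in some
    order ([prox_minmax_le]). It is continuous because proximal points converge under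
    epi-convergence ([prox_cvg]) while the supports stay in a common ball ([confined_bound],
    [confined_open]). On smooth [u] the substitution [z = grad u(x) + e x], valid by
    [change_of_variables], makes it a polynomial in [e]; [proxext] reads off one coefficient
    ([proxext_gradient]).

    A singular [zeta] is frozen below [1/(k+1)], and the limit in [k] exists by [proxext_bound],
    which involves [zeta] only through [eta], a bound for [s^(n-j+1) |zeta s|], and is uniform on
    confined functions. For its proof let [h] be the inverse of the gradient of a smooth strongly
    convex function; the functional is then the integral of [zeta(|y|) y_a [Dh(y)]_j]
    ([proxext_hinv]). Invariance of volume under compactly supported perturbations ([cov_perturb]),
    applied to the field [P(|y|) y_a y + Q(|y|) e_a], exchanges this integrand for
    [y_a ((n-j) P + zeta) b], with [b] a mixed discriminant of [Dh] and a multiple of the Hessian of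
    [|y|] ([radial_divergence]). Since [y/|y|] is monotone, [b] is at most [|y|^(n-j)] times the
    Jacobian of a monotone map; the weights cancel and only a volume remains ([key_bound]). Density
    of smooth functions ([smooth_dense]) carries the bound to all [u].

    For [u] of class [C2plus] the gradient has at most one zero and grows at least linearly away
    from it on balls ([gradient_lower]), so the integrand has a singularity of order [n-j < n] and
    dominated convergence gives the formula ([tval_formula]). Uniqueness is again density.
    Equivariance under the whole orthogonal group comes from the rotation invariance of Lebesgue
    measure ([lint_rotate]). *)

Section rowvectors.
Context {R : realType}.

(** * Norms, inner products and continuity for row vectors *)

Lemma ler_mx_norm_coord m n (A : 'M[R]_(m, n)) i j : `|A i j| <= `|A|.
Proof.
by rewrite [leRHS]/Num.norm /= mx_normrE; apply/bigmax_geP; right; exists (i, j).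
Qed.

Lemma ler_mx_normP m n (A : 'M[R]_(m, n)) e : 0 <= e ->
  (forall i j, `|A i j| <= e) -> `|A| <= e.
Proof.
move=> e0 h; rewrite [leLHS]/Num.norm /= mx_normrE.
by apply/bigmax_leP; split => // -[i j] _; exact: h.
Qed.

Lemma ltr_mx_normP m n (A : 'M[R]_(m, n)) e : 0 < e ->
  (forall i j, `|A i j| < e) -> `|A| < e.
Proof.
move=> e0 h; rewrite [ltLHS]/Num.norm /= mx_normrE.
by apply/bigmax_ltP; split => // -[i j] _; exact: h.
Qed.

Lemma cts_coord m n i j : continuous (fun A : 'M[R]_(m, n) => A i j).
Proof. exact: coord_continuous. Qed.

Lemma cts_mx (T : topologicalType) m n (f : T -> 'M[R]_(m, n)) :
  (forall i j, continuous (fun x => f x i j)) -> continuous f.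
Proof.
move=> h x; apply/cvgrPdist_lt => e e0.
have H ij : \forall y \near x, `|f x ij.1 ij.2 - f y ij.1 ij.2| < e.
  by have /cvgrPdist_lt := h ij.1 ij.2 x; exact.
move/filter_forall : H.
apply: filterS => y hy; apply: ltr_mx_normP => // i j.
by rewrite !mxE; exact: (hy (i, j)).
Qed.

Lemma cts_sum (T : topologicalType) I (r : seq I) (P : pred I) (f : I -> T -> R) :
  (forall i, P i -> continuous (f i)) ->
  continuous (fun x => \sum_(i <- r | P i) f i x).
Proof.
move=> h; elim: r => [|i r IH] x.
  by under eq_fun do rewrite big_nil; exact: cst_continuous.
under eq_fun do rewrite big_cons.
have [Pi|nPi] := boolP (P i); last exact: IH.
by apply: cvgD; [exact: h|exact: IH].
Qed.

Lemma cts_prod (T : topologicalType) I (r : seq I) (P : pred I) (f : I -> T -> R) :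
  (forall i, P i -> continuous (f i)) ->
  continuous (fun x => \prod_(i <- r | P i) f i x).
Proof.
move=> h; elim: r => [|i r IH] x.
  by under eq_fun do rewrite big_nil; exact: cst_continuous.
under eq_fun do rewrite big_cons.
have [Pi|nPi] := boolP (P i); last exact: IH.
by apply: cvgM; [exact: h|exact: IH].
Qed.

Lemma ctsD (T : topologicalType) (f g : T -> R) :
  continuous f -> continuous g -> continuous (fun x => f x + g x).
Proof. by move=> cf cg x; apply: cvgD; [exact: cf|exact: cg]. Qed.

Lemma ctsB (T : topologicalType) (f g : T -> R) :
  continuous f -> continuous g -> continuous (fun x => f x - g x).
Proof. by move=> cf cg x; apply: cvgB; [exact: cf|exact: cg]. Qed.

Lemma ctsN (T : topologicalType) (f : T -> R) :
  continuous f -> continuous (fun x => - f x).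
Proof. by move=> cf x; apply: cvgN; exact: cf. Qed.

Lemma ctsM (T : topologicalType) (f g : T -> R) :
  continuous f -> continuous g -> continuous (fun x => f x * g x).
Proof. by move=> cf cg x; apply: cvgM; [exact: cf|exact: cg]. Qed.

Lemma ctsV (T : topologicalType) (f : T -> R) :
  (forall x, f x != 0) -> continuous f -> continuous (fun x => (f x)^-1).
Proof. by move=> f0 cf x; apply: cvgV => //; exact: cf. Qed.

Lemma ctsC (T : topologicalType) (c : R) : continuous (fun _ : T => c).
Proof. exact: cst_continuous. Qed.

Lemma cts_comp (T U V : topologicalType) (f : U -> V) (g : T -> U) :
  continuous f -> continuous g -> continuous (fun x => f (g x)).
Proof. by move=> cf cg x; apply: (@continuous_comp _ _ _ g f); [exact: cg|exact: cf]. Qed.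

Lemma cts_det (T : topologicalType) n (A : T -> 'M[R]_n) :
  (forall i j, continuous (fun x => A x i j)) -> continuous (fun x => \det (A x)).
Proof.
move=> h; rewrite /determinant; apply: cts_sum => s _.
by apply: ctsM; [exact: ctsC|apply: cts_prod => i _; exact: h].
Qed.

Lemma cts_cofactor (T : topologicalType) n (A : T -> 'M[R]_n) i j :
  (forall i j, continuous (fun x => A x i j)) ->
  continuous (fun x => cofactor (A x) i j).
Proof.
move=> h; rewrite /cofactor; apply: ctsM; first exact: ctsC.
by apply: cts_det => k l; under eq_fun do rewrite !mxE; exact: h.
Qed.

Lemma cts_invmx (T : topologicalType) n (A : T -> 'M[R]_n) i j :
  (forall i j, continuous (fun x => A x i j)) -> (forall x, A x \in unitmx) ->
  continuous (fun x => invmx (A x) i j).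
Proof.
move=> h u.
have -> : (fun x => invmx (A x) i j) = (fun x => (\det (A x))^-1 * cofactor (A x) j i).
  by apply/funext => x; rewrite /invmx u !mxE.
apply: ctsM; last exact: cts_cofactor.
apply: ctsV; last exact: cts_det.
by move=> x; have := u x; rewrite unitmxE unitfE.
Qed.

Lemma cts_mulmx (T : topologicalType) m n p (A : T -> 'M[R]_(m, n))
  (B : T -> 'M[R]_(n, p)) i j :
  (forall i j, continuous (fun x => A x i j)) ->
  (forall i j, continuous (fun x => B x i j)) ->
  continuous (fun x => (A x *m B x) i j).
Proof.
move=> cA cB; under eq_fun do rewrite mxE.
by apply: cts_sum => k _; apply: ctsM; [exact: cA|exact: cB].
Qed.

Section dot.
Context {n : nat}.
Implicit Types x y z : 'rV[R]_n.

Definition dot x y : R := \sum_i x 0 i * y 0 i.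

Lemma dotC x y : dot x y = dot y x.
Proof. by apply: eq_bigr => i _; rewrite mulrC. Qed.

Lemma dotDl x y z : dot (x + y) z = dot x z + dot y z.
Proof. by rewrite -big_split; apply: eq_bigr => i _; rewrite mxE mulrDl. Qed.

Lemma dotDr x y z : dot x (y + z) = dot x y + dot x z.
Proof. by rewrite dotC dotDl !(dotC _ x). Qed.

Lemma dotZl a x z : dot (a *: x) z = a * dot x z.
Proof. by rewrite mulr_sumr; apply: eq_bigr => i _; rewrite mxE mulrA. Qed.

Lemma dotZr a x z : dot x (a *: z) = a * dot x z.
Proof. by rewrite dotC dotZl dotC. Qed.

Lemma dotNl x z : dot (- x) z = - dot x z.
Proof. by rewrite -scaleN1r dotZl mulN1r. Qed.

Lemma dotNr x z : dot x (- z) = - dot x z.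
Proof. by rewrite dotC dotNl dotC. Qed.

Lemma dotBl x y z : dot (x - y) z = dot x z - dot y z.
Proof. by rewrite dotDl dotNl. Qed.

Lemma dotBr x y z : dot x (y - z) = dot x y - dot x z.
Proof. by rewrite dotDr dotNr. Qed.

Lemma dot0l x : dot 0 x = 0.
Proof. by rewrite -(scale0r 0) dotZl mul0r. Qed.

Lemma dot0r x : dot x 0 = 0.
Proof. by rewrite dotC dot0l. Qed.

Definition dotE := (dotDl, dotDr, dotNl, dotNr, dotZl, dotZr, dot0l, dot0r).

Lemma dot_ge0 x : 0 <= dot x x.
Proof. by apply: sumr_ge0 => i _; rewrite -expr2 sqr_ge0. Qed.

Lemma dotE_mx x y : dot x y = (x *m y^T) 0 0.
Proof. by rewrite mxE; apply: eq_bigr => i _; rewrite mxE. Qed.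

Lemma enormE x : enorm x = Num.sqrt (dot x x).
Proof. by []. Qed.

Lemma enorm_ge0 x : 0 <= enorm x.
Proof. exact: sqrtr_ge0. Qed.

Lemma sqr_enorm x : enorm x ^+ 2 = dot x x.
Proof. by rewrite sqr_sqrtr // dot_ge0. Qed.

Lemma norm_le_enorm x : `|x| <= enorm x.
Proof.
apply: ler_mx_normP => [|i j]; first exact: enorm_ge0.
rewrite (ord1 i) -(@ler_pXn2r _ 2) ?nnegrE ?normr_ge0 ?enorm_ge0 //.
rewrite sqr_enorm -normrX ger0_norm ?sqr_ge0 // /dot (bigD1 j) //= expr2 lerDl.
by apply: sumr_ge0 => k _; rewrite -expr2 sqr_ge0.
Qed.

Lemma dot_le_norm x y : `|dot x y| <= n%:R * (`|x| * `|y|).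
Proof.
apply: (le_trans (ler_norm_sum _ _ _)).
apply: (@le_trans _ _ (\sum_(i < n) `|x| * `|y|)); last first.
  by rewrite sumr_const card_ord mulr_natl.
by apply: ler_sum => i _; rewrite normrM ler_pM // ler_mx_norm_coord.
Qed.

Lemma sqr_norm_le_dot x : `|x| ^+ 2 <= dot x x.
Proof.
by rewrite -sqr_enorm ler_pXn2r ?nnegrE ?normr_ge0 ?enorm_ge0 // norm_le_enorm.
Qed.

Lemma enorm_le_norm x : enorm x <= n%:R * `|x|.
Proof.
rewrite -(@ler_pXn2r _ 2) ?nnegrE ?enorm_ge0 ?mulr_ge0 // sqr_enorm.
apply: le_trans (ler_norm _) _; apply: (le_trans (dot_le_norm _ _)).
rewrite exprMn -expr2 ler_wpM2r ?sqr_ge0 //.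
have [->|n0] := posnP n; first by rewrite expr0n.
by rewrite -natrX ler_nat expnS expn1 leq_pmulr.
Qed.

Lemma cauchy_schwarz x y : dot x y <= enorm x * enorm y.
Proof.
have [y0|y0] := eqVneq (dot y y) 0.
  have yE : y = 0.
    apply/eqP; rewrite -normr_eq0 -sqrf_eq0 eq_le sqr_ge0 andbT.
    by rewrite (le_trans (sqr_norm_le_dot _)) // y0.
  by rewrite yE dot0r mulr_ge0 // enorm_ge0.
have yp : 0 < dot y y by rewrite lt_def y0 dot_ge0.
have := dot_ge0 (dot y y *: x - dot x y *: y).
rewrite !dotE (dotC y x) => h.
have {}h : 0 <= dot y y * (dot x x * dot y y - dot x y ^+ 2).
  by apply: le_trans h _; rewrite le_eqVlt; apply/orP; left; apply/eqP; ring.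
move: h; rewrite pmulr_rge0 // subr_ge0 => h.
apply: (le_trans (ler_norm _)).
rewrite -(@ler_pXn2r _ 2) ?nnegrE ?mulr_ge0 ?enorm_ge0 //.
by rewrite -normrX ger0_norm ?sqr_ge0 // exprMn !sqr_enorm.
Qed.

Lemma cauchy_schwarzN x y : - (enorm x * enorm y) <= dot x y.
Proof.
have := cauchy_schwarz (- x) y.
have -> : enorm (- x) = enorm x by rewrite !enormE dotNl dotNr opprK.
by rewrite dotNl; lra.
Qed.

Lemma enormN x : enorm (- x) = enorm x.
Proof. by rewrite !enormE dotNl dotNr opprK. Qed.

Lemma enormD x y : enorm (x + y) <= enorm x + enorm y.
Proof.
rewrite -(@ler_pXn2r _ 2) ?nnegrE ?addr_ge0 ?enorm_ge0 // sqr_enorm !dotE (dotC y x).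
have := cauchy_schwarz x y; rewrite -!sqr_enorm; nra.
Qed.

Lemma enormB x y : enorm (x - y) <= enorm x + enorm y.
Proof. by rewrite -(enormN y) enormD. Qed.

Lemma enormZ a x : enorm (a *: x) = `|a| * enorm x.
Proof.
rewrite !enormE dotZl dotZr mulrA -expr2 sqrtrM ?sqr_ge0 //.
by rewrite sqrtr_sqr.
Qed.

Lemma enorm0 : enorm (0 : 'rV[R]_n) = 0.
Proof. by rewrite enormE dot0l sqrtr0. Qed.

Lemma enorm_eq0 x : enorm x = 0 -> x = 0.
Proof.
move=> h; apply/eqP; rewrite -normr_eq0 eq_le normr_ge0 andbT.
by rewrite (le_trans (norm_le_enorm _)) // h.
Qed.

Lemma enorm_gt0 x : x != 0 -> 0 < enorm x.
Proof.
move=> x0; rewrite lt_def enorm_ge0 andbT.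
by apply: contra x0 => /eqP/enorm_eq0/eqP.
Qed.

Lemma dot_gt0 x : x != 0 -> 0 < dot x x.
Proof. by move=> x0; rewrite -sqr_enorm exprn_gt0 // enorm_gt0. Qed.

Lemma coord_le_enorm x i : `|x 0 i| <= enorm x.
Proof. exact: le_trans (ler_mx_norm_coord _ _ _) (norm_le_enorm _). Qed.

Lemma cts_dot (T : topologicalType) (f g : T -> 'rV[R]_n) :
  (forall i, continuous (fun t => f t 0 i)) ->
  (forall i, continuous (fun t => g t 0 i)) ->
  continuous (fun t => dot (f t) (g t)).
Proof. by move=> cf cg; apply: cts_sum => i _; apply: ctsM. Qed.

Lemma cts_sqrt : continuous (Num.sqrt : R -> R).
Proof. exact: sqrt_continuous. Qed.

Lemma cts_enorm : continuous (fun x => enorm x).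
Proof.
apply: (@cts_comp _ _ _ Num.sqrt (fun x => dot x x)); first exact: cts_sqrt.
by apply: cts_dot => i; exact: cts_coord.
Qed.

End dot.
End rowvectors.

(** * Borel measurability of continuous functions on tuples *)

Section measurability.
Context {R : realType}.
Local Notation T := (measurableTypeR R).

(** The sigma-algebra on tuples is generated by the coordinates, so an open set has to be written as
    a countable union of boxes: those of rational centre and radius [1/(k+1)] that it contains. *)
Lemma measurable_row_of_tuple_open n (U : set 'rV[R]_n) : open U ->
  measurable ((@row_of_tuple R n) @^-1` U).
Proof.
move=> oU.
pose box (p : 'rV[rat]_n * nat) : set 'rV[R]_n :=
  [set x | forall i, `|x 0 i - ratr (p.1 0 i)| < p.2.+1%:R^-1].
have -> : row_of_tuple (n := n) @^-1` U =
    \bigcup_p (if `[< box p `<=` U >] then row_of_tuple (n := n) @^-1` box p else set0).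
  apply/seteqP; split => [t /= Ut|t [p _]]; last by case: asboolP => // h /h.
  have := oU; rewrite openE => /(_ _ Ut) /nbhs_ballP[e /= e0 eU].
  have [k ke] : exists k : nat, k.+1%:R^-1 < e / 2.
    have e2 : 0 < e / 2 by rewrite divr_gt0.
    by have [k hk] := ltr_add_invr e2; exists k; rewrite add0r in hk.
  have k0 : (0 : R) < k.+1%:R^-1 by rewrite invr_gt0.
  have Q i : exists q : rat, `|row_of_tuple t 0 i - ratr q| < k.+1%:R^-1.
    have [|q] := @rat_in_itvoo R (row_of_tuple t 0 i - k.+1%:R^-1) (row_of_tuple t 0 i + k.+1%:R^-1).
      by rewrite ltrBlDr -addrA ltrDl addr_gt0.
    rewrite in_itv /= => /andP[q1 q2]; by exists q; rewrite distrC ltr_distl q1 q2.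
  have {Q}[q Q] := choice Q.
  exists (\row_i q i, k) => //=; case: asboolP => [_ i|[]] /=; first by rewrite mxE; exact: Q.
  move=> y /= hy; apply: eU; rewrite mx_norm_ball /ball_ /=.
  apply: ltr_mx_normP => // i j; rewrite (ord1 i).
  have /= h1 := Q j; have := hy j; rewrite /= (mxE _ (fun _ => q)) => h2.
  rewrite (_ : (row_of_tuple t - y) 0 j =
    (row_of_tuple t 0 j - ratr (q j)) - (y 0 j - ratr (q j))); last by rewrite !mxE; ring.
  apply: (le_lt_trans (ler_normB _ _)); rewrite [ltRHS]splitr.
  by apply: ltrD; [exact: lt_trans h1 ke|exact: lt_trans h2 ke].
apply: countable_bigcupT_measurable => // p; case: asboolP => _ //.
rewrite (_ : _ @^-1` _ = \big[setI/setT]_(i < n)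
   ((@tnth _ T ^~ i) @^-1` (ball (ratr (p.1 0 i) : R) (p.2.+1%:R^-1 : R)))).
  apply: bigsetI_measurable => i _.
  rewrite -[X in measurable X]setTI; apply: measurable_tnth => //.
  by rewrite ball_itv; exact: measurable_itv.
rewrite -bigcap_seq; apply/seteqP; split => t /= h i.
  by move=> _; have := h i; rewrite mxE /ball /= distrC.
by have := h i; rewrite /ball /= mem_index_enum mxE distrC; apply.
Qed.

Lemma measurable_cts n (F : 'rV[R]_n -> R) : continuous F ->
  measurable_fun setT (fun t : n.-tuple T => F (row_of_tuple t)).
Proof.
move=> /continuousP cF; apply: (measurability _ (RGenOpens.measurableE R)).
move=> _ [_ [a [b ->] <-]]; rewrite setTI.
have o : open (F @^-1` `]a, b[) by apply: cF; exact: interval_open.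
exact: (measurable_row_of_tuple_open o).
Qed.

End measurability.

(** * Lebesgue integrals on R^n and Tonelli in one coordinate *)

Section lint.
Context {R : realType}.
Local Notation T := (measurableTypeR R).
Local Notation Leb := (lebesgue_tuple R).

Definition lint n (F : 'rV[R]_n -> R) : \bar R :=
  (\int[Leb n]_t (F (row_of_tuple t))%:E)%E.

Definition cns n (s : R) (x : 'rV[R]_n) : 'rV[R]_n.+1 := row_mx s%:M x.

Lemma cns0 n s (x : 'rV[R]_n) : cns s x 0 0 = s.
Proof.
have -> : (0 : 'I_n.+1) = lshift n (0 : 'I_1) by apply/val_inj.
by rewrite [LHS]row_mxEl mxE eqxx.
Qed.

Lemma cnsS n s (x : 'rV[R]_n) i : cns s x 0 (lift 0 i) = x 0 i.
Proof.
have -> : lift 0 i = rshift 1 i by apply/val_inj.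
by rewrite [LHS]row_mxEr.
Qed.

Lemma row_of_tuple_cons n (s : T) (t : n.-tuple T) :
  row_of_tuple [tuple of s :: t] = cns s (row_of_tuple t).
Proof.
apply/rowP => i; case: (unliftP 0 i) => [j|] ->; rewrite mxE.
  by rewrite cnsS tnthS mxE.
by rewrite cns0.
Qed.

Lemma measurable_cts_cns n (F : 'rV[R]_n.+1 -> R) : continuous F ->
  measurable_fun setT (fun p : T * n.-tuple T => F (cns p.1 (row_of_tuple p.2))).
Proof.
move=> cF.
rewrite (_ : (fun p => _) = (fun t : n.+1.-tuple T => F (row_of_tuple t)) \o
   (fun p : T * n.-tuple T => [the n.+1.-tuple T of p.1 :: p.2])); last first.
  by apply/funext => -[s t] /=; rewrite row_of_tuple_cons.
apply: measurableT_comp; first exact: measurable_cts.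
exact: measurable_cons measurable_fst measurable_snd.
Qed.

Lemma lint_cns1 n (F : 'rV[R]_n.+1 -> R) : continuous F ->
  (forall x, 0 <= F x) ->
  lint F = (\int[@lebesgue_measure R]_s lint (fun x : 'rV[R]_n => F (cns s x)))%E.
Proof.
move=> cF F0; rewrite /lint /=.
rewrite ge0_integral_pushforward //=; last 3 first.
- exact: measurable_cons measurable_fst measurable_snd.
- by apply/measurable_EFinP; exact: measurable_cts.
- by move=> t _; rewrite lee_fin.
rewrite fubini_tonelli1 /=; last 2 first.
- apply/measurable_EFinP.
  apply: (@measurableT_comp _ _ _ _ _ _ (fun t : n.+1.-tuple T => F (row_of_tuple t)) _
    (fun p : T * n.-tuple T => [the n.+1.-tuple T of p.1 :: p.2])).
    exact: measurable_cts.
  exact: measurable_cons measurable_fst measurable_snd.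
- by move=> t; rewrite lee_fin.
by apply: eq_integral => s _; apply: eq_integral => t _ /=; rewrite row_of_tuple_cons.
Qed.

Lemma lint_cns2 n (F : 'rV[R]_n.+1 -> R) : continuous F ->
  (forall x, 0 <= F x) ->
  lint F = (\int[Leb n]_t \int[@lebesgue_measure R]_s (F (cns s (row_of_tuple t)))%:E)%E.
Proof.
move=> cF F0; rewrite lint_cns1 // /lint.
rewrite (fubini_tonelli (fun p : T * n.-tuple T => (F (cns p.1 (row_of_tuple p.2)))%:E)) //.
- by apply/measurable_EFinP; exact: measurable_cts_cns.
- by move=> p; rewrite lee_fin.
Qed.

End lint.

(** * Change of variables on the line *)

Section changevar1.
Context {R : realType}.
Local Notation mu := (@lebesgue_measure R).

Definition smono (e : R) (g : R -> R) := forall s t, e * (s - t) ^+ 2 <= (g s - g t) * (s - t).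

Lemma smono_lt e g s t : 0 < e -> smono e g -> s < t -> g s < g t.
Proof.
move=> e0 sg st; have h := sg t s.
have ts : 0 < t - s by rewrite subr_gt0.
rewrite -subr_gt0 -(pmulr_lgt0 _ ts); apply: lt_le_trans h.
by rewrite mulr_gt0 // exprn_gt0.
Qed.

Lemma smono_ge e g t : 0 < e -> smono e g -> 0 <= t -> g 0 + e * t <= g t.
Proof.
move=> e0 sg; rewrite le_eqVlt => /predU1P[<-|t0]; first by rewrite mulr0 addr0.
have := sg t 0; rewrite subr0 expr2 mulrA ler_pM2r //; lra.
Qed.

Lemma smono_le e g t : 0 < e -> smono e g -> 0 <= t -> g (- t) <= g 0 - e * t.
Proof.
move=> e0 sg; rewrite le_eqVlt => /predU1P[<-|t0].
  by rewrite oppr0 mulr0 subr0.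
have := sg 0 (- t); rewrite opprK add0r expr2 mulrA ler_pM2r //; lra.
Qed.

Lemma smono_enclose e g r : 0 < e -> smono e g ->
  exists k : nat, g (- k%:R) <= r <= g k%:R.
Proof.
move=> e0 sg.
have k0 : 0 <= `|r - g 0| / e by rewrite divr_ge0 // ltW.
exists (Num.bound (`|r - g 0| / e)).
have /ltW := archi_boundP k0; set k := _%:R; rewrite ler_pdivrMr // mulrC => ek.
have hk : g 0 + e * k <= g k by apply: smono_ge e0 sg _; rewrite ler0n.
have hk' : g (- k) <= g 0 - e * k by apply: smono_le e0 sg _; rewrite ler0n.
move: ek; rewrite ler_norml => /andP[ek1 ek2].
by apply/andP; split; lra.
Qed.

Lemma smono_surj e g : 0 < e -> smono e g -> continuous g -> forall r, exists s, g s = r.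
Proof.
move=> e0 sg cg r; have [k /andP[h1 h2]] := smono_enclose r e0 sg.
have kk : - (k%:R : R) <= k%:R by have := ler0n R k; lra.
have [|s _ <-] := IVT kk (continuous_subspaceT cg) (v := r).
  by rewrite ge_min le_max h1 h2 orbT.
by exists s.
Qed.

(** Substitution on [[-k, k]], then monotone convergence on both sides. The intervals [[g(-k), g k]]
    exhaust the line because strong monotonicity makes [g] grow at least linearly at both ends. *)
Lemma smono_cov (e : R) (g dg psi : R -> R) : 0 < e -> smono e g ->
  (forall s : R, is_derive s (1 : R) g (dg s)) -> continuous dg ->
  (forall s, 0 <= dg s) ->
  continuous psi -> (forall x, 0 <= psi x) ->
  (\int[mu]_s (psi (g s) * dg s)%:E = \int[mu]_s (psi s)%:E)%E.
Proof.
move=> e0 sg gd cdg dg0 cpsi psi0.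
have cg : continuous g.
  by move=> x; apply/differentiable_continuous/derivable1_diffP; case: (gd x).
have dgE : derive1 g = dg.
  by apply/funext => x; rewrite derive1E; case: (gd x).
have subst (a b : R) : a <= b -> (\int[mu]_(x in `[g a, g b]) (psi x)%:E =
    \int[mu]_(x in `[a, b]) (psi (g x) * dg x)%:E)%E.
  move=> ab.
  rewrite (@integration_by_substitution_increasing _ g psi a b) //.
  - by rewrite dgE.
  - by move=> x y _ _; exact: smono_lt e0 sg.
  - by rewrite dgE => x _; exact: cdg.
  - rewrite dgE; apply/cvg_ex; exists (dg a).
    by apply: cvg_at_right_filter; exact: cdg.
  - rewrite dgE; apply/cvg_ex; exists (dg b).
    by apply: cvg_at_left_filter; exact: cdg.
  - split.
    + by move=> x _; case: (gd x).
    + by apply: cvg_at_right_filter; exact: cg.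
    + by apply: cvg_at_left_filter; exact: cg.
  - exact: continuous_subspaceT.
pose A (k : nat) := `[(- k%:R : R)%R, k%:R]%classic : set (measurableTypeR R).
pose B (k : nat) := `[g (- k%:R), g k%:R]%classic : set (measurableTypeR R).
have TA : \bigcup_k A k = setT.
  apply/seteqP; split => // x _; exists (Num.bound `|x|) => //=.
  have := archi_boundP (normr_ge0 x); rewrite /A /= in_itv /= ltr_norml => /andP[h1 h2].
  by rewrite !ltW.
have TB : \bigcup_k B k = setT.
  apply/seteqP; split => // x _; have [k h] := smono_enclose x e0 sg.
  by exists k => //; rewrite /B /= in_itv.
have ndA : nondecreasing_seq A.
  move=> m n mn; rewrite subsetEset /A; apply: subset_itv; rewrite bnd_simp ?lerN2 ler_nat //.
have ndB : nondecreasing_seq B.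
  have gm x y : x <= y -> g x <= g y.
    by rewrite le_eqVlt => /predU1P[->//|xy]; apply/ltW/(smono_lt e0 sg).
  move=> m n mn; rewrite subsetEset /B; apply: subset_itv; rewrite bnd_simp; apply: gm.
    by rewrite lerN2 ler_nat.
  by rewrite ler_nat.
have mpsi : measurable_fun setT psi by exact: continuous_measurable_fun.
have mpg : measurable_fun setT (fun x => psi (g x) * dg x).
  apply: continuous_measurable_fun; apply: ctsM => //; exact: cts_comp.
have cA := @ge0_nondecreasing_set_cvg_integral _ _ _ A (fun x => (psi (g x) * dg x)%:E) mu ndA.
have cB := @ge0_nondecreasing_set_cvg_integral _ _ _ B (fun x => (psi x)%:E) mu ndB.
rewrite TA in cA; rewrite TB in cB.
have {}cA : (\int[mu]_(x in A i) (psi (g x) * dg x)%:E @[i --> \oo] --> \int[mu]_x (psi (g x) * dg x)%:E)%E.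
  apply: cA => [i|i|i x _]; first exact: measurable_itv.
    by apply/measurable_EFinP; exact: measurable_funTS.
  by rewrite lee_fin mulr_ge0.
have {}cB : (\int[mu]_(x in B i) (psi x)%:E @[i --> \oo] --> \int[mu]_x (psi x)%:E)%E.
  apply: cB => [i|i|i x _]; first exact: measurable_itv.
    by apply/measurable_EFinP; exact: measurable_funTS.
  by rewrite lee_fin.
rewrite -(cvg_lim _ cA) // -(cvg_lim _ cB) //; congr (limn _).
by apply/funext => k; rewrite [RHS]subst //; have := ler0n R k; lra.
Qed.
End changevar1.

(** * Translation and rotation invariance of Lebesgue measure *)

Section lint_theory.
Context {R : realType}.
Local Notation T := (measurableTypeR R).
Local Notation Leb := (lebesgue_tuple R).

Definition rsub n (x : 'rV[R]_n.+1) : 'rV[R]_n := \row_i x 0 (lift 0 i).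

Lemma cnsE n (x : 'rV[R]_n.+1) : cns (x 0 0) (rsub x) = x.
Proof.
apply/rowP => i; case: (unliftP 0 i) => [j|] ->; last by rewrite cns0.
by rewrite cnsS mxE.
Qed.

Lemma cnsD n s r (x y : 'rV[R]_n) : cns s x + cns r y = cns (s + r) (x + y).
Proof.
apply/rowP => i; case: (unliftP 0 i) => [j|] ->; rewrite mxE.
  by rewrite !cnsS mxE.
by rewrite !cns0.
Qed.

Lemma cnsB n s r (x y : 'rV[R]_n) : cns s x - cns r y = cns (s - r) (x - y).
Proof.
apply/rowP => i; case: (unliftP 0 i) => [j|] ->; rewrite mxE [X in _ + X]mxE.
  by rewrite !cnsS !mxE.
by rewrite !cns0.
Qed.

Lemma cts_cns (U : topologicalType) n (f : U -> R) (g : U -> 'rV[R]_n) :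
  continuous f -> continuous g -> continuous (fun x => cns (f x) (g x)).
Proof.
move=> cf cg; apply: cts_mx => i j; rewrite (ord1 i).
case: (unliftP 0 j) => [k|] ->; last by under eq_fun do rewrite cns0.
under eq_fun do rewrite cnsS.
by apply: (@cts_comp _ _ _ (fun A : 'rV[R]_n => A 0 k)) => //; exact: cts_coord.
Qed.

Lemma ctsDv (U : topologicalType) n (f g : U -> 'rV[R]_n) :
  continuous f -> continuous g -> continuous (fun x => f x + g x).
Proof. by move=> cf cg x; apply: cvgD; [exact: cf|exact: cg]. Qed.

Lemma ctsBv (U : topologicalType) n (f g : U -> 'rV[R]_n) :
  continuous f -> continuous g -> continuous (fun x => f x - g x).
Proof. by move=> cf cg x; apply: cvgB; [exact: cf|exact: cg]. Qed.

Lemma ctsZv (U : topologicalType) n (c : R) (g : U -> 'rV[R]_n) :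
  continuous g -> continuous (fun x => c *: g x).
Proof. by move=> cg x; apply: cvgZr; exact: cg. Qed.

Lemma cts_id (U : topologicalType) : continuous (fun x : U => x).
Proof. by move=> x; exact: cvg_id. Qed.

Lemma cts_mulmxr n m (A : 'M[R]_(n, m)) : continuous (fun x : 'rV[R]_n => x *m A).
Proof.
apply: cts_mx => i j; apply: cts_mulmx => k l; last exact: ctsC.
exact: cts_coord.
Qed.

Lemma eq_lint n (F G : 'rV[R]_n -> R) : F =1 G -> lint F = lint G.
Proof. by move=> h; apply: eq_integral => t _; rewrite h. Qed.

(** Induction on the dimension: the first coordinate is shifted by [smono_cov] with slope 1,
    integrated innermost, and the others by the inductive hypothesis, with the first coordinate
    outermost. *)
Lemma lint_translate n (F : 'rV[R]_n -> R) (a : 'rV[R]_n) : continuous F ->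
  (forall x, 0 <= F x) -> lint (fun x => F (x + a)) = lint F.
Proof.
elim: n F a => [|n IH] F a cF F0.
  by apply: eq_lint => x; congr F; apply/rowP => -[].
have cFa : continuous (fun x : 'rV[R]_n.+1 => F (x + a)).
  by apply: cts_comp cF _; apply: ctsDv; [exact: cts_id|exact: cst_continuous].
rewrite lint_cns2 //.
transitivity (\int[Leb n]_t \int[@lebesgue_measure R]_s
    (F (cns s (row_of_tuple t + rsub a)))%:E)%E.
  apply: eq_integral => t _.
  have dd (s : R) : is_derive s (1 : R) (fun s : R => s + a 0 0) 1.
    by rewrite -[X in is_derive _ _ _ X]addr0; apply: is_deriveD.
  rewrite -(smono_cov (e := 1) (psi := fun s => F (cns s (row_of_tuple t + rsub a))) _ _ dd) //.
  - apply: eq_integral => s _; rewrite mulr1; congr (F _)%:E.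
    by rewrite -cnsD cnsE.
  - by move=> s r; rewrite mul1r expr2 [in leRHS]opprD addrACA subrr addr0.
  - by move=> s; exact: cst_continuous.
  - by apply: cts_comp cF _; apply: cts_cns; [exact: cts_id|exact: cst_continuous].
pose G (x : 'rV[R]_n.+1) := F (x + cns 0 (rsub a)).
have cG : continuous G.
  by apply: cts_comp cF _; apply: ctsDv; [exact: cts_id|exact: cst_continuous].
have G0 x : 0 <= G x by exact: F0.
transitivity (lint G).
  rewrite [RHS](lint_cns2 cG G0).
  by apply: eq_integral => t _; apply: eq_integral => s _; rewrite /G cnsD addr0.
rewrite [LHS](lint_cns1 cG G0) [RHS](lint_cns1 cF F0).
apply: eq_integral => s _.
rewrite -(IH (fun x => F (cns s x)) (rsub a)) //; last first.
  by apply: cts_comp cF _; apply: cts_cns; [exact: cst_continuous|exact: cts_id].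
by apply: eq_lint => x; rewrite /G cnsD addr0.
Qed.

Lemma lintZ n (F : 'rV[R]_n -> R) k : continuous F -> (forall x, 0 <= F x) ->
  0 <= k -> lint (fun x => k * F x) = (k%:E * lint F)%E.
Proof.
move=> cF F0 k0; rewrite /lint; under eq_integral do rewrite EFinM.
rewrite ge0_integralZl // ?lee_fin //.
- by apply/measurable_EFinP; exact: measurable_cts.
- by move=> x _; rewrite lee_fin.
Qed.

Definition cube n (r : R) : set (n.-tuple T) := [set t | forall i, tnth t i \in `[- r, r]].

Lemma measurable_cube n r : measurable (@cube n r).
Proof.
rewrite (_ : cube _ = \big[setI/setT]_(i < n) ((@tnth _ T ^~ i) @^-1` `[- r, r])).
  apply: bigsetI_measurable => i _.
  by rewrite -[X in measurable X]setTI; apply: measurable_tnth.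
rewrite -bigcap_seq /=; apply/seteqP; split => t /= h i.
  by move=> _; exact: h.
by apply: (h i); rewrite /= mem_index_enum.
Qed.

Lemma lebesgue_cube n r : 0 <= r -> Leb n (cube r) = ((2 * r) ^+ n)%:E.
Proof.
move=> r0; rewrite (@lebesgue_tuple_box R n (fun=> `[- r, r]%classic)) //.
rewrite (eq_bigr (fun=> (2 * r)%:E)) => [|i _]; last first.
  rewrite lebesgue_measure_itv /= lte_fin; case: ifPn => h.
    by rewrite -EFinD; congr _%:E; lra.
  by congr _%:E; lra.
by rewrite prodEFin prodr_const card_ord.
Qed.

Lemma cubeP n r (t : n.-tuple T) : 0 <= r -> cube r t <-> `|row_of_tuple t| <= r.
Proof.
move=> r0; split => [h|h i].
  apply: ler_mx_normP => // i j; rewrite mxE ler_norml.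
  by have := h j; rewrite in_itv.
have := le_trans (ler_mx_norm_coord _ 0 i) h; rewrite mxE ler_norml in_itv /= => ->.
by [].
Qed.

Lemma lint_le_cube n (F : 'rV[R]_n -> R) C r : continuous F -> (forall x, 0 <= F x) ->
  0 <= C -> 0 <= r -> (forall x, F x <= C) -> (forall x, r < `|x| -> F x = 0) ->
  (lint F <= (C * (2 * r) ^+ n)%:E)%E.
Proof.
move=> cF F0 C0 r0 FC Fr.
rewrite EFinM -lebesgue_cube // -integral_cst; last exact: measurable_cube.
rewrite [leRHS]integral_mkcond; apply: ge0_le_integral => //.
- by move=> x _; rewrite lee_fin.
- by apply/measurable_EFinP; exact: measurable_cts.
- apply/(measurable_restrictT _ _).1; first exact: measurable_cube.
  exact: measurable_cst.
- move=> t _; rewrite patchE; case: ifPn => [_|]; first by rewrite lee_fin.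
  rewrite notin_setE => nc; rewrite lee_fin Fr // ltNge; apply/negP => h.
  by apply: nc; exact/(cubeP _ r0).
Qed.

Lemma lint_ge_cube n (F : 'rV[R]_n -> R) c r : continuous F -> (forall x, 0 <= F x) ->
  0 <= c -> 0 <= r -> (forall x, `|x| <= r -> c <= F x) ->
  ((c * (2 * r) ^+ n)%:E <= lint F)%E.
Proof.
move=> cF F0 c0 r0 Fc.
rewrite EFinM -lebesgue_cube // -integral_cst; last exact: measurable_cube.
rewrite [leLHS]integral_mkcond; apply: ge0_le_integral => //.
- by move=> x _; rewrite patchE; case: ifP; rewrite ?lee_fin.
- apply/(measurable_restrictT _ _).1; first exact: measurable_cube.
  exact: measurable_cst.
- by apply/measurable_EFinP; exact: measurable_cts.
- move=> t _; rewrite patchE; case: ifPn; last by rewrite lee_fin.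
  by rewrite inE => h; rewrite lee_fin Fc //; exact/(cubeP _ r0).
Qed.

Lemma measurable_affine2 n (F : 'rV[R]_n -> R) (A : 'M[R]_n) : continuous F ->
  measurable_fun setT (fun p : n.-tuple T * n.-tuple T =>
    F (row_of_tuple p.1 *m A + row_of_tuple p.2)).
Proof.
move=> cF.
pose h (p : n.-tuple T * n.-tuple T) : n.-tuple T :=
  [tuple (row_of_tuple p.1 *m A) 0 i + tnth p.2 i | i < n].
rewrite (_ : (fun p => _) = (fun t => F (row_of_tuple t)) \o h); last first.
  by apply/funext => p /=; congr F; apply/rowP => i; rewrite !mxE tnth_mktuple mxE.
apply: measurableT_comp; first exact: measurable_cts.
apply/measurable_fun_tnthP => i.
rewrite (_ : _ \o _ = fun p => (row_of_tuple p.1 *m A) 0 i + tnth p.2 i); last first.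
  by apply/funext => p; rewrite /= tnth_mktuple.
apply: measurable_funD.
  apply: (@measurableT_comp _ _ _ _ _ _ (fun t => (row_of_tuple t *m A) 0 i) _ fst) => //.
  apply: (@measurable_cts R n (fun x => (x *m A) 0 i)).
  by apply: cts_mulmx => k l; [exact: cts_coord|exact: ctsC].
apply: (@measurableT_comp _ _ _ _ _ _ (fun t => tnth t i) _ snd) => //.
exact: measurable_tnth.
Qed.

Lemma On_mulr n (Q : 'M[R]_n) : On Q -> Q^T *m Q = 1%:M.
Proof. by move=> h; apply: mulmx1C. Qed.

Lemma dot_On n (Q : 'M[R]_n) x y : On Q -> dot (x *m Q) (y *m Q) = dot x y.
Proof.
by move=> h; rewrite !dotE_mx trmx_mul mulmxA -(mulmxA x) h mulmx1.
Qed.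

Lemma enorm_On n (Q : 'M[R]_n) x : On Q -> enorm (x *m Q) = enorm x.
Proof. by move=> h; rewrite !enormE dot_On. Qed.

Definition bump n (x : 'rV[R]_n) : R := Num.max 0 (1 - enorm x).

Lemma cts_max (U : topologicalType) (f g : U -> R) :
  continuous f -> continuous g -> continuous (fun x => Num.max (f x) (g x)).
Proof.
by move=> cf cg x; apply: (@continuous_max _ _ _ _ _); [exact: cf|exact: cg].
Qed.

Lemma cts_bump n : continuous (@bump n).
Proof.
apply: cts_max; first exact: ctsC.
by apply: ctsB; [exact: ctsC|exact: cts_enorm].
Qed.

Lemma lint_bump n : exists2 c : R, 0 < c & lint (@bump n) = c%:E.
Proof.
have b0 (x : 'rV[R]_n) : 0 <= bump x by rewrite le_max lexx.
have up : (lint (@bump n) <= (1 * (2 * 1) ^+ n)%:E)%E.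
  apply: lint_le_cube => //; first exact: cts_bump.
    by move=> x; rewrite ge_max ler01 lerBlDr lerDl enorm_ge0.
  move=> x x1; apply/max_idPl; rewrite subr_le0.
  by rewrite (le_trans (ltW x1)) // norm_le_enorm.
(* Points of sup norm at most [r] have Euclidean norm at most [n r <= 1/2], so the bump is at least
   [1/2] on this cube. *)
pose r : R := (2 * n.+1%:R)^-1.
have r0 : 0 < r by rewrite invr_gt0 mulr_gt0.
have lo : ((2^-1 * (2 * r) ^+ n)%:E <= lint (@bump n))%E.
  apply: lint_ge_cube => //; [exact: cts_bump|exact: ltW|].
  move=> x xr; rewrite le_max; apply/orP; right.
  have h : enorm x <= 2^-1.
    apply: (le_trans (enorm_le_norm _)).
    apply: (@le_trans _ _ (n.+1%:R * r)).
      by apply: ler_pM => //; rewrite ler_nat.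
    by rewrite /r invfM mulrCA mulfV ?mulr1.
  by lra.
have fin : lint (@bump n) \is a fin_num.
  rewrite ge0_fin_numE; first exact: le_lt_trans up (ltry _).
  by apply: integral_ge0 => x _; rewrite lee_fin.
exists (fine (lint (@bump n))); last by rewrite fineK.
rewrite -lte_fin fineK //; apply: lt_le_trans lo.
by rewrite lte_fin mulr_gt0 // exprn_gt0 // mulr_gt0.
Qed.

(* Comparing both sides after convolution with a rotation invariant bump function    *)
(* only uses translation invariance and Tonelli's theorem.                           *)
Lemma lint_rotate n (F : 'rV[R]_n -> R) Q : continuous F -> (forall x, 0 <= F x) ->
  On Q -> lint (fun x => F (x *m Q)) = lint F.
Proof.
move=> cF F0 OQ; have [c c0 cE] := lint_bump n.
have QQ := On_mulr OQ.
have b0 (x : 'rV[R]_n) : 0 <= bump x by rewrite le_max lexx.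
have cFQ : continuous (fun x : 'rV[R]_n => F (x *m Q)).
  by apply: cts_comp cF _; exact: cts_mulmxr.
suff : (c%:E * lint (fun x => F (x *m Q)) = c%:E * lint F)%E.
  move=> /(congr1 (fun z => ((c^-1)%:E * z)%E)).
  by rewrite !muleA -EFinM mulVf ?gt_eqF// !mul1e.
transitivity (\int[Leb n]_t \int[Leb n]_s
    (F (row_of_tuple s *m Q + row_of_tuple t) * bump (row_of_tuple t))%:E)%E.
  rewrite muleC -cE /lint -ge0_integralZl //; last 3 first.
  - by apply/measurable_EFinP; apply: measurable_cts; exact: cts_bump.
  - by move=> t _; rewrite lee_fin.
  - by apply: integral_ge0 => t _; rewrite lee_fin.
  apply: eq_integral => t _.
  rewrite -/(lint (fun x => F (x *m Q))) muleC -lintZ //.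
  set y := row_of_tuple t.
  rewrite -(@lint_translate _ (fun x => bump y * F (x *m Q)) (y *m Q^T)); last 2 first.
  - exact: (ctsM (@ctsC R 'rV[R]_n (bump y)) cFQ).
  - by move=> x; rewrite mulr_ge0.
  by apply: eq_integral => s _ /=; rewrite mulmxDl -mulmxA QQ mulmx1 mulrC.
rewrite -(fubini_tonelli (fun p : n.-tuple T * n.-tuple T =>
  (F (row_of_tuple p.1 *m Q + row_of_tuple p.2) * bump (row_of_tuple p.2))%:E)); last 2 first.
- apply/measurable_EFinP; apply: measurable_funM; first exact: measurable_affine2.
  apply: (@measurableT_comp _ _ _ _ _ _ (fun t => bump (row_of_tuple t)) _ snd) => //.
  by apply: measurable_cts; exact: cts_bump.
- by move=> p; rewrite lee_fin mulr_ge0.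
transitivity (\int[Leb n]_s \int[Leb n]_t
    (F (row_of_tuple t) * bump (row_of_tuple s *m - Q + row_of_tuple t))%:E)%E.
  apply: eq_integral => s _ /=; set x := row_of_tuple s.
  rewrite -/(lint (fun y => F (x *m Q + y) * bump y)).
  rewrite -/(lint (fun y => F y * bump (x *m - Q + y))).
  rewrite -(@lint_translate _ (fun y => F y * bump (x *m - Q + y)) (x *m Q)); last 2 first.
  - apply: (ctsM cF); apply: (cts_comp (@cts_bump n)).
    by apply: ctsDv; [exact: cst_continuous|exact: cts_id].
  - by move=> y; rewrite mulr_ge0.
  apply: eq_lint => y; congr *%R; first by rewrite addrC.
  by congr bump; rewrite mulmxN [RHS]addrC addrK.
rewrite (fubini_tonelli (fun p : n.-tuple T * n.-tuple T =>
  (F (row_of_tuple p.2) * bump (row_of_tuple p.1 *m - Q + row_of_tuple p.2))%:E)); last 2 first.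
- apply/measurable_EFinP; apply: measurable_funM; last by apply: measurable_affine2; exact: cts_bump.
  apply: (@measurableT_comp _ _ _ _ _ _ (fun t => F (row_of_tuple t)) _ snd) => //.
  exact: measurable_cts.
- by move=> p; rewrite lee_fin mulr_ge0.
rewrite muleC /lint -ge0_integralZr //; last 3 first.
- by apply/measurable_EFinP; exact: measurable_cts.
- by move=> t _; rewrite lee_fin.
- by rewrite lee_fin ltW.
apply: eq_integral => t _ /=; set y := row_of_tuple t.
rewrite -/(lint (fun x => F y * bump (x *m - Q + y))) lintZ //; last first.
  apply: (cts_comp (@cts_bump n)).
  by apply: ctsDv; [exact: cts_mulmxr|exact: cst_continuous].
suff E : lint (fun x => bump (x *m - Q + y)) = c%:E by rewrite E.
apply: (etrans _ (etrans (@lint_translate _ (@bump n) (- (y *m Q^T)) (@cts_bump n) b0) cE)).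
apply: eq_lint => x; rewrite /bump; congr (Num.max _ (_ - _)).
rewrite -[RHS](enorm_On _ OQ) mulmxBl -mulmxA QQ mulmx1 -enormN mulmxN opprD opprK.
by rewrite addrC addrC.
Qed.

End lint_theory.

(** * Frechet derivatives *)

Section frechet.
Context {R : realType}.

(** Vectors are rows and matrices act on the right, so [A] is the transpose of the usual Jacobian
    matrix. *)
Definition vfre n p (G : 'rV[R]_n -> 'rV[R]_p) (x : 'rV[R]_n) (A : 'M[R]_(n, p)) : Prop :=
  forall e, 0 < e -> \forall y \near x, `|G y - G x - (y - x) *m A| <= e * `|y - x|.

Lemma norm_mulmx n p (v : 'rV[R]_n) (A : 'M[R]_(n, p)) : `|v *m A| <= n%:R * (`|v| * `|A|).
Proof.
apply: ler_mx_normP => [|i j]; first by rewrite !mulr_ge0.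
rewrite mxE; apply: (le_trans (ler_norm_sum _ _ _)).
apply: (@le_trans _ _ (\sum_(k < n) `|v| * `|A|)); last first.
  by rewrite sumr_const card_ord mulr_natl.
by apply: ler_sum => k _; rewrite normrM (ord1 i) ler_pM // ler_mx_norm_coord.
Qed.

Lemma near_dist n (x : 'rV[R]_n) d : 0 < d -> \forall y \near x, `|y - x| < d.
Proof.
move=> d0; have /cvgrPdist_lt /(_ d d0) := @cvg_id _ (nbhs x).
by apply: filterS => y; rewrite distrC.
Qed.

Lemma vfre_cvg n p (G : 'rV[R]_n -> 'rV[R]_p) x A : vfre G x A -> G @ x --> G x.
Proof.
move=> h; apply/(@cvgrPdist_lt _ _ _ (nbhs x) (nbhs_filter x) G) => e e0.
pose C := 1 + n%:R * `|A|.
have C0 : 0 < C by rewrite ltr_pwDl // mulr_ge0.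
have eC : 0 < e / C by rewrite divr_gt0.
have H1 := h 1 ltr01; have H2 := near_dist x eC.
near=> y; rewrite distrC.
have h1 : `|G y - G x - (y - x) *m A| <= 1 * `|y - x| by near: y.
have h2 : `|y - x| < e / C by near: y.
rewrite -[G y - G x](subrK ((y - x) *m A)).
apply: (le_lt_trans (ler_normD _ _)).
apply: (@le_lt_trans _ _ (C * `|y - x|)).
  rewrite /C mulrDl; apply: lerD => //.
  by rewrite -mulrA [`|A| * _]mulrC norm_mulmx.
by rewrite mulrC -ltr_pdivlMr.
Unshelve. all: by end_near. Qed.

Lemma is_derive_eps (g : R -> R) s D :
  (forall e, 0 < e -> \forall r \near s, `|g r - g s - (r - s) * D| <= e * `|r - s|) ->
  is_derive s (1 : R) g D.
Proof.
move=> H.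
suff c : (fun h => h^-1 *: ((g \o shift s) (h *: (1 : R)) - g s)) @ 0^' --> D.
  by apply: DeriveDef; [apply/cvg_ex; exists D|exact: cvg_lim].
apply/cvgrPdist_le => e e0.
have /nbhs_ballP[d /= d0 hd] := H e e0.
near=> h.
have h0 : h != 0 by near: h; exact: nbhs_dnbhs_neq.
have hh : `|h| < d by near: h; exact: dnbhs0_lt.
have := hd (h + s); rewrite /ball /= opprD addrCA subrr addr0 normrN => /(_ hh).
rewrite addrK /= /shift /= => h1.
rewrite -(@ler_pM2r _ `|h|) ?normr_gt0 // -normrM; apply: le_trans h1.
rewrite -normrN le_eqVlt; apply/orP; left; apply/eqP; congr `|_|.
rewrite /GRing.scale /= mulr1; field => //.
Unshelve. all: by end_near. Qed.

End frechet.

(** * Schur complements and coercive matrices *)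

Section schur.
Context {R : realType}.

Definition ma n (A : 'M[R]_n.+1) : R := A 0 0.
Definition mb n (A : 'M[R]_n.+1) : 'rV[R]_n := ursubmx (A : 'M[R]_(1 + n, 1 + n)).
Definition mc n (A : 'M[R]_n.+1) : 'cV[R]_n := dlsubmx (A : 'M[R]_(1 + n, 1 + n)).
Definition md n (A : 'M[R]_n.+1) : 'M[R]_n := drsubmx (A : 'M[R]_(1 + n, 1 + n)).

Lemma mx_blockE n (A : 'M[R]_n.+1) :
  A = block_mx (ma A)%:M (mb A) (mc A) (md A) :> 'M[R]_(1 + n, 1 + n).
Proof.
rewrite -[LHS](@submxK _ 1 n 1 n); congr block_mx.
apply/matrixP => i j; rewrite (ord1 i) (ord1 j) !mxE eqxx mulr1n.
by congr (A _ _); apply/val_inj.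
Qed.

Lemma cns_mul n (A : 'M[R]_n.+1) s k :
  cns s k *m A = cns (s * ma A + (k *m mc A) 0 0) (s *: mb A + k *m md A).
Proof.
rewrite [in LHS](mx_blockE A) /cns.
etransitivity; first exact: (mul_row_block s%:M k (ma A)%:M (mb A) (mc A) (md A)).
have -> : s%:M *m (ma A)%:M + k *m mc A = (s * ma A + (k *m mc A) 0 0)%:M.
  by rewrite [k *m _ in LHS]mx11_scalar -scalar_mxM raddfD.
by rewrite mul_scalar_mx.
Qed.

Definition schur n (A : 'M[R]_n.+1) : R := ma A - (mb A *m invmx (md A) *m mc A) 0 0.

Lemma det_schur n (A : 'M[R]_n.+1) : md A \in unitmx -> \det A = \det (md A) * schur A.
Proof.
move=> u; rewrite [in LHS](mx_blockE A).
have -> : block_mx (ma A)%:M (mb A) (mc A) (md A) =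
    (block_mx 1%:M (mb A *m invmx (md A)) 0 1%:M : 'M[R]_(1 + n))
      *m block_mx (schur A)%:M 0 (mc A) (md A).
  rewrite mulmx_block !mul1mx !mul0mx !add0r /schur.
  rewrite mulmxKV //; congr block_mx.
  rewrite [X in _ = _ + X]mx11_scalar -raddfD /=; congr (_%:M).
  by rewrite subrK.
by rewrite det_mulmx (@det_ublock _ 1 n) (@det_lblock _ 1 n) !det1 !mul1r det_scalar1 mulrC.
Qed.

Lemma dot_cns n s r (x y : 'rV[R]_n) : dot (cns s x) (cns r y) = s * r + dot x y.
Proof.
rewrite /dot big_ord_recl !cns0; congr (_ + _).
by apply: eq_bigr => i _; rewrite !cnsS.
Qed.

Lemma norm_cns_l n s (x : 'rV[R]_n) : `|s| <= `|cns s x|.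
Proof. by rewrite -{1}(cns0 s x) ler_mx_norm_coord. Qed.

Lemma norm_cns_r n s (x : 'rV[R]_n) : `|x| <= `|cns s x|.
Proof.
by apply: ler_mx_normP => // i j; rewrite (ord1 i) -(cnsS s x) ler_mx_norm_coord.
Qed.

Lemma norm_cns n s (x : 'rV[R]_n) : `|cns s x| <= `|s| + `|x|.
Proof.
apply: ler_mx_normP => [|i j]; first by rewrite addr_ge0.
rewrite (ord1 i); case: (unliftP 0 j) => [k|] ->.
  by rewrite cnsS (le_trans (ler_mx_norm_coord _ _ _)) // lerDr.
by rewrite cns0 lerDl.
Qed.

Lemma rsub_cns n s (x : 'rV[R]_n) : rsub (cns s x) = x.
Proof. by apply/rowP => i; rewrite mxE cnsS. Qed.

Lemma rsubB n (x y : 'rV[R]_n.+1) : rsub (x - y) = rsub x - rsub y.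
Proof. by apply/rowP => i; rewrite !mxE. Qed.

Lemma norm_rsub n (x : 'rV[R]_n.+1) : `|rsub x| <= `|x|.
Proof. by rewrite -{2}(cnsE x) norm_cns_r. Qed.

Definition mxpos n (e : R) (A : 'M[R]_n) := forall v, e * `|v| ^+ 2 <= dot (v *m A) v.

Lemma mxpos_unit n e (A : 'M[R]_n) : 0 < e -> mxpos e A -> A \in unitmx.
Proof.
move=> e0 pA; rewrite -row_free_unit -kermx_eq0.
apply/eqP/row_matrixP => i; rewrite row0; set v := row i _.
have vA : v *m A = 0 by apply/sub_kermxP; exact: row_sub.
have := pA v; rewrite vA dot0l pmulr_rle0 // => h.
by apply/eqP; rewrite -normr_eq0 -sqrf_eq0 eq_le h sqr_ge0.
Qed.

Lemma mxpos_md n e (A : 'M[R]_n.+1) : mxpos e A -> 0 < e -> mxpos e (md A).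
Proof.
move=> pA e0 v; have := pA (cns 0 v); rewrite cns_mul dot_cns mulr0 add0r scale0r add0r.
apply: le_trans; rewrite ler_pM2l // ler_pXn2r ?nnegrE //.
exact: norm_cns_r.
Qed.

(** Test the quadratic form on [(1, - b d^-1)]: multiplication by [A] annihilates all coordinates
    but the first, which becomes the Schur complement. *)
Lemma mxpos_schur n e (A : 'M[R]_n.+1) : 0 < e -> mxpos e A -> e <= schur A.
Proof.
move=> e0 pA.
have u : md A \in unitmx := mxpos_unit e0 (mxpos_md pA e0).
have := pA (cns 1 (- (mb A *m invmx (md A)))).
rewrite cns_mul scale1r !mulNmx mulmxKV // subrr dot_cns dot0l addr0 mulr1 mul1r.
rewrite mxE -/(schur A); apply: le_trans.
rewrite -{1}[e]mulr1 ler_pM2l // -[leLHS](expr1n _ 2) ler_pXn2r ?nnegrE //.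
by rewrite -[leLHS]normr1 norm_cns_l.
Qed.

Lemma mxpos_det n e (A : 'M[R]_n) : 0 < e -> mxpos e A -> 0 < \det A.
Proof.
elim: n A => [|n IH] A e0 pA; first by rewrite det_mx00.
have pd : mxpos e (md A) := mxpos_md pA e0.
rewrite det_schur; last exact: mxpos_unit e0 pd.
by rewrite mulr_gt0 ?IH // (lt_le_trans e0) // mxpos_schur.
Qed.

End schur.

(** * Strongly monotone C^1 maps and their inverses *)

Section monotone_maps.
Context {R : realType}.

Record C1mono n (e : R) (G : 'rV[R]_n -> 'rV[R]_n) (J : 'rV[R]_n -> 'M[R]_n) : Prop := {
  c1_gt0 : 0 < e ;
  c1_fre : forall x, vfre G x (J x) ;
  c1_cts : forall i j, continuous (fun x => J x i j) ;
  c1_mono : forall x y, e * `|x - y| ^+ 2 <= dot (G x - G y) (x - y) }.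

Section theory.
Context {n : nat} {e : R} {G : 'rV[R]_n -> 'rV[R]_n} {J : 'rV[R]_n -> 'M[R]_n}.
Hypothesis GJ : C1mono e G J.
Let e0 : 0 < e := c1_gt0 GJ.

Lemma C1mono_cts : continuous G.
Proof. by move=> x; apply: vfre_cvg (c1_fre GJ x). Qed.

Lemma C1mono_lip x y : `|x - y| <= n%:R / e * `|G x - G y|.
Proof.
have := le_trans (c1_mono GJ x y) (le_trans (ler_norm _) (dot_le_norm _ _)).
have [->|h0] := eqVneq (x - y) 0; first by rewrite normr0 mulr_ge0 // divr_ge0 // ltW.
have p : 0 < `|x - y| by rewrite normr_gt0.
rewrite expr2 !mulrA ler_pM2r // => h.
by rewrite mulrAC ler_pdivlMr // mulrC.
Qed.

Lemma C1mono_inj : injective G.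
Proof.
move=> x y xy; have := C1mono_lip x y; rewrite xy subrr normr0 mulr0 normr_le0.
by rewrite subr_eq0 => /eqP.
Qed.

(** Divide the monotonicity inequality between [x + t v] and [x] by [t ^ 2]; the remainder of the
    differential contributes less than any given [d]. *)
Lemma C1mono_pos x : mxpos e (J x).
Proof.
move=> v; have [->|v0] := eqVneq v 0; first by rewrite normr0 expr0n mulr0 dot0r.
have nv : 0 < `|v| by rewrite normr_gt0.
apply/ler_addgt0Pl => d d0.
pose q := d / (n.+1%:R * `|v| ^+ 2).
have q0 : 0 < q by rewrite divr_gt0 // mulr_gt0 // exprn_gt0.
have /nbhs_ballP[r /= r0 hr] := c1_fre GJ x q0.
pose t := r / 2 / `|v|.
have t0 : 0 < t by rewrite !divr_gt0.
have /hr : ball x r (x + t *: v).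
  rewrite mx_norm_ball /ball_ /= opprD addrA subrr sub0r normrN normrZ gtr0_norm //.
  rewrite /t divfK ?gt_eqF //; lra.
rewrite [_ + _ - x]addrC addKr => h.
have m := c1_mono GJ (x + t *: v) x.
rewrite [x + t *: v - x]addrC addKr in m.
move: m h; move: (G _ - G x) => D m h.
have h2 : dot (D - t *: v *m J x) (t *: v) <= d * t ^+ 2.
  apply: le_trans (ler_norm _) _; apply: (le_trans (dot_le_norm _ _)).
  apply: (@le_trans _ _ (n.+1%:R * (q * `|t *: v| * `|t *: v|))).
    by apply: ler_pM => //; rewrite ?ler_nat // ?mulr_ge0 // ler_pM.
  rewrite normrZ gtr0_norm // /q le_eqVlt; apply/orP; left; apply/eqP; field.
  by rewrite gt_eqF //= addrC natr1 pnatr_eq0.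
rewrite -(@ler_pM2r _ (t ^+ 2)) ?exprn_gt0 //.
move: m h2; rewrite normrZ gtr0_norm // dotBl -scalemxAl !dotZr !dotZl exprMn; nra.
Qed.

Lemma C1mono_unit x : J x \in unitmx.
Proof. exact: mxpos_unit e0 (C1mono_pos x). Qed.

(** Monotonicity makes [H] Lipschitz, so the remainder of [G] at [H z], multiplied by the inverse
    matrix, is a first-order remainder of [H] at [z]. *)
Lemma C1mono_inv_fre H : cancel H G -> forall z, vfre H z (invmx (J (H z))).
Proof.
move=> HG z d d0; set A := J (H z).
have u : A \in unitmx := C1mono_unit _.
pose C := n%:R / e + 1.
have C0 : 0 < C by rewrite ltr_wpDl // divr_ge0 // ltW.
have lip z' : `|H z' - H z| <= C * `|z' - z|.
  apply: (le_trans (C1mono_lip _ _)); rewrite !HG ler_wpM2r //.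
  by rewrite lerDl.
pose K := n%:R * `|invmx A| + 1.
have K0 : 0 < K by rewrite ltr_wpDl // mulr_ge0.
have q0 : 0 < d / (K * C) by rewrite divr_gt0 // mulr_gt0.
have /nbhs_ballP[r /= r0 hr] := c1_fre GJ (H z) q0.
have rC : 0 < r / C by rewrite divr_gt0.
apply: filterS (near_dist z rC) => z' hz'.
have /hr : ball (H z) r (H z').
  rewrite mx_norm_ball /ball_ /= distrC (le_lt_trans (lip _)) //.
  by rewrite mulrC -ltr_pdivlMr.
rewrite !HG -/A => h.
have -> : H z' - H z - (z' - z) *m invmx A =
    - (z' - z - (H z' - H z) *m A) *m invmx A.
  move: (z' - z) (H z' - H z) => w k.
  by rewrite mulNmx mulmxBl mulmxK // opprB.
rewrite mulNmx normrN; apply: (le_trans (norm_mulmx _ _)).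
rewrite mulrCA mulrC.
apply: (@le_trans _ _ (K * (d / (K * C) * `|H z' - H z|))).
  by apply: ler_pM => //; rewrite ?mulr_ge0 // lerDl.
apply: (@le_trans _ _ (K * (d / (K * C) * (C * `|z' - z|)))).
  by rewrite ler_pM2l // ler_pM2l.
rewrite le_eqVlt; apply/orP; left; apply/eqP; field.
by rewrite !gt_eqF.
Qed.

Lemma C1mono_inv_cts H : cancel H G -> continuous H.
Proof. by move=> HG z; apply: vfre_cvg (C1mono_inv_fre HG z). Qed.

End theory.
End monotone_maps.

Arguments c1_cts {R n e G J}.

(** * Change of variables for monotone maps *)

Section change_of_variables.
Context {R : realType}.
Local Notation T := (measurableTypeR R).
Local Notation Leb := (lebesgue_tuple R).

Lemma cts_rsub n : continuous (@rsub R n).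
Proof.
apply: cts_mx => i j; under eq_fun do rewrite mxE; exact: cts_coord.
Qed.

Lemma mdE n (A : 'M[R]_n.+1) i j : md A i j = A (lift 0 i) (lift 0 j).
Proof. by rewrite /md !mxE; congr (A _ _); apply/val_inj. Qed.

Section slices.
Context {n : nat} {e : R} {G : 'rV[R]_n.+1 -> 'rV[R]_n.+1} {J : 'rV[R]_n.+1 -> 'M[R]_n.+1}.
Hypothesis GJ : C1mono e G J.
Let e0 : 0 < e := c1_gt0 GJ.

(** Freezing the first coordinate and dropping the first component gives a map in one dimension less
    that is again strongly monotone; this drives the induction on the dimension. *)
Definition slice s (x : 'rV[R]_n) := rsub (G (cns s x)).

Lemma slice_C1mono s : C1mono e (slice s) (fun x => md (J (cns s x))).
Proof.
split => //.
- move=> x d d0; have /nbhs_ballP[r /= r0 hr] := c1_fre GJ (cns s x) d0.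
  apply: filterS (near_dist x r0) => y hy.
  have cn (k : 'rV[R]_n) : `|cns 0 k| <= `|k|.
    by rewrite (le_trans (norm_cns _ _)) // normr0 add0r.
  have /hr : ball (cns s x) r (cns s y).
    rewrite mx_norm_ball /ball_ /= cnsB subrr (le_lt_trans (cn _)) //.
    by rewrite distrC.
  rewrite cnsB subrr => h; have := le_trans (norm_rsub _) h.
  rewrite !rsubB cns_mul rsub_cns scale0r add0r => h1; apply: le_trans h1 _.
  by rewrite ler_pM2l.
- move=> i j; under eq_fun do rewrite mdE.
  apply: (cts_comp (g := fun x => cns s x) (c1_cts GJ (lift 0 i) (lift 0 j))).
  by apply: cts_cns; [exact: cst_continuous|exact: cts_id].
- move=> x y; have := c1_mono GJ (cns s x) (cns s y).
  rewrite cnsB subrr -[X in dot (X - _) _]cnsE -[X in dot (_ - X) _]cnsE cnsB.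
  rewrite dot_cns mulr0 add0r; apply: le_trans.
  by rewrite ler_pM2l // ler_pXn2r ?nnegrE // norm_cns_r.
Qed.

Context {X : R -> 'rV[R]_n -> 'rV[R]_n}.
Hypothesis XK : forall s, cancel (X s) (slice s).

Lemma slice_inv_lip s w s' w' : `|X s w - X s' w'| <=
  n%:R / e * (`|w - w'| + `|slice s' (X s' w') - slice s (X s' w')|).
Proof.
apply: (le_trans (C1mono_lip (slice_C1mono s) _ _)).
rewrite XK ler_wpM2l //; first by rewrite divr_ge0 // ltW.
rewrite -[w in leLHS](subrK w') -addrA -{2}(XK s' w').
exact: ler_normD.
Qed.

(** With [X s] inverse to [slice s], this is the point of first coordinate [y 0 0] whose image
    agrees with [y] in all other coordinates. Hence [G] is the map [(s, x) -> (s, slice s x)]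
    followed by [y -> (height y, rsub y)], which changes the first coordinate only. *)
Definition fibre (y : 'rV[R]_n.+1) := cns (y 0 0) (X (y 0 0) (rsub y)).

Lemma slice_inv_cts : continuous (fun y : 'rV[R]_n.+1 => X (y 0 0) (rsub y)).
Proof.
move=> y0; apply/(@cvgrPdist_lt _ _ _ (nbhs y0) (nbhs_filter y0)) => d d0.
pose C := n%:R / e + 1.
have C0 : 0 < C by rewrite ltr_wpDl // divr_ge0 // ltW.
set X0 := X (y0 0 0) (rsub y0).
have cf : continuous (fun y : 'rV[R]_n.+1 => slice (y 0 0) X0).
  apply: (cts_comp (@cts_rsub n)); apply: (cts_comp (C1mono_cts GJ)).
  by apply: cts_cns; [exact: cts_coord|exact: cst_continuous].
have q0 : 0 < d / (2 * C) by rewrite divr_gt0 // mulr_gt0.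
have := cf y0 => /(@cvgrPdist_lt _ _ _ (nbhs y0) (nbhs_filter y0)) /(_ _ q0).
apply: filterS2 (near_dist y0 q0) => y h1 h2.
rewrite distrC; apply: (le_lt_trans (slice_inv_lip _ _ _ _)).
apply: (@le_lt_trans _ _ (C * (`|rsub y - rsub y0| + `|slice (y0 0 0) X0 - slice (y 0 0) X0|))).
  by rewrite ler_wpM2r ?addr_ge0 // lerDl.
have h3 : `|rsub y - rsub y0| < d / (2 * C) by rewrite -rsubB (le_lt_trans (norm_rsub _)).
rewrite -ltr_pdivlMl //; apply: lt_le_trans (ltrD h3 h2) _.
rewrite le_eqVlt; apply/orP; left; apply/eqP; field.
by rewrite gt_eqF.
Qed.

Lemma fibre_cts : continuous fibre.
Proof. by apply: cts_cns; [exact: cts_coord|exact: slice_inv_cts]. Qed.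

Definition height y := G (fibre y) 0 0.
(** The quotient form cancels against the Jacobian of the slice in the change of variables; its
    value is the Schur complement ([dheightE]). *)
Definition dheight y := \det (J (fibre y)) / \det (md (J (fibre y))).

Lemma height_cts : continuous height.
Proof.
apply: (cts_comp (g := fun y => G (fibre y)) (@cts_coord R 1 n.+1 0 0)).
by apply: (cts_comp (C1mono_cts GJ)); exact: fibre_cts.
Qed.

Let pos x : mxpos e (J x) := C1mono_pos GJ x.
Let upd x : md (J x) \in unitmx := mxpos_unit e0 (mxpos_md (pos x) e0).
Let detd x : 0 < \det (md (J x)) := mxpos_det e0 (mxpos_md (pos x) e0).

Lemma dheightE y : dheight y = schur (J (fibre y)).
Proof. by rewrite /dheight det_schur // mulrC mulKf // gt_eqF. Qed.

Lemma dheight_cts : continuous dheight.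
Proof.
apply: ctsM.
  by apply: cts_det => i j; apply: (cts_comp (g := fibre) (c1_cts GJ i j)); exact: fibre_cts.
apply: ctsV => [y|]; first by rewrite gt_eqF.
apply: cts_det => i j; under eq_fun do rewrite mdE.
by apply: (cts_comp (g := fibre) (c1_cts GJ _ _)); exact: fibre_cts.
Qed.

Lemma dheight_ge0 y : 0 <= dheight y.
Proof. by rewrite dheightE (le_trans (ltW e0)) // mxpos_schur. Qed.

Lemma fibreE s w : fibre (cns s w) = cns s (X s w).
Proof. by rewrite /fibre cns0 rsub_cns. Qed.

Lemma G_fibre y : G (fibre y) = cns (height y) (rsub y).
Proof.
by rewrite -[LHS]cnsE; congr cns; exact: XK.
Qed.

Lemma height_smono w : smono e (fun s => height (cns s w)).
Proof.
move=> s r; have := c1_mono GJ (fibre (cns s w)) (fibre (cns r w)).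
rewrite !G_fibre !fibreE !rsub_cns !cnsB dot_cns subrr dot0l addr0.
apply: le_trans; rewrite ler_pM2l // -[leLHS]ger0_norm ?sqr_ge0 // normrX.
by rewrite ler_pXn2r ?nnegrE // norm_cns_l.
Qed.

(** Implicit differentiation: with [w] fixed, [X s w] moves to first order by
    [- mb A *m invmx (md A)] per unit of [s], and inserting this in the first component of the
    differential leaves the Schur complement. The error is at most [K] times the remainder [r] of
    [G]. *)
Lemma height_derive s w : is_derive s (1 : R) (fun s => height (cns s w)) (dheight (cns s w)).
Proof.
apply: is_derive_eps => d d0; rewrite dheightE fibreE.
set k0 := X s w; set x0 := cns s k0; set A := J x0.
pose C1 := n%:R / e * (`|mb A| + 1).
have C10 : 0 <= C1 by rewrite mulr_ge0 ?addr_ge0 // divr_ge0 // ltW.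
pose C2 := 1 + C1.
have C20 : 0 < C2 by rewrite ltr_pwDl.
pose B := invmx (md A) *m mc A.
pose K := 1 + n%:R * `|B|.
have K0 : 0 < K by rewrite ltr_pwDl // mulr_ge0.
have q0 : 0 < d / (C2 * K) by rewrite divr_gt0 // mulr_gt0.
have /nbhs_ballP[r1 /= r10 hr1] := c1_fre GJ x0 ltr01.
have /nbhs_ballP[r2 /= r20 hr2] := c1_fre GJ x0 q0.
have nd (q : R) : 0 < q -> \forall t \near s, `|t - s| < q.
  move=> q1; have /cvgrPdist_lt /(_ q q1) := @cvg_id _ (nbhs s).
  by apply: filterS => t; rewrite distrC.
have r2C : 0 < r2 / C2 by rewrite divr_gt0.
apply: filterS2 (nd _ r10) (nd _ r2C) => t ht1 ht2.
pose k := X t w - k0.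
have nk : `|k| <= C1 * `|t - s|.
  apply: (le_trans (slice_inv_lip _ _ _ _)); rewrite subrr normr0 add0r -/k0 /C1 -[leRHS]mulrA.
  rewrite ler_wpM2l //; first by rewrite divr_ge0 // ltW.
  rewrite distrC.
  have c0 (a : R) : `|cns a (0 : 'rV[R]_n)| <= `|a|.
    by rewrite (le_trans (norm_cns _ _)) // normr0 addr0.
  have /hr1 : ball x0 r1 (cns t k0).
    rewrite mx_norm_ball /ball_ /= cnsB subrr (le_lt_trans (c0 _)) //.
    by rewrite distrC.
  rewrite mul1r /x0 cnsB subrr => /(le_trans (norm_rsub _)).
  rewrite !rsubB cns_mul rsub_cns mul0mx addr0 -/(slice _ _) -/(slice _ _) => h.
  rewrite -(subrK ((t - s) *: mb A) (slice t k0 - slice s k0)).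
  apply: (le_trans (ler_normD _ _)); rewrite addrC mulrDl mul1r.
  by apply: lerD; [rewrite normrZ mulrC|apply: le_trans h _; exact: c0].
have yE : cns t (X t w) - x0 = cns (t - s) k by rewrite cnsB.
clearbody k.
have ny : `|cns (t - s) k| <= C2 * `|t - s|.
  by rewrite (le_trans (norm_cns _ _)) // /C2 mulrDl mul1r lerD2l.
have /hr2 : ball x0 r2 (cns t (X t w)).
  rewrite mx_norm_ball /ball_ /= distrC yE (le_lt_trans ny) //.
  by rewrite mulrC -ltr_pdivlMr.
rewrite yE; set r := _ - _ - _ => hr.
have {}hr : K * `|r| <= d * `|t - s|.
  apply: (@le_trans _ _ (K * (d / (C2 * K) * (C2 * `|t - s|)))).
    by rewrite ler_pM2l // (le_trans hr) // ler_pM2l.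
  rewrite le_eqVlt; apply/orP; left; apply/eqP; field.
  by rewrite !gt_eqF.
apply: le_trans hr.
have GE : G (cns t (X t w)) - G x0 = r + cns (t - s) k *m A by rewrite subrK.
have G0 : height (cns t w) - height (cns s w) = r 0 0 + ((t - s) * ma A + (k *m mc A) 0 0).
  have := congr1 (fun v : 'rV[R]_n.+1 => v 0 0) GE.
  have subE (u v : 'rV[R]_n.+1) : (u - v) 0 0 = u 0 0 - v 0 0 by rewrite !mxE.
  have addE (u v : 'rV[R]_n.+1) : (u + v) 0 0 = u 0 0 + v 0 0 by rewrite !mxE.
  by rewrite cns_mul subE addE cns0 /height !fibreE.
(* The components of [G] other than the first stay equal to [w], so their expansion can be solved
   for the displacement [k]. *)
have G1 : k = - ((t - s) *: (mb A *m invmx (md A))) - rsub r *m invmx (md A).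
  have := congr1 (@rsub R n) GE.
  rewrite rsubB -/(slice _ _) -/(slice _ _) !XK subrr => /(congr1 (fun v => v *m invmx (md A))).
  have -> : rsub (r + cns (t - s) k *m A) = rsub r + ((t - s) *: mb A + k *m md A).
    by rewrite cns_mul -[r in LHS]cnsE cnsD rsub_cns.
  rewrite mul0mx !mulmxDl mulmxK ?upd // -scalemxAl => /esym.
  by rewrite addrA => /eqP; rewrite addr_eq0 => /eqP h; rewrite -[LHS]opprK -h opprD addrC.
rewrite G0 G1 /schur.
have -> : r 0 0 + ((t - s) * ma A + ((- ((t - s) *: (mb A *m invmx (md A))) -
   rsub r *m invmx (md A)) *m mc A) 0 0) -
   (t - s) * (ma A - (mb A *m invmx (md A) *m mc A) 0 0) = r 0 0 - (rsub r *m B) 0 0.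
  rewrite mulmxBl mulNmx -scalemxAl -!mulmxA -/B.
  move: (mb A *m B) (rsub r *m B) => U V; rewrite !mxE; ring.
apply: (le_trans (ler_normB _ _)); rewrite /K mulrDl mul1r; apply: lerD.
  exact: ler_mx_norm_coord.
apply: (le_trans (ler_mx_norm_coord _ _ _)); apply: (le_trans (norm_mulmx _ _)).
by rewrite -mulrA ler_wpM2l // mulrC ler_wpM2l // norm_rsub.
Qed.

End slices.

(** Induction on the dimension: at fixed first coordinate the inductive hypothesis replaces the
    slice by its image; then the order of integration is exchanged and [smono_cov] treats the height
    along each line. A preimage is found the same way, by solving for the height first. *)
Theorem change_of_variables n e (G : 'rV[R]_n -> 'rV[R]_n) J : C1mono e G J ->
  (exists H, cancel G H /\ cancel H G) /\
  forall psi : 'rV[R]_n -> R, continuous psi -> (forall x, 0 <= psi x) ->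
    lint (fun x => psi (G x) * \det (J x)) = lint psi.
Proof.
elim: n e G J => [|n IH] e G J GJ.
  have E (x y : 'rV[R]_0) : x = y by apply/rowP => -[].
  split; first by exists id; split => x; exact: E.
  by move=> psi _ _; apply: eq_lint => x; rewrite det_mx00 mulr1; congr psi; exact: E.
have e0 := c1_gt0 GJ.
have /choice[X hX] : forall s, exists H, cancel (slice (G := G) s) H /\ cancel H (slice (G := G) s).
  by move=> s; have [] := IH _ _ _ (slice_C1mono GJ s).
have XK s := (hX s).2; have XL s := (hX s).1.
have gder := height_derive GJ XK.
have gc w : continuous (fun s => height (G := G) (X := X) (cns s w)).
  apply: (cts_comp (height_cts GJ XK)); apply: cts_cns; last exact: cst_continuous.
  exact: cts_id.
split.
  have surj z : exists x, G x = z.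
    have [s hs] := smono_surj e0 (height_smono GJ XK (rsub z)) (gc (rsub z)) (z 0 0).
    by exists (fibre (X := X) (cns s (rsub z))); rewrite (G_fibre XK) hs rsub_cns cnsE.
  have [H HG] := choice surj; exists H; split => // x.
  by apply: (C1mono_inj GJ); rewrite HG.
move=> psi cpsi psi0.
have det0 x : 0 <= \det (J x) by apply: ltW; exact: (mxpos_det e0 (C1mono_pos GJ x)).
rewrite lint_cns1; last 2 first.
- apply: ctsM; first exact: (cts_comp cpsi (C1mono_cts GJ)).
  by apply: cts_det; exact: c1_cts GJ.
- by move=> x; rewrite mulr_ge0.
pose Phi y := psi (cns (height (G := G) (X := X) y) (rsub y)) * dheight (J := J) (X := X) y.
have cPhi : continuous Phi.
  apply: ctsM; last exact: (dheight_cts GJ XK).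
  apply: (cts_comp cpsi); apply: cts_cns; [exact: (height_cts GJ XK)|exact: cts_rsub].
have Phi0 y : 0 <= Phi y by rewrite mulr_ge0 // (dheight_ge0 GJ).
transitivity (\int[@lebesgue_measure R]_s lint (fun w : 'rV[R]_n => Phi (cns s w)))%E.
  apply: eq_integral => s _.
  have [_ /(_ (fun w => Phi (cns s w))) <-] := IH _ _ _ (slice_C1mono GJ s).
  - apply: eq_lint => x.
    rewrite /Phi rsub_cns /dheight fibreE XL -mulrA divfK; last first.
      by rewrite gt_eqF //; exact: (mxpos_det e0 (mxpos_md (C1mono_pos GJ _) e0)).
    congr (psi _ * _); rewrite -[LHS]cnsE; congr cns.
    by rewrite /height fibreE XL.
  - by apply: (cts_comp cPhi); apply: cts_cns; [exact: cst_continuous|exact: cts_id].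
  - by move=> x; exact: Phi0.
rewrite -lint_cns1 // lint_cns2 // [RHS]lint_cns2 //.
apply: eq_integral => t _; set w := row_of_tuple t.
rewrite -(smono_cov (psi := fun r => psi (cns r w)) e0 (height_smono GJ XK w) (fun s => gder s w)).
- by apply: eq_integral => s _; rewrite /Phi rsub_cns.
- apply: (cts_comp (dheight_cts GJ XK)); apply: cts_cns; last exact: cst_continuous.
  exact: cts_id.
- by move=> s; exact: (dheight_ge0 GJ).
- apply: (cts_comp cpsi); apply: cts_cns; last exact: cst_continuous.
  exact: cts_id.
- by move=> s; exact: psi0.
Qed.

Lemma change_of_variables_signed n e (G : 'rV[R]_n -> 'rV[R]_n) J (psi : 'rV[R]_n -> R) : C1mono e G J ->
  continuous psi -> lint (fun x => psi (G x) * \det (J x)) = lint psi.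
Proof.
move=> GJ cpsi.
have det0 x : 0 <= \det (J x) by apply/ltW/(mxpos_det (c1_gt0 GJ)); exact: C1mono_pos GJ x.
have [_ cov] := change_of_variables GJ.
rewrite /lint integralE [RHS]integralE; congr (_ - _)%E.
- transitivity (lint (fun x => Num.max (psi (G x)) 0 * \det (J x))).
    apply: eq_integral => t _; rewrite funeposE -EFin_max; congr _%:E.
    by rewrite maxr_pMl // mul0r.
  rewrite (cov (fun x => Num.max (psi x) 0)).
  + by apply: eq_integral => t _; rewrite funeposE -EFin_max.
  + by apply: cts_max => //; exact: ctsC.
  + by move=> x; rewrite le_max lexx orbT.
- transitivity (lint (fun x => Num.max (- psi (G x)) 0 * \det (J x))).
    apply: eq_integral => t _; rewrite funenegE -EFinN -EFin_max; congr _%:E.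
    by rewrite maxr_pMl // mul0r mulNr.
  rewrite (cov (fun x => Num.max (- psi x) 0)).
  + by apply: eq_integral => t _; rewrite funenegE -EFinN -EFin_max.
  + by apply: cts_max; [exact: ctsN|exact: ctsC].
  + by move=> x; rewrite le_max lexx orbT.
Qed.

End change_of_variables.

(** * Epi-convergence and attainment of minima *)

Section convex_analysis.
Context {R : realType} {n : nat}.
Implicit Types (u w : 'rV[R]_n -> \bar R) (x y z p : 'rV[R]_n).

Lemma real_between (a b : \bar R) : (a < b)%E -> exists M : R, (a < M%:E < b)%E.
Proof.
case: a b => [a| |] [b| |] //= ab.
- by exists ((a + b) / 2); rewrite !lte_fin in ab *; apply/andP; split; lra.
- by exists (a + 1); rewrite lte_fin ltry andbT; lra.
- by exists (b - 1); rewrite ltNyr lte_fin; lra.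
- by exists 0; rewrite ltNyr ltry.
Qed.

Lemma limn_einf_ge (v : nat -> \bar R) (M : \bar R) :
  (\forall k \near \oo, (M <= v k)%E) -> (M <= limn_einf v)%E.
Proof.
move=> [N _ h]; rewrite limn_einf_lim; apply: lime_ge; first exact: is_cvg_einfs.
exists N => // m /= Nm; apply: le_ereal_inf_tmp => _ [k /= mk <-].
by apply: h => /=; exact: leq_trans mk.
Qed.

Lemma limn_einf_le (v : nat -> \bar R) (M : \bar R) :
  (forall N, exists2 k, (N <= k)%N & (v k <= M)%E) -> (limn_einf v <= M)%E.
Proof.
move=> h; rewrite limn_einf_lim; apply: lime_le; first exact: is_cvg_einfs.
apply: nearW => m; have [k mk vk] := h m.
by apply: le_trans vk; apply: ereal_inf_lbound; exists k.
Qed.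

(* The sequential lower bound in epi_cvg, made uniform in a neighbourhood. *)
Definition ecv (u_ : nat -> 'rV[R]_n -> \bar R) u : Prop :=
  (forall x (M : R), (M%:E < u x)%E -> \forall y \near x & k \near \oo, (M%:E < u_ k y)%E) /\
  (forall x, exists2 x_ : nat -> 'rV[R]_n, x_ @ \oo --> x &
     (fun k => u_ k (x_ k)) @ \oo --> u x).

Lemma ecv_epi (u_ : nat -> _) u : ecv u_ u -> epi_cvg u_ u.
Proof.
move=> [h1 h2] x; split; last exact: h2.
move=> x_ xx; rewrite leNgt; apply/negP => lt.
have [M /andP[M1 M2]] : exists M : R, (limn_einf (fun k => u_ k (x_ k)) < M%:E < u x)%E.
  exact: (real_between lt).
have [[A B] /= [nA nB] hAB] := h1 x M M2.
move: M1; rewrite ltNge => /negP; apply; apply: limn_einf_ge.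
have nA' : \forall k \near \oo, A (x_ k) by exact: xx.
apply: filterS2 nA' nB => k Ak Bk; apply: ltW.
exact: (hAB (x_ k, k)).
Qed.

(** If the uniform lower bound failed at [x], points [y] tending to [x] with [u_ k y <= M] could be
    chosen for strictly increasing indices [k]. Completed by [x] at the other indices, they form a
    sequence tending to [x] that violates the liminf inequality. *)
Lemma epi_ecv (u_ : nat -> _) u : epi_cvg u_ u -> ecv u_ u.
Proof.
move=> h; split; last by move=> x; have [] := h x.
move=> x M Mu; apply: contrapT => nh.
have bad (m N : nat) : exists k y, [/\ (N <= k)%N, `|y - x| < m.+1%:R^-1 & (u_ k y <= M%:E)%E].
  apply: contrapT => h2; apply: nh.
  exists ([set y | `|y - x| < m.+1%:R^-1], [set k | (N <= k)%N]).
    by split; [apply: near_dist; rewrite invr_gt0|exists N].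
  move=> [y k] /= [hy hk]; rewrite ltNge; apply/negP => le; apply: h2.
  by exists k, y.
have {bad} /choice[kf] : forall mN : nat * nat, exists ky : nat * 'rV[R]_n,
    [/\ (mN.2 <= ky.1)%N, `|ky.2 - x| < mN.1.+1%:R^-1 & (u_ ky.1 ky.2 <= M%:E)%E].
  by move=> [m N]; have [k [y H]] := bad m N; exists (k, y).
move=> kfP.
pose ks := fix ks (m : nat) : nat * 'rV[R]_n :=
  if m is m'.+1 then kf (m, (ks m').1.+1) else kf (0%N, 0%N).
have ksP m : `|(ks m).2 - x| < m.+1%:R^-1 /\ (u_ (ks m).1 (ks m).2 <= M%:E)%E.
  by case: m => [|m] /=; [have [] := kfP (0%N, 0%N)|have [] := kfP (m.+1, (ks m).1.+1)].
have ksS m : ((ks m).1 < (ks m.+1).1)%N by have [] := kfP (m.+1, (ks m).1.+1).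
have ks_ge m : (m <= (ks m).1)%N.
  by elim: m => // m IH; exact: leq_ltn_trans IH (ksS m).
have ks_lt m m' : (m < m')%N -> ((ks m).1 < (ks m').1)%N.
  elim: m' => // m' IH; rewrite ltnS leq_eqVlt => /predU1P[->|/IH hh]; first exact: ksS.
  exact: ltn_trans hh (ksS _).
pose x_ k := if pselect (exists m, (ks m).1 = k) is left e then (ks (projT1 (cid e))).2 else x.
have x_ks m : x_ (ks m).1 = (ks m).2.
  rewrite /x_; case: pselect => [e|[]]; last by exists m.
  case: (cid e) => m' /= e'.
  by case: (ltngtP m m') => [/ks_lt|/ks_lt|-> //]; rewrite e' ltnn.
have xx : x_ @ \oo --> x.
  apply/cvgrPdist_lt => e e0.
  have [m hm] := ltr_add_invr e0; rewrite add0r in hm.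
  exists (ks m).1 => // k /= mk; rewrite /x_; case: pselect => [ee|_]; last by rewrite subrr normr0.
  case: (cid ee) => m' /= e'.
  have mm' : (m <= m')%N.
    by rewrite leqNgt; apply/negP => /ks_lt; rewrite e' ltnNge mk.
  rewrite distrC; apply: lt_trans hm; apply: lt_le_trans (ksP m').1 _.
  by rewrite lef_pV2 ?posrE // ler_nat.
have := (h x).1 x_ xx; rewrite leNgt => /negP; apply; apply: le_lt_trans Mu.
apply: limn_einf_le => N; exists (ks N).1 => //.
by rewrite x_ks; exact: (ksP N).2.
Qed.

Lemma ecv_gt (u_ : nat -> _) u (c : 'rV[R]_n -> R) (K : set 'rV[R]_n) : ecv u_ u -> compact K ->
  continuous c -> (forall x, K x -> ((c x)%:E < u x)%E) ->
  \forall k \near \oo, forall x, K x -> ((c x)%:E < u_ k x)%E.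
Proof.
move=> [h _] /compact_near_coveringP cK cc hc.
apply: (cK _ _ (fun k x => ((c x)%:E < u_ k x)%E)) => x Kx.
have [M /andP[M1 M2]] : exists M : R, ((c x)%:E < M%:E < u x)%E.
  exact: (real_between (hc _ Kx)).
have [[A B] /= [nA nB] hAB] := h x M M2.
exists (A `&` [set y | c y < M], B).
  split => //; apply: filterI => //.
  have /(@cvgrPdist_lt _ _ _ (nbhs x) (nbhs_filter x)) := cc x.
  move=> /(_ (M - c x)); rewrite subr_gt0 -lte_fin => /(_ M1).
  by apply: filterS => y; rewrite ltr_norml => /andP[h1 h2] /=; lra.
move=> [y k] /= [[Ay cy] Bk]; by apply: lt_trans (hAB (y, k) _).
Qed.

Lemma lsc_gt u (c : 'rV[R]_n -> R) x : lower_semicontinuous u -> continuous c ->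
  ((c x)%:E < u x)%E -> \forall y \near x, ((c y)%:E < u y)%E.
Proof.
move=> lu cc cu.
have [M /andP[M1 M2]] : exists M : R, ((c x)%:E < M%:E < u x)%E.
  exact: (real_between cu).
have [V nV hV] := lu x M M2.
have /(@cvgrPdist_lt _ _ _ (nbhs x) (nbhs_filter x)) := cc x.
move=> /(_ (M - c x)); rewrite subr_gt0 -lte_fin => /(_ M1).
apply: filterS2 nV => y Vy h; apply: lt_trans (hV _ Vy).
by move: h; rewrite ltr_norml lte_fin => /andP[h1 h2]; lra.
Qed.

Lemma compact_enorm (a : 'rV[R]_n) (r s : R) : compact [set x : 'rV[R]_n | r <= enorm (x - a) <= s].
Proof.
apply: bounded_closed_compact.
  exists (s + `|a|); split; first by rewrite num_real.
  move=> M hM x /= /andP[_ h]; rewrite -(subrK a x).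
  apply: (le_trans (ler_normD _ _)); apply: le_trans (ltW hM).
  by rewrite lerD2r (le_trans (norm_le_enorm _)).
have cf : continuous (fun x : 'rV[R]_n => enorm (x - a)).
  apply: (cts_comp (@cts_enorm R n)); apply: ctsBv; first exact: cts_id.
  exact: cst_continuous.
rewrite (_ : [set x | _] = (fun x : 'rV[R]_n => enorm (x - a)) @^-1` `[r, s]).
  by apply: (@closed_comp _ _ _ _) => [x _|]; [exact: cf|exact: itv_closed].
by apply/seteqP; split => x /=; rewrite in_itv.
Qed.

Section argmin.
Context {u : 'rV[R]_n -> \bar R} {q : 'rV[R]_n -> R}.
Hypotheses (uN : forall x, u x != -oo%E) (lu : lower_semicontinuous u) (cq : continuous q).
Variable K : set 'rV[R]_n.
Hypotheses (cK : compact K) (x0 : 'rV[R]_n) (Kx0 : K x0).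

(** Without a minimizer every point is strictly beaten by some [i], and by lower semicontinuity so
    are its neighbours. Compactness along the filter of sublevel sets then yields a point that beats
    itself. *)
Lemma compact_argmin : exists2 p, K p & forall x, K x -> (u p + (q p)%:E <= u x + (q x)%:E)%E.
Proof.
pose f x := (u x + (q x)%:E)%E.
apply: contrapT => nh.
have bad x : K x -> exists2 i, K i & (f i < f x)%E.
  move=> Kx; apply: contrapT => h; apply: nh; exists x => // y Ky.
  by rewrite leNgt; apply/negP => fy; apply: h; exists y.
pose F : set_system 'rV[R]_n := filter_from K (fun i0 => [set i | K i /\ (f i <= f i0)%E]).
have FF : Filter F.
  apply: filter_from_filter; first by exists x0.
  move=> i j Ki Kj; have [ij|ij] := leP (f i) (f j).
    by exists i => // k [Kk ki]; split; split => //; exact: le_trans ij.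
  by exists j => // k [Kk ki]; split; split => //; exact: le_trans ki (ltW ij).
have /compact_near_coveringP cov := cK.
have [|i1 Ki1 h] := cov _ F (fun i x => (f i < f x)%E) FF.
  move=> x Kx; have [i Ki fi] := bad x Kx.
  have ifin : u i \is a fin_num.
    rewrite fin_numE uN /=; apply/negP => /eqP ui.
    by move: fi; rewrite /f ui addye ?ltNge ?leey // .
  have ci : continuous (fun x => fine (u i) + q i - q x).
    by apply: ctsB => //; exact: ctsC.
  have hx : ((fine (u i) + q i - q x)%:E < u x)%E.
    move: fi; rewrite /f -(fineK ifin) -EFinD EFinB => fi.
    by rewrite lteBlDr.
  have N := lsc_gt lu ci hx.
  exists ([set y | ((fine (u i) + q i - q y)%:E < u y)%E], [set k | K k /\ (f k <= f i)%E]).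
    by split => //; exists i.
  move=> [y k] /= [hy [Kk fk]]; apply: le_lt_trans fk _.
  move: hy; rewrite EFinB lteBlDr // => hy.
  by rewrite /f -(fineK ifin) -EFinD.
by have := h i1 (conj Ki1 (lexx _)) i1 Ki1; rewrite ltxx.
Qed.

End argmin.
End convex_analysis.

(** * Subgradients and proximal points *)

Section prox.
Context {R : realType} {n : nat}.
Implicit Types (u w : 'rV[R]_n -> \bar R) (x y z p : 'rV[R]_n) (e : R).

Definition convex_ereal u := forall x y (t : R), 0 < t < 1 ->
  (u (t *: x + (1 - t) *: y)%R <= t%:E * u x + (1 - t)%:E * u y)%E.

Lemma conv_sc_convex u : conv_sc u -> convex_ereal u.
Proof. by case. Qed.

Lemma conv_sc_proper u : conv_sc u -> exists a s, u a = s%:E.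
Proof.
case=> uN [a ua] _ _ _; exists a; case E : (u a) => [s| |]; first by exists s.
  by move: ua; rewrite E eqxx.
by have := uN a; rewrite E eqxx.
Qed.

Lemma conv_sc_coercive u : conv_sc u -> forall M : R, exists r : R, forall x,
  r < enorm x -> ((M * enorm x)%:E <= u x)%E.
Proof.
case=> uN _ _ _ sc M; have [r hr] := sc M; exists (Num.max r 0) => x.
rewrite gt_max => /andP[/hr h x0].
move: h; case E : (u x) => [s| |]; last by have := uN x; rewrite E eqxx.
  by rewrite -EFinM !lee_fin ler_pdivlMr.
by rewrite leey.
Qed.

Lemma convex_real u x y a b (t : R) : (forall x, u x != -oo%E) -> convex_ereal u ->
  u x = a%:E -> u y = b%:E -> 0 < t < 1 ->
  exists2 c : R, u (t *: x + (1 - t) *: y) = c%:E & c <= t * a + (1 - t) * b.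
Proof.
move=> uN cu ux uy t01; have := cu x y t t01; rewrite ux uy -!EFinM -EFinD.
case: (u _) (uN (t *: x + (1 - t) *: y)) => [c| |]; rewrite ?eqxx // => _.
by rewrite lee_fin => h; exists c.
Qed.

Definition subgrad u x y := exists2 s : R, u x = s%:E &
  forall x', ((s + dot y (x' - x))%:E <= u x')%E.

(* p minimizes u + e/2 |.|^2 - <z, .>, expanded around p. *)
Definition amin e u z p := exists2 s : R, u p = s%:E & forall x,
  ((s + dot (z - e *: p) (x - p) - e / 2 * dot (x - p) (x - p))%:E <= u x)%E.

(** On the segment from [p] to [x], a failing subgradient inequality would lower [u] linearly in
    [t], while the quadratic term only costs order [t ^ 2]; this contradicts minimality for small
    [t]. *)
Lemma amin_sub e u z p : 0 < e -> (forall x, u x != -oo%E) -> convex_ereal u ->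
  amin e u z p -> subgrad u p (z - e *: p).
Proof.
move=> e0 uN cu [s us h]; exists s => // x.
case E : (u x) => [b| |]; [|by rewrite leey|by have := uN x; rewrite E eqxx].
rewrite lee_fin leNgt; apply/negP => lt.
set k := dot (z - e *: p) (x - p) in lt.
set D := dot (x - p) (x - p).
have D0 : 0 <= D := dot_ge0 _.
pose gap := s + k - b.
have g0 : 0 < gap by rewrite /gap subr_gt0.
pose t := gap / (gap + e * D + 1).
have den : 0 < gap + e * D + 1 by rewrite addr_gt0 // ltr_wpDr // mulr_ge0 // ltW.
have t0 : 0 < t by rewrite divr_gt0.
have t1 : t < 1.
  rewrite ltr_pdivrMr // mul1r -addrA ltrDl ltr_wpDl //.
  by rewrite mulr_ge0 // ltW.
have [|c uc ch] := @convex_real u x p b s t uN cu E us; first by rewrite t0.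
have := h (t *: x + (1 - t) *: p).
have -> : t *: x + (1 - t) *: p - p = t *: (x - p).
  by apply/rowP => i; rewrite !mxE; ring.
rewrite uc lee_fin dotZr dotZl dotZr -/k -/D => h1.
have : t * gap <= t * (t * (e / 2 * D)) by rewrite /gap; nra.
rewrite ler_pM2l // /t mulrAC ler_pdivlMr // ler_pM2l // => h2.
have : e / 2 * D <= e * D by rewrite ler_wpM2r //; lra.
lra.
Qed.

Lemma sub_amin e u z p : 0 <= e -> subgrad u p (z - e *: p) -> amin e u z p.
Proof.
move=> e0 [s us h]; exists s => // x; apply: le_trans (h x); rewrite lee_fin gerBl.
by rewrite mulr_ge0 ?divr_ge0 // dot_ge0.
Qed.

Lemma subgrad_mono u x y x' y' : subgrad u x y -> subgrad u x' y' ->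
  0 <= dot (y - y') (x - x').
Proof.
move=> [s us h] [s' us' h']; have := h x'; have := h' x; rewrite us us' !lee_fin.
rewrite !dotBl !dotBr; lra.
Qed.

Lemma subgrad_prox_lip e u z p z' p' : subgrad u p (z - e *: p) ->
  subgrad u p' (z' - e *: p') -> e * dot (p - p') (p - p') <= dot (z - z') (p - p').
Proof.
move=> h h'; have := subgrad_mono h h'.
have -> : z - e *: p - (z' - e *: p') = (z - z') - e *: (p - p').
  by apply/rowP => i; rewrite !mxE; ring.
by move: (z - z') (p - p') => a d; rewrite dotBl dotZl subr_ge0.
Qed.

Lemma dot_eq0 x : dot x x <= 0 -> x = 0.
Proof. by move=> h; apply/eqP; apply/negPn/negP => /dot_gt0; rewrite ltNge h. Qed.

Lemma subgrad_prox_uniq e u z p p' : 0 < e -> subgrad u p (z - e *: p) ->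
  subgrad u p' (z - e *: p') -> p = p'.
Proof.
move=> e0 h h'; have := subgrad_prox_lip h h'; rewrite subrr dot0l pmulr_rle0 //.
by move=> /dot_eq0/eqP; rewrite subr_eq0 => /eqP.
Qed.

Lemma cts_quad e z : continuous (fun x => e / 2 * dot x x - dot z x).
Proof.
apply: ctsB; first (apply: ctsM; first exact: ctsC).
  by apply: cts_dot => i; exact: cts_coord.
by apply: cts_dot => i; [exact: ctsC|exact: cts_coord].
Qed.

Lemma quad_expand e z p x : e / 2 * dot p p - dot z p - (e / 2 * dot x x - dot z x) =
  dot (z - e *: p) (x - p) - e / 2 * dot (x - p) (x - p).
Proof. by rewrite !dotBl !dotBr !dotZl (dotC x p); field. Qed.

Lemma amin_exists e u z : 0 < e -> conv_sc u -> exists p, amin e u z p.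
Proof.
move=> e0 cu; have [a [s us]] := conv_sc_proper cu.
have [r hr] := conv_sc_coercive cu (enorm z + 1).
case: (cu) => uN _ lu _ _.
pose q x := e / 2 * dot x x - dot z x.
(* Outside this radius [u x - <z, x>] is at least [|x|], which exceeds the value of the objective at
   [a]. *)
pose r1 := Num.max (enorm a) (Num.max r (s + q a)).
have Ka : [set x : 'rV[R]_n | 0 <= enorm (x - 0) <= r1] a.
  by rewrite /= subr0 enorm_ge0 le_max lexx.
have cq : continuous q := @cts_quad e z.
have [p Kp hp] := compact_argmin uN lu cq (@compact_enorm R n 0 0 r1) Ka.
have hpa : (u p + (q p)%:E <= s%:E + (q a)%:E)%E.
  by rewrite -us; apply: hp; rewrite /= subr0 enorm_ge0 le_max lexx.
have [sp usp] : exists sp, u p = sp%:E.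
  case E : (u p) hpa => [sp| |]; first by exists sp.
    by rewrite addye // leye_eq.
  by have := uN p; rewrite E eqxx.
exists p; exists sp => // x; rewrite -addrA -quad_expand -/(q p) -/(q x).
have [xr|xr] := leP (enorm x) r1.
  have := hp x; rewrite /= subr0 enorm_ge0 xr usp => /(_ isT).
  case: (u x) (uN x) => [b| |]; rewrite ?eqxx // => _; last by move=> _; rewrite leey.
  by rewrite -!EFinD !lee_fin; lra.
move: xr; rewrite !gt_max => /and3P[_ /hr h xs]; apply: le_trans h.
move: hpa; rewrite usp -!EFinD !lee_fin => hpa.
have := cauchy_schwarz z x; have := dot_ge0 x; rewrite /q in hpa xs *.
have : 0 <= e / 2 * dot x x by rewrite mulr_ge0 ?dot_ge0 // divr_ge0 // ltW.
rewrite mulrDl mul1r; lra.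
Qed.

(** In the usual notation, the proximal point of [u / e] at [z / e]. The default [0] of [xget] is
    never reached when [e > 0] and [u] is in [conv_sc], by [proxP]. *)
Definition prox e u z : 'rV[R]_n := xget 0 [set p | subgrad u p (z - e *: p)].

Lemma proxP e u z : 0 < e -> conv_sc u -> subgrad u (prox e u z) (z - e *: prox e u z).
Proof.
move=> e0 cu; rewrite /prox; case: xgetP => [p -> //|].
have [p hp] := amin_exists z e0 cu => /(_ p) /=.
by case: (cu) => uN _ _ cv _; move=> []; exact: amin_sub hp.
Qed.

Lemma prox_uniq e u z p : 0 < e -> conv_sc u -> subgrad u p (z - e *: p) -> prox e u z = p.
Proof. by move=> e0 cu h; exact: subgrad_prox_uniq (proxP z e0 cu) h. Qed.

Definition yprox e u z := z - e *: prox e u z.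

Lemma prox_lip e u z z' : 0 < e -> conv_sc u ->
  `|prox e u z - prox e u z'| <= n%:R / e * `|z - z'|.
Proof.
move=> e0 cu; have h := subgrad_prox_lip (proxP z e0 cu) (proxP z' e0 cu).
move: h; set k := _ - prox _ _ _ => h.
have [->|k0] := eqVneq k 0; first by rewrite normr0 mulr_ge0 // divr_ge0 // ltW.
have p : 0 < `|k| by rewrite normr_gt0.
rewrite mulrAC ler_pdivlMr // mulrC -(ler_pM2r p) -mulrA -expr2 -!mulrA.
apply: le_trans (le_trans (le_trans h (ler_norm _)) (dot_le_norm _ _)).
by rewrite ler_pM2l // sqr_norm_le_dot.
Qed.

Lemma prox_cts e u : 0 < e -> conv_sc u -> continuous (prox e u).
Proof.
move=> e0 cu z; apply/(@cvgrPdist_lt _ _ _ (nbhs z) (nbhs_filter z)) => d d0.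
have C0 : 0 < n%:R / e + 1 by rewrite ltr_wpDl // divr_ge0 // ltW.
have q0 : 0 < d / (n%:R / e + 1) by rewrite divr_gt0.
apply: filterS (near_dist z q0) => z' hz; rewrite distrC.
apply: (le_lt_trans (prox_lip _ _ e0 cu)).
apply: (@le_lt_trans _ _ ((n%:R / e + 1) * `|z' - z|)); first by rewrite ler_wpM2r // lerDl.
by rewrite mulrC -ltr_pdivlMr.
Qed.

Lemma yprox_cts e u : 0 < e -> conv_sc u -> continuous (yprox e u).
Proof.
move=> e0 cu; apply: ctsBv; first exact: cts_id.
by apply: ctsZv; exact: prox_cts.
Qed.

Lemma prox_translate e u a (c : R) z : 0 < e -> conv_sc u ->
  conv_sc (fun x => u (x - a)%R + c%:E)%E ->
  yprox e (fun x => u (x - a)%R + c%:E)%E z = yprox e u (z - e *: a).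
Proof.
move=> e0 cu cu'; rewrite /yprox.
rewrite (@prox_uniq _ _ _ (a + prox e u (z - e *: a))) //.
  by rewrite scalerDr opprD addrA.
have [s us h] := proxP (z - e *: a) e0 cu.
have E : z - e *: (a + prox e u (z - e *: a)) = z - e *: a - e *: prox e u (z - e *: a).
  by rewrite scalerDr opprD addrA.
exists (s + c); first by rewrite addrAC subrr add0r us.
move=> x'; rewrite E; have := h (x' - a).
case: (u (x' - a)) => [b| |]; last by rewrite leeNy_eq.
  rewrite -EFinD !lee_fin opprD addrA; lra.
by move=> _; rewrite addye // leey.
Qed.

Lemma prox_rotate e u (Q : 'M[R]_n) z : 0 < e -> conv_sc u -> On Q ->
  conv_sc (fun x => u (x *m Q^T)) ->
  yprox e (fun x => u (x *m Q^T)) z = yprox e u (z *m Q^T) *m Q.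
Proof.
move=> e0 cu OQ cu'; rewrite /yprox.
have QQ := On_mulr OQ.
have E : z - e *: (prox e u (z *m Q^T) *m Q) = (z *m Q^T - e *: prox e u (z *m Q^T)) *m Q.
  by rewrite mulmxBl -scalemxAl -mulmxA QQ mulmx1.
rewrite (@prox_uniq _ _ _ (prox e u (z *m Q^T) *m Q)) //.
have [s us h] := proxP (z *m Q^T) e0 cu.
exists s; first by rewrite -mulmxA OQ mulmx1.
move=> x'; rewrite E; apply: le_trans (h (x' *m Q^T)); rewrite lee_fin.
have -> : x' - prox e u (z *m Q^T) *m Q = (x' *m Q^T - prox e u (z *m Q^T)) *m Q.
  by rewrite mulmxBl -(mulmxA x') QQ mulmx1.
by rewrite dot_On.
Qed.

(* The minimizer of u + q with the smaller minimum also minimizes min(u, w) + q; strict *)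
(* convexity of the latter along the segment of minimizers handles max(u, w) + q.      *)
Lemma prox_minmax_le e u w z s s' : 0 < e -> conv_sc u -> conv_sc w ->
  conv_sc (fun x => Order.max (u x) (w x)) -> conv_sc (fun x => Order.min (u x) (w x)) ->
  let q x := e / 2 * dot x x - dot z x in
  u (prox e u z) = s%:E -> w (prox e w z) = s'%:E ->
  s + q (prox e u z) <= s' + q (prox e w z) ->
  prox e (fun x => Order.min (u x) (w x)) z = prox e u z /\
  prox e (fun x => Order.max (u x) (w x)) z = prox e w z.
Proof.
move=> e0 cu cw cM cm q us ws le.
set p := prox e u z; set p' := prox e w z.
have [s1 us1 hu] := sub_amin (ltW e0) (proxP z e0 cu).
have [s2 ws2 hw] := sub_amin (ltW e0) (proxP z e0 cw).
rewrite -/p -/p' in us us1 hu ws ws2 hw le.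
have {}us1 : s1 = s by move: us1; rewrite us => -[].
have {}ws2 : s2 = s' by move: ws2; rewrite ws => -[].
subst s1 s2.
have {}hu x : ((s + q p - q x)%:E <= u x)%E.
  by apply: le_trans (hu x); rewrite lee_fin -addrA -[leRHS]addrA -quad_expand /q; lra.
have {}hw x : ((s' + q p' - q x)%:E <= w x)%E.
  by apply: le_trans (hw x); rewrite lee_fin -addrA -[leRHS]addrA -quad_expand /q; lra.
have wp : (s%:E <= w p)%E by apply: le_trans (hw p); rewrite lee_fin; lra.
have mp : Order.min (u p) (w p) = s%:E by rewrite us; apply/min_idPl.
have hm x : ((s + q p - q x)%:E <= Order.min (u x) (w x))%E.
  rewrite le_min hu /=; apply: le_trans (hw x); rewrite lee_fin; lra.
have [mN cvm] : (forall x, Order.min (u x) (w x) != -oo%E) /\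
  convex_ereal (fun x => Order.min (u x) (w x)) by case: cm.
have [MN cvM] : (forall x, Order.max (u x) (w x) != -oo%E) /\
  convex_ereal (fun x => Order.max (u x) (w x)) by case: cM.
have min_p : prox e (fun x => Order.min (u x) (w x)) z = p.
  apply: prox_uniq => //; apply: amin_sub => //; exists s => // x.
  by apply: le_trans (hm x); rewrite lee_fin -addrA -quad_expand /q; lra.
split => //.
suff up' : (u p' <= s'%:E)%E.
  apply: prox_uniq => //; apply: amin_sub => //; exists s'.
    by rewrite ws; apply/max_idPr.
  move=> x; rewrite le_max; apply/orP; right.
  by apply: le_trans (hw x); rewrite lee_fin -addrA -quad_expand /q; lra.
have [E|pp'] := eqVneq p' p.
  by move: le; rewrite E us lee_fin lerD2r.
(* If [u p' > s'], lower semicontinuity keeps [u + q] above [s' + q p'] near [p'], and [w + q] is at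
   least that everywhere. A point [m] of the segment close to [p'] then contradicts convexity of the
   minimum, because [q] is strictly convex. *)
rewrite leNgt; apply/negP => lt.
case: (cu) => _ _ lu _ _.
pose c x := s' + q p' - q x.
have cc : continuous c by apply: ctsB; [exact: ctsC|exact: cts_quad].
have cp' : ((c p')%:E < u p')%E by rewrite /c addrK.
have /nbhs_ballP[d /= d0 hd] := lsc_gt lu cc cp'.
set D := dot (p - p') (p - p').
have D0 : 0 < D by rewrite dot_gt0 // subr_eq0 eq_sym.
pose N := `|p - p'| + 1.
have N0 : 0 < N by rewrite ltr_wpDl.
pose t := Num.min (2^-1) (d / 2 / N).
have t0 : 0 < t by rewrite lt_min invr_gt0 ltr0n !divr_gt0.
have t1 : t < 1 by rewrite gt_min invf_lt1 // ltr1n.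
have t01 : 0 < t < 1 by rewrite t0 t1.
pose m := t *: p + (1 - t) *: p'.
have mE : m = p' + t *: (p - p').
  by apply/rowP => i; rewrite !mxE; ring.
have hum : ((c m)%:E < u m)%E.
  apply: hd; rewrite mx_norm_ball /ball_ /= mE opprD addrA subrr sub0r normrN normrZ gtr0_norm //.
  apply: (@le_lt_trans _ _ (t * N)); first by rewrite ler_wpM2l ?ltW // ltrDl.
  apply: (@le_lt_trans _ _ (d / 2 / N * N)).
    by rewrite ler_wpM2r // ?ge_min ?lexx ?orbT // ltW.
  by rewrite divfK ?gt_eqF //; lra.
have mp' : Order.min (u p') (w p') = s'%:E by rewrite ws; apply/min_idPr/ltW.
have [v hv vle] := convex_real mN cvm mp mp' t01.
have : ((c m)%:E <= v%:E)%E by rewrite -hv le_min (ltW hum) hw.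
rewrite lee_fin /c => hc.
have qm : q m = t * q p + (1 - t) * q p' - e / 2 * t * (1 - t) * D.
  by rewrite /q mE /D !dotE (dotC p' p); field.
have : 0 < e / 2 * t * (1 - t) * D by rewrite !mulr_gt0 // ?divr_gt0 // subr_gt0.
rewrite qm in hc => pos.
have : t * (s + q p) <= t * (s' + q p') by rewrite ler_pM2l.
lra.
Qed.

End prox.

(** * Stability of proximal points under epi-convergence *)

Section stability.
Context {R : realType} {n : nat}.
Implicit Types (u w : 'rV[R]_n -> \bar R) (x y z p a : 'rV[R]_n) (e : R).

Lemma compact_near_enorm (x_ : nat -> 'rV[R]_n) x (d : R) : x_ @ \oo --> x -> 0 < d ->
  \forall k \near \oo, enorm (x_ k - x) < d.
Proof.
move=> xx d0.
have q0 : 0 < d / (n%:R + 1) by rewrite divr_gt0 // ltr_wpDl.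
move/cvgrPdist_lt : xx => /(_ _ q0); apply: filterS => k h.
apply: (le_lt_trans (enorm_le_norm _)).
apply: (@le_lt_trans _ _ ((n%:R + 1) * `|x_ k - x|)); first by rewrite ler_wpM2r // lerDl.
by rewrite mulrC -ltr_pdivlMr ?ltr_wpDl // distrC.
Qed.

Lemma cvg_ereal_lt (v : nat -> \bar R) (l : \bar R) (M : R) : v @ \oo --> l -> (l < M%:E)%E ->
  \forall k \near \oo, (v k < M%:E)%E.
Proof.
move=> vl lM; have : nbhs l [set y | (y < M%:E)%E].
  by apply: open_nbhs_nbhs; split => //; exact: open_ereal_lt_ereal.
exact: vl.
Qed.

(* An open condition on u that bounds all the points with a subgradient of norm at most r1. *)
Definition confined (r1 : R) a (m r : R) u : Prop :=
  (exists2 a0, enorm (a0 - a) < 1 & (u a0 < (m + 1)%:E)%E) /\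
  (forall x, r - 1 <= enorm (x - a) <= r + 1 -> ((m + 1 + r1 * r)%:E < u x)%E).

(** A point [x] farther away would, by its subgradient inequality at [a0] and convexity, force a
    value at most [u a0 + r1 * r] at distance [r] from [a0], inside the shell where [u] is
    larger. *)
Lemma confined_bound r1 a m r u x y : (forall x, u x != -oo%E) -> convex_ereal u -> 0 < r ->
  confined r1 a m r u -> enorm y <= r1 -> subgrad u x y -> enorm (x - a) <= r + 1.
Proof.
move=> uN cu r0 [[a0 ha0 ua0] hc] yr [s us hs].
have [xr|xr] := leP (enorm (x - a0)) r.
  rewrite -(subrK a0 x) -addrA; apply: (le_trans (enormD _ _)).
  by apply: lerD => //; exact: ltW.
exfalso.
have x0 : 0 < enorm (x - a0) := lt_trans r0 xr.
pose t := r / enorm (x - a0).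
have t01 : 0 < t < 1 by rewrite divr_gt0 //= ltr_pdivrMr // mul1r.
have [s0 us0] : exists s0, u a0 = s0%:E.
  case: (u a0) (uN a0) ua0 => [b| |]; rewrite ?eqxx // => _ ?; by [exists b].
have [c uc cle] := convex_real uN cu us us0 t01.
have bE : t *: x + (1 - t) *: a0 - a0 = t *: (x - a0).
  by apply/rowP => i; rewrite !mxE; ring.
have tE : enorm (t *: (x - a0)) = r.
  by rewrite enormZ gtr0_norm ?divr_gt0 // divfK // gt_eqF.
have shell : r - 1 <= enorm (t *: x + (1 - t) *: a0 - a) <= r + 1.
  have -> : t *: x + (1 - t) *: a0 - a = t *: (x - a0) + (a0 - a).
    by apply/rowP => i; rewrite !mxE; ring.
  have h1 := enormD (t *: (x - a0)) (a0 - a).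
  have h2 := enormD (t *: (x - a0) + (a0 - a)) (- (a0 - a)).
  rewrite addrK enormN tE in h2; rewrite tE in h1.
  by apply/andP; split; lra.
have := hc _ shell; rewrite uc lte_fin.
have := hs a0; rewrite us0 lee_fin.
move: ua0; rewrite us0 lte_fin => h1 h2 h3.
have h4 : t * dot y (x - a0) <= r1 * r.
  rewrite -dotZr; apply: (le_trans (cauchy_schwarz _ _)); rewrite tE.
  by rewrite ler_wpM2r // ltW.
have h5 : dot y (a0 - x) = - dot y (x - a0) by rewrite -dotNr opprB.
rewrite h5 in h2; case/andP: t01 => t0 t1.
have : t * s <= t * (s0 + dot y (x - a0)) by rewrite ler_pM2l //; lra.
nra.
Qed.

Lemma confined_open r1 a m r (u_ : nat -> _) u : ecv u_ u -> confined r1 a m r u ->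
  \forall k \near \oo, confined r1 a m r (u_ k).
Proof.
move=> uu [[a0 ha0 ua0] hc].
have [x_ xx ux] := uu.2 a0.
have h1 := ecv_gt uu (@compact_enorm R n a (r - 1) (r + 1))
  (@ctsC R 'rV[R]_n (m + 1 + r1 * r)) hc.
have h2 := cvg_ereal_lt ux ua0.
have d0 : 0 < 1 - enorm (a0 - a) by rewrite subr_gt0.
have h3 := compact_near_enorm xx d0.
apply: filterS3 h1 h2 h3 => k g1 g2 g3; split => //.
exists (x_ k) => //; rewrite -(subrK a0 (x_ k)) -addrA.
by apply: (le_lt_trans (enormD _ _)); lra.
Qed.

Lemma confined_exists r1 u : 0 <= r1 -> conv_sc u ->
  exists a m r, 0 < r /\ confined r1 a m r u.
Proof.
move=> r10 cu; have [a [m um]] := conv_sc_proper cu.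
have [rho hrho] := conv_sc_coercive cu (r1 + 1).
exists a, m.
(* Large enough that on the shell [|x|] exceeds [rho] and [(r1 + 1)(r - 1 - |a|) > m + 1 + r1 r]. *)
pose r := `|rho| + 2 + enorm a + (r1 + 1) * (1 + enorm a) + `|m| + 1.
have ea := enorm_ge0 a.
have pp : 0 <= (r1 + 1) * (1 + enorm a) by rewrite mulr_ge0 // addr_ge0.
have n1 := ler_norm rho; have n2 := ler_norm m.
have n3 := normr_ge0 rho; have n4 := normr_ge0 m.
exists r; split; first by rewrite /r; lra.
split; first by exists a; rewrite ?subrr ?enorm0 // um lte_fin; lra.
move=> x /andP[h1 _].
have h2 : r - 1 - enorm a <= enorm x by have := enormB x a; lra.
have h3 : rho < enorm x by apply: lt_le_trans h2; rewrite /r; lra.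
apply: lt_le_trans (hrho _ h3); rewrite lte_fin.
apply: (@lt_le_trans _ _ ((r1 + 1) * (r - 1 - enorm a))); last first.
  by rewrite ler_wpM2l // addr_ge0.
have : m + 1 + (r1 + 1) * (1 + enorm a) < r by rewrite /r; lra.
nra.
Qed.

(** On a shell around [p] the objective [u + q] exceeds its minimum by a fixed amount, and by
    compactness so does [u_ k + q] for large [k], while its value at the recovery point [x_ k] is
    nearly minimal. If the minimizer [pk] were far from [x_ k], the segment between them would cross
    the shell at a point whose value convexity bounds by the one at [x_ k]. *)
Lemma prox_cvg e (u_ : nat -> 'rV[R]_n -> \bar R) u z : 0 < e -> (forall k, conv_sc (u_ k)) ->
  conv_sc u -> ecv u_ u -> prox e (u_ k) z @[k --> \oo] --> prox e u z.
Proof.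
move=> e0 cu_ cu uu; set p := prox e u z.
apply/cvgrPdist_lt => d d0.
pose r := d / 2.
have r0 : 0 < r by rewrite divr_gt0.
pose q x := e / 2 * dot x x - dot z x.
have [s us hs] := proxP z e0 cu.
rewrite -/p in us hs.
(* Half of [e / 2 * (r / 2) ^ 2], the least excess of the objective at distance [r / 2] from [p]. *)
pose eta := e * r ^+ 2 / 16.
have eta0 : 0 < eta by rewrite divr_gt0 // mulr_gt0 // exprn_gt0.
pose c x := s + q p + eta - q x.
have cq : continuous q := @cts_quad R n e z.
have cc : continuous c by apply: ctsB; [exact: ctsC|].
have hc x : [set x : 'rV[R]_n | r / 2 <= enorm (x - p) <= 2 * r] x -> ((c x)%:E < u x)%E.
  move=> /= /andP[h _]; apply: lt_le_trans (hs x); rewrite lte_fin.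
  have := quad_expand e z p x; rewrite -/(q p) -/(q x) => qe.
  have D : (r / 2) ^+ 2 <= dot (x - p) (x - p).
    by rewrite -sqr_enorm ler_pXn2r ?nnegrE ?enorm_ge0 // divr_ge0 // ltW.
  have : e / 2 * (r / 2) ^+ 2 <= e / 2 * dot (x - p) (x - p).
    by rewrite ler_wpM2l // divr_ge0 // ltW.
  have -> : e / 2 * (r / 2) ^+ 2 = 2 * eta by rewrite /eta; field.
  rewrite /c; lra.
have [x_ xx ux] := uu.2 p.
have r2 : 0 < r / 2 by rewrite divr_gt0.
have n1 := compact_near_enorm xx r2.
have seta : (u p < (s + eta / 2)%:E)%E by rewrite us lte_fin; lra.
have n2 := cvg_ereal_lt ux seta.
have n3 := ecv_gt uu (@compact_enorm R n p (r / 2) (2 * r)) cc hc.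
have e2 : 0 < eta / 2 by rewrite divr_gt0.
have qx : q (x_ k) @[k --> \oo] --> q p by apply: continuous_cvg => //; exact: cq.
have /cvgrPdist_lt /(_ _ e2) n4 := qx.
apply: filterS2 (filterI n1 n2) (filterI n3 n4) => k [g1 g2] [g3 g4].
set pk := prox e (u_ k) z.
have uN : forall x, u_ k x != -oo%E by case: (cu_ k).
have [sk usk hsk] := proxP z e0 (cu_ k); rewrite -/pk in usk hsk.
have [v uv] : exists v, u_ k (x_ k) = v%:E.
  by case: (u_ k (x_ k)) (uN (x_ k)) g2 => [b| |]; rewrite ?eqxx // => _ ?; exists b.
have min_k : sk + q pk <= v + q (x_ k).
  have := hsk (x_ k); rewrite uv lee_fin.
  have := quad_expand e z pk (x_ k); rewrite -/(q pk) -/(q (x_ k)).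
  have : 0 <= e / 2 * dot (x_ k - pk) (x_ k - pk).
    by rewrite mulr_ge0 ?dot_ge0 // divr_ge0 // ltW.
  lra.
have small : v + q (x_ k) < s + q p + eta.
  by move: g2 g4; rewrite uv lte_fin ltr_norml => ? /andP[? ?]; lra.
suff le : enorm (pk - x_ k) <= r.
  apply: (le_lt_trans (norm_le_enorm _)).
  have -> : p - pk = - (pk - x_ k) - (x_ k - p) by apply/rowP => i; rewrite !mxE; ring.
  apply: (le_lt_trans (enormB _ _)); rewrite enormN.
  by rewrite /r in g1 le *; lra.
rewrite leNgt; apply/negP => lt.
have x0 : 0 < enorm (pk - x_ k) := lt_trans r0 lt.
pose t := r / enorm (pk - x_ k).
have t01 : 0 < t < 1 by rewrite divr_gt0 //= ltr_pdivrMr // mul1r.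
have [b ub bv] := convex_real uN (conv_sc_convex (cu_ k)) usk uv t01.
have tE : enorm (t *: (pk - x_ k)) = r.
  by rewrite enormZ gtr0_norm ?divr_gt0 // divfK // gt_eqF.
have shell : [set x : 'rV[R]_n | r / 2 <= enorm (x - p) <= 2 * r] (t *: pk + (1 - t) *: x_ k).
  rewrite /=.
  have -> : t *: pk + (1 - t) *: x_ k - p = t *: (pk - x_ k) + (x_ k - p).
    by apply/rowP => i; rewrite !mxE; ring.
  have h1 := enormD (t *: (pk - x_ k)) (x_ k - p).
  have h2 := enormD (t *: (pk - x_ k) + (x_ k - p)) (- (x_ k - p)).
  rewrite addrK enormN tE in h2; rewrite tE in h1.
  by apply/andP; split; lra.
have := g3 _ shell; rewrite ub lte_fin /c.
have -> : q (t *: pk + (1 - t) *: x_ k) = t * q pk + (1 - t) * q (x_ k) -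
    e / 2 * t * (1 - t) * dot (pk - x_ k) (pk - x_ k).
  by rewrite /q !dotE (dotC (x_ k) pk); field.
case/andP: (t01) => t0 t1.
have : 0 <= e / 2 * t * (1 - t) * dot (pk - x_ k) (pk - x_ k).
  by rewrite mulr_ge0 ?dot_ge0 // !mulr_ge0 // ?subr_ge0 ?invr_ge0 // ltW.
have : t * (sk + q pk) <= t * (v + q (x_ k)) by rewrite ler_pM2l.
lra.
Qed.

End stability.

(** * Real integrals of compactly supported continuous functions *)

Section rint.
Context {R : realType}.
Local Notation T := (measurableTypeR R).
Local Notation Leb := (lebesgue_tuple R).

Lemma ctsNorm (U : topologicalType) (f : U -> R) :
  continuous f -> continuous (fun x => `|f x|).
Proof. by move=> cf x; apply: cvg_norm; exact: cf. Qed.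

Definition rint n (F : 'rV[R]_n -> R) : R := fine (lint F).

(** The bound and the support radius are explicit so that a whole sequence can share them, as
    domination in [rint_cvg] requires. *)
Record ccs n (C r : R) (F : 'rV[R]_n -> R) : Prop := {
  ccs_C : 0 <= C ; ccs_r : 0 <= r ;
  ccs_cts : continuous F ;
  ccs_bd : forall x, `|F x| <= C ;
  ccs_supp : forall x, r < `|x| -> F x = 0 }.

Lemma ccs_integrable n C r (F : 'rV[R]_n -> R) : ccs C r F ->
  (Leb n).-integrable setT (EFin \o (fun t => F (row_of_tuple t))).
Proof.
move=> [C0 r0 cF bF sF]; apply/integrableP; split.
  by apply/measurable_EFinP; exact: measurable_cts.
apply: le_lt_trans (@lint_le_cube R n (fun x => `|F x|) C r _ _ C0 r0 bF _) _ => //.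
- exact: ctsNorm.
- by move=> x /sF ->; rewrite normr0.
- exact: ltry.
Qed.

Lemma lint_rint n C r (F : 'rV[R]_n -> R) : ccs C r F -> lint F = (rint F)%:E.
Proof.
by move=> h; rewrite /rint fineK //; exact: (integrable_fin_num measurableT (ccs_integrable h)).
Qed.

Lemma eq_rint n (F G : 'rV[R]_n -> R) : F =1 G -> rint F = rint G.
Proof. by move=> h; rewrite /rint (eq_lint h). Qed.

Lemma rintD n C r C' r' (F G : 'rV[R]_n -> R) : ccs C r F -> ccs C' r' G ->
  rint (fun x => F x + G x) = rint F + rint G.
Proof.
move=> h h'; exact: (RintegralD measurableT (ccs_integrable h) (ccs_integrable h')).
Qed.

Lemma rintZ n C r k (F : 'rV[R]_n -> R) : ccs C r F ->
  rint (fun x => k * F x) = k * rint F.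
Proof. by move=> h; exact: (RintegralZl _ measurableT (ccs_integrable h)). Qed.

Lemma rint0 n : rint (fun _ : 'rV[R]_n => 0) = 0.
Proof. by rewrite /rint /lint integral0. Qed.

Lemma ccs0 n C r : 0 <= C -> 0 <= r -> ccs C r (fun _ : 'rV[R]_n => 0).
Proof. by move=> C0 r0; split => // [|x]; [exact: ctsC|rewrite normr0]. Qed.

Lemma ccsZ n C r k (F : 'rV[R]_n -> R) : ccs C r F -> ccs (`|k| * C) r (fun x => k * F x).
Proof.
move=> [C0 r0 cF bF sF]; split => //.
- by rewrite mulr_ge0.
- by apply: ctsM => //; exact: ctsC.
- by move=> x; rewrite normrM ler_wpM2l.
- by move=> x /sF ->; rewrite mulr0.
Qed.

Lemma ccsD n C r C' (F G : 'rV[R]_n -> R) : ccs C r F -> ccs C' r G ->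
  ccs (C + C') r (fun x => F x + G x).
Proof.
move=> [C0 r0 cF bF sF] [C0' _ cG bG sG]; split => //.
- by rewrite addr_ge0.
- exact: ctsD.
- by move=> x; apply: (le_trans (ler_normD _ _)); apply: lerD.
- by move=> x xr; rewrite sF // sG // addr0.
Qed.

Lemma rintB n C r C' (F G : 'rV[R]_n -> R) : ccs C r F -> ccs C' r G ->
  rint (fun x => F x - G x) = rint F - rint G.
Proof.
move=> hF hG; rewrite -mulN1r -(rintZ (-1) hG) -(rintD hF (ccsZ (-1) hG)).
by apply: eq_rint => x; rewrite mulN1r.
Qed.

Lemma ccs_sum n C r (I : Type) (s : seq I) (F : I -> 'rV[R]_n -> R) : 0 <= C -> 0 <= r ->
  (forall i, ccs C r (F i)) -> ccs ((size s)%:R * C) r (fun x => \sum_(i <- s) F i x).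
Proof.
move=> C0 r0 h; elim: s => [|i s IH] /=.
  under eq_fun do rewrite big_nil; rewrite mul0r; exact: ccs0.
under eq_fun do rewrite big_cons; rewrite -addn1 natrD mulrDl mul1r addrC.
exact: (ccsD (h i) IH).
Qed.

Lemma le_rint n C r C' r' (F G : 'rV[R]_n -> R) : ccs C r F -> ccs C' r' G ->
  (forall x, F x <= G x) -> rint F <= rint G.
Proof.
move=> hF hG le; apply: le_Rintegral => //.
- exact: (ccs_integrable hF).
- exact: (ccs_integrable hG).
Qed.

Lemma rint_le_cube n C r (F : 'rV[R]_n -> R) : ccs C r F -> `|rint F| <= C * (2 * r) ^+ n.
Proof.
move=> h; have [C0 r0 cF bF sF] := h.
apply: (le_trans (le_normr_Rintegral measurableT (ccs_integrable h))).
have hN : ccs C r (fun x => `|F x|).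
  split => //; first exact: ctsNorm.
  - by move=> x; rewrite normr_id.
  - by move=> x /sF ->; rewrite normr0.
rewrite -lee_fin -/(rint (fun x => `|F x|)) -(lint_rint hN).
apply: lint_le_cube => //; first exact: ccs_cts hN.
exact: ccs_supp hN.
Qed.

Lemma rint_cvg n C r (F_ : nat -> 'rV[R]_n -> R) (F : 'rV[R]_n -> R) :
  (\forall k \near \oo, ccs C r (F_ k)) -> continuous F -> 0 <= C -> 0 <= r ->
  (forall x, F_ k x @[k --> \oo] --> F x) -> rint (F_ k) @[k --> \oo] --> rint F.
Proof.
move=> [N _ hN] cF C0 r0 FF.
suff : rint (F_ (k + N)%N) @[k --> \oo] --> rint F.
  by rewrite -(cvg_shiftn N (fun k => rint (F_ k))).
have cE k : ccs C r (F_ (k + N)%N) by apply: hN; rewrite /= leq_addl.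
have bF x : `|F x| <= C.
  have h : `|F_ k x| @[k --> \oo] --> `|F x| by apply: cvg_norm; exact: FF.
  rewrite -(cvg_lim _ h) //; apply: limr_le; first by apply/cvg_ex; exists `|F x|.
  by exists N => // k Nk; have [_ _ _ + _] := hN k Nk; exact.
have sF x : r < `|x| -> F x = 0.
  move=> xr; rewrite -(cvg_lim _ (FF x)) //; apply: cvg_lim => //.
  apply: cvg_near_cst; exists N => // k Nk.
  by have [_ _ _ _] := hN k Nk; exact.
have cc : ccs C r F by split.
apply: fine_cvg; rewrite -(lint_rint cc).
pose g (t : n.-tuple T) : \bar R := ((cst C%:E) \_ (cube r)) t.
have mc := @measurable_cube R n r.
have ig : (Leb n).-integrable setT g.
  apply/(integrable_mkcond _ mc).1.
  apply/integrableP; split; first exact: measurable_cst.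
  under eq_integral do rewrite /= ger0_norm //.
  rewrite integral_cst; last exact: mc.
  rewrite [X in (_ * X)%E](lebesgue_cube n r0); exact: ltry.
pose f_ k (t : n.-tuple T) := (F_ (k + N)%N (row_of_tuple t))%:E.
have mf_ k : measurable_fun setT (f_ k).
  by apply/measurable_EFinP; apply: measurable_cts; exact: (ccs_cts (cE k)).
have mf : measurable_fun setT (fun t : n.-tuple T => (F (row_of_tuple t))%:E).
  by apply/measurable_EFinP; exact: measurable_cts.
have f_f : {ae Leb n, forall t, setT t -> f_ ^~ t @ \oo --> (F (row_of_tuple t))%:E}.
  apply: aeW => t _; apply: cvg_EFin; first by apply: nearW.
  by have := FF (row_of_tuple t); rewrite -(cvg_shiftn N).
have f_g : {ae Leb n, forall t k, setT t -> (`|f_ k t| <= g t)%E}.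
  apply: aeW => t k _; rewrite /g patchE; case: ifPn => [_|].
    by rewrite lee_fin; exact: (ccs_bd (cE k)).
  rewrite notin_setE => nc; rewrite /f_ (ccs_supp (cE k)) ?abse0 //.
  by rewrite ltNge; apply/negP => h; apply: nc; exact/(cubeP _ r0).
by have [_ _ +] := dominated_convergence measurableT mf_ mf f_f ig f_g.
Qed.

Lemma lint_posneg n (F : 'rV[R]_n -> R) :
  lint F = (lint (fun x => Num.max (F x) 0)%R - lint (fun x => Num.max (- F x) 0)%R)%E.
Proof.
rewrite /lint integralE; congr (_ - _)%E; apply: eq_integral => t _.
  by rewrite funeposE -EFin_max.
by rewrite funenegE -EFinN -EFin_max.
Qed.

Lemma rint_translate n (F : 'rV[R]_n -> R) a : continuous F ->
  rint (fun x => F (x + a)) = rint F.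
Proof.
move=> cF; rewrite /rint lint_posneg [in RHS]lint_posneg.
rewrite (@lint_translate _ _ (fun x => Num.max (F x) 0)).
- rewrite (@lint_translate _ _ (fun x => Num.max (- F x) 0)) //.
    by apply: cts_max; [exact: ctsN|exact: ctsC].
  by move=> x; rewrite le_max lexx orbT.
- by apply: cts_max => //; exact: ctsC.
- by move=> x; rewrite le_max lexx orbT.
Qed.

Lemma rint_rotate n (F : 'rV[R]_n -> R) Q : continuous F -> On Q ->
  rint (fun x => F (x *m Q)) = rint F.
Proof.
move=> cF OQ; rewrite /rint lint_posneg [in RHS]lint_posneg.
rewrite (@lint_rotate _ _ (fun x => Num.max (F x) 0)) //.
- rewrite (@lint_rotate _ _ (fun x => Num.max (- F x) 0)) //.
    by apply: cts_max; [exact: ctsN|exact: ctsC].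
  by move=> x; rewrite le_max lexx orbT.
- by apply: cts_max => //; exact: ctsC.
- by move=> x; rewrite le_max lexx orbT.
Qed.

End rint.

(** * The regularised valuation *)

Section proxint.
Context {R : realType} {n : nat}.
Implicit Types (u w : 'rV[R]_n -> \bar R) (x y z p a : 'rV[R]_n) (e : R) (phi : 'rV[R]_n -> R).

Record tfun (r1 C : R) phi : Prop := {
  tf_r : 0 <= r1 ; tf_C : 0 <= C ; tf_cts : continuous phi ;
  tf_bd : forall y, `|phi y| <= C ;
  tf_supp : forall y, r1 < enorm y -> phi y = 0 }.

Lemma tfunP (r1 : R) phi : 0 <= r1 -> continuous phi ->
  (forall y, r1 < enorm y -> phi y = 0) -> exists C, tfun r1 C phi.
Proof.
move=> r0 cp sp.
have cK := @compact_enorm R n 0 0 r1.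
have K0 : [set x : 'rV[R]_n | 0 <= enorm (x - 0) <= r1] !=set0.
  by exists 0; rewrite /= subr0 enorm0 lexx.
have cn : continuous (fun x => `|phi x|) by exact: ctsNorm.
have [c _ hc] := EVT_max_rV K0 cK (continuous_subspaceT cn).
exists `|phi c|; split => // y.
have [yr|yr] := leP (enorm y) r1; last by rewrite sp // normr0.
by apply: hc; rewrite inE /= subr0 enorm_ge0.
Qed.

(** The integral of [phi] against the image of Lebesgue measure under [yprox e u]. For smooth [u] it
    is a Steiner-type polynomial in [e]. *)
Definition proxint phi e u : R := rint (fun z => phi (yprox e u z)).

(** Where [phi y] is nonzero, [|y| <= r1]; then [confined_bound] bounds the proximal point [p],
    hence also [z = y + e p]. *)
Lemma proxint_ccs r1 C phi e u a m r : tfun r1 C phi -> 0 < e -> conv_sc u -> 0 < r ->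
  confined r1 a m r u ->
  ccs C (r1 + e * (r + 1 + enorm a)) (fun z => phi (yprox e u z)).
Proof.
move=> [r10 C0 cp bp sp] e0 cu r0 cfu; split => //.
- by rewrite addr_ge0 // mulr_ge0 ?addr_ge0 ?enorm_ge0 // ltW.
- exact: (cts_comp cp (yprox_cts e0 cu)).
- move=> z hz; apply: sp; rewrite ltNge; apply/negP => hy.
  have uN : forall x, u x != -oo%E by case: cu.
  have hb := confined_bound uN (conv_sc_convex cu) r0 cfu hy (proxP z e0 cu).
  move: hz; apply/negP; rewrite -leNgt; apply: (le_trans (norm_le_enorm _)).
  rewrite -[z in enorm z](subrK (e *: prox e u z)) -/(yprox e u z).
  apply: (le_trans (enormD _ _)); apply: lerD => //.
  rewrite enormZ gtr0_norm // ler_pM2l // -[X in enorm X](subrK a).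
  by apply: (le_trans (enormD _ _)); apply: lerD.
Qed.

Lemma proxint_ccs_ex r1 C phi e u : tfun r1 C phi -> 0 < e -> conv_sc u ->
  exists r, ccs C r (fun z => phi (yprox e u z)).
Proof.
move=> tp e0 cu; have [a [m [r [r0 cf]]]] := confined_exists (tf_r tp) cu.
by eexists; exact: (proxint_ccs tp e0 cu r0 cf).
Qed.

Lemma proxint_cvg r1 C phi e (u_ : nat -> 'rV[R]_n -> \bar R) u : tfun r1 C phi -> 0 < e ->
  (forall k, conv_sc (u_ k)) -> conv_sc u -> ecv u_ u ->
  proxint phi e (u_ k) @[k --> \oo] --> proxint phi e u.
Proof.
move=> tp e0 cu_ cu uu; have [a [m [r [r0 cf]]]] := confined_exists (tf_r tp) cu.
have h := confined_open uu cf.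
apply: (@rint_cvg R n C (r1 + e * (r + 1 + enorm a))).
- by apply: filterS h => k hk; exact: (proxint_ccs tp e0 (cu_ k) r0 hk).
- exact: (cts_comp (tf_cts tp) (yprox_cts e0 cu)).
- exact: tf_C tp.
- by rewrite addr_ge0 ?(tf_r tp) // mulr_ge0 ?addr_ge0 ?enorm_ge0 // ltW.
- move=> z; apply: continuous_cvg; first exact: (tf_cts tp).
  apply: cvgB; first exact: cvg_cst.
  by apply: cvgZr; exact: prox_cvg.
Qed.

(** Already the integrands agree: at each [z] the smaller of the two regularised minima decides
    which of [u], [w] shares its proximal point with the minimum and which with the maximum. *)
Lemma proxint_valuation r1 C phi e u w : tfun r1 C phi -> 0 < e -> conv_sc u -> conv_sc w ->
  conv_sc (fun x => Order.max (u x) (w x)) -> conv_sc (fun x => Order.min (u x) (w x)) ->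
  proxint phi e (fun x => Order.max (u x) (w x)) + proxint phi e (fun x => Order.min (u x) (w x))
   = proxint phi e u + proxint phi e w.
Proof.
move=> tp e0 cu cw cM cm.
have [ru hu] := proxint_ccs_ex tp e0 cu; have [rw hw] := proxint_ccs_ex tp e0 cw.
have [rM hM] := proxint_ccs_ex tp e0 cM; have [rm hm] := proxint_ccs_ex tp e0 cm.
apply: (etrans (esym (rintD hM hm))); apply: (etrans _ (rintD hu hw)); apply: eq_rint => z.
have [s us _] := proxP z e0 cu; have [s' ws _] := proxP z e0 cw.
have [le|/ltW le] := leP (s + (e / 2 * dot (prox e u z) (prox e u z) - dot z (prox e u z)))
  (s' + (e / 2 * dot (prox e w z) (prox e w z) - dot z (prox e w z))).
  have [E1 E2] := prox_minmax_le e0 cu cw cM cm us ws le.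
  by rewrite /yprox E1 E2 addrC.
have EM : (fun x => Order.max (w x) (u x)) = (fun x => Order.max (u x) (w x)).
  by apply/funext => x; rewrite maxC.
have Em : (fun x => Order.min (w x) (u x)) = (fun x => Order.min (u x) (w x)).
  by apply/funext => x; rewrite minC.
have := prox_minmax_le e0 cw cu; rewrite EM Em => /(_ _ _ _ cM cm ws us le)[E1 E2].
by rewrite /yprox E1 E2.
Qed.

Lemma proxint_translate r1 C phi e u a (c : R) : tfun r1 C phi -> 0 < e -> conv_sc u ->
  conv_sc (fun x => u (x - a)%R + c%:E)%E ->
  proxint phi e (fun x => u (x - a)%R + c%:E)%E = proxint phi e u.
Proof.
move=> tp e0 cu cu'; rewrite /proxint -[RHS](rint_translate (- (e *: a))).
  by apply: eq_rint => z; rewrite prox_translate.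
exact: (cts_comp (tf_cts tp) (yprox_cts e0 cu)).
Qed.

Lemma proxint_rotate r1 C phi e u (Q : 'M[R]_n) : tfun r1 C phi -> 0 < e -> conv_sc u ->
  On Q -> conv_sc (fun x => u (x *m Q^T)) ->
  proxint phi e (fun x => u (x *m Q^T)) = proxint (fun y => phi (y *m Q)) e u.
Proof.
move=> tp e0 cu OQ cu'; rewrite /proxint.
have OQ' : On Q^T by rewrite /On /= trmxK; exact: On_mulr.
rewrite -(@rint_rotate R n (fun z => phi (yprox e u z *m Q)) Q^T) //.
  by apply: eq_rint => z; rewrite prox_rotate.
apply: (cts_comp (tf_cts tp)).
exact: (cts_comp (g := yprox e u) (@cts_mulmxr R n n Q) (yprox_cts e0 cu)).
Qed.

End proxint.

(** * Extraction of polynomial coefficients *)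

Section extraction.
Context {R : realType}.

(** The Vandermonde matrix of the distinct nodes [1, ..., n + 1] is invertible. *)
Lemma extraction_exists n (j : 'I_n.+1) : exists c : 'I_n.+1 -> R,
  forall k : 'I_n.+1, \sum_i c i * i.+1%:R ^+ k = (k == j)%:R.
Proof.
pose a : 'rV[R]_n.+1 := \row_i i.+1%:R.
pose V := Vandermonde n.+1 a.
have u : V \in unitmx.
  rewrite unitmxE unitfE det_Vandermonde; apply/prodf_neq0 => i _; apply/prodf_neq0 => k ik.
  by rewrite !mxE subr_eq0 eqr_nat eqSS gtn_eqF.
exists (fun i => (invmx V *m (delta_mx j 0 : 'cV_n.+1)) i 0) => k.
have := congr1 (fun A : 'cV[R]_n.+1 => A k 0) (mulKVmx u (delta_mx j 0 : 'cV_n.+1)).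
rewrite mxE [RHS]mxE eqxx andbT => <-; apply: eq_bigr => i _.
by rewrite mulrC; congr (_ * _); rewrite !mxE.
Qed.

Definition excoef n (j : 'I_n.+1) : 'I_n.+1 -> R := projT1 (cid (extraction_exists j)).

(* ext j q is the coefficient of s ^+ j in q when q is a polynomial of degree at most n. *)
Definition ext n (j : 'I_n.+1) (q : R -> R) : R := \sum_i excoef j i * q i.+1%:R.

Lemma ext_poly n (j : 'I_n.+1) (b : nat -> R) q :
  (forall s, 0 < s -> q s = \sum_(k < n.+1) b k * s ^+ k) -> ext j q = b j.
Proof.
move=> hq; rewrite /ext /excoef; case: (cid _) => c hc /=.
under eq_bigr do rewrite hq ?ltr0n // mulr_sumr.
rewrite exchange_big /= (bigD1 j) //= [X in _ + X]big1 ?addr0 => [|k kj].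
  under eq_bigr do rewrite mulrCA; rewrite -mulr_sumr hc eqxx mulr1 //.
under eq_bigr do rewrite mulrCA; rewrite -mulr_sumr hc (negbTE kj) mulr0 //.
Qed.

Lemma eq_ext n (j : 'I_n.+1) q q' : (forall s, 0 < s -> q s = q' s) -> ext j q = ext j q'.
Proof. by move=> h; apply: eq_bigr => i _; rewrite h ?ltr0n. Qed.

Lemma extD n (j : 'I_n.+1) q q' : ext j (fun s => q s + q' s) = ext j q + ext j q'.
Proof. by rewrite -big_split; apply: eq_bigr => i _; rewrite mulrDr. Qed.

Lemma extZ n (j : 'I_n.+1) a q : ext j (fun s => a * q s) = a * ext j q.
Proof. by rewrite mulr_sumr; apply: eq_bigr => i _; rewrite mulrCA. Qed.

Lemma extB n (j : 'I_n.+1) q q' : ext j (fun s => q s - q' s) = ext j q - ext j q'.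
Proof. by rewrite -sumrB; apply: eq_bigr => i _; rewrite mulrBr. Qed.

End extraction.

(** * Determinant expansions and elementary symmetric functions *)

Section determinants.
Context {R : realType} {n : nat}.
Implicit Types (A B M D K : 'M[R]_n).

Lemma det_scalar_sub A (t : R) : \det (t%:M - A) = (char_poly A).[t].
Proof.
rewrite /char_poly -[RHS]/(horner_eval t _) -det_map_mx; congr (\det _).
by apply/matrixP => i k; rewrite !mxE /= !horner_evalE !hornerE hornerMn hornerX.
Qed.

(** [det (1 + t K)] is [(-t)^n] times the characteristic polynomial of [K] at [-1/t], which reverses
    the order of its coefficients. *)
Lemma det_1Z K (t : R) : 0 < t -> \det (1%:M + t *: K) =
  \sum_(k < n.+1) ((-1) ^+ k * (char_poly K)`_(n - k)) * t ^+ k.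
Proof.
move=> t0.
have tn : t != 0 by rewrite gt_eqF.
have -> : 1%:M + t *: K = (- t) *: ((- t^-1)%:M - K).
  by apply/matrixP => i k; rewrite !mxE; case: (i == k); rewrite ?mulr1n ?mulr0n; field.
rewrite detZ det_scalar_sub horner_coef size_char_poly mulr_sumr (reindex_inj rev_ord_inj) /=.
apply: eq_bigr => k _; rewrite subSS.
have kn : (k <= n)%N by rewrite -ltnS.
have -> : (- t) ^+ n = (- t) ^+ (n - k) * ((-1) ^+ k * t ^+ k).
  by rewrite -exprNn -exprD subnK.
have : (- t) ^+ (n - k) * (- t^-1) ^+ (n - k) = 1.
  by rewrite -exprMn mulrNN mulfV // expr1n.
move: ((- t) ^+ (n - k)) ((- t^-1) ^+ (n - k)) => x y xy.
rewrite -[RHS]mul1r -xy; ring.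
Qed.

(** Jacobi's formula for the derivative of a determinant, in coefficient form. *)
Lemma ext_det_1 M D (j : 'I_n.+1) : (0 < n)%N -> j = 1%N :> nat -> M \in unitmx ->
  ext j (fun t => \det (M + t *: D)) = \det M * \tr (invmx M *m D).
Proof.
move=> n0 j1 uM.
rewrite (@ext_poly _ _ _ (fun k => \det M * ((-1) ^+ k * (char_poly (invmx M *m D))`_(n - k)))).
  by rewrite j1 subn1 char_poly_trace // expr1 mulN1r opprK.
move=> t t0.
have -> : M + t *: D = M *m (1%:M + t *: (invmx M *m D)).
  by rewrite mulmxDr mulmx1 -scalemxAr mulKVmx.
rewrite det_mulmx det_1Z // mulr_sumr; apply: eq_bigr => k _; by rewrite !mulrA.
Qed.

Lemma det_eig A (t : R) : A^T = A -> \det (A + t%:M) = \prod_i (t + eigenvals A 0 i).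
Proof.
move=> AT.
have -> : A + t%:M = - ((- t)%:M - A) by rewrite opprB raddfN /= opprK.
rewrite -scaleN1r detZ det_scalar_sub (eigenvalsP AT) horner_prod.
rewrite -[n in (-1) ^+ n]card_ord -prodr_const -big_split; apply: eq_bigr => i _.
by rewrite !hornerE /=; ring.
Qed.

Lemma det_esym A (t : R) : A^T = A ->
  \det (A + t%:M) = \sum_(k < n.+1) esym_eig A (n - k) * t ^+ k.
Proof.
move=> AT; rewrite det_eig //.
under eq_bigr do rewrite addrC.
rewrite bigA_distr /=.
rewrite (partition_big (fun I : {set 'I_n} => @inord n (n - #|I|)) xpredT) //=.
have cI (I : {set 'I_n}) : (#|I| <= n)%N by rewrite -[X in (_ <= X)%N]card_ord max_card.
apply: eq_bigr => k _; rewrite /esym_eig mulr_suml.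
apply: eq_big => [I|I].
  rewrite -val_eqE /= inordK; last by rewrite ltnS leq_subr.
  have := cI I; move: #|I| (nat_of_ord k) (ltn_ord k) => a b kn an.
  by apply/eqP/eqP; lia.
rewrite -val_eqE /= inordK; last by rewrite ltnS leq_subr.
move=> /eqP <-; rewrite (bigID (fun i => i \in I)) /=; congr (_ * _).
  by apply: eq_bigr => i ->.
rewrite (eq_bigr (fun=> t)) => [|i /negbTE -> //].
rewrite prodr_const; congr (_ ^+ _).
have := cardC (mem I); rewrite card_ord /=; have := cI I.
have -> : #|[predC mem I]| = #|[pred i | i \notin I]| by [].
have -> : #|mem I| = #|I| by [].
lia.
Qed.

Lemma esym_ext A (j : 'I_n.+1) : A^T = A ->
  ext j (fun t => \det (A + t%:M)) = esym_eig A (n - j).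
Proof.
by move=> AT; apply: (@ext_poly _ _ _ (fun k => esym_eig A (n - k))) => t _; exact: det_esym.
Qed.

Lemma esym_ext1 A (j : 'I_n.+1) : A^T = A ->
  ext j (fun t => \det (1%:M + t *: A)) = esym_eig A j.
Proof.
move=> AT; apply: (@ext_poly _ _ _ (fun k => esym_eig A k)) => t t0.
have tn : t != 0 by rewrite gt_eqF.
have -> : 1%:M + t *: A = t *: (A + (t^-1)%:M).
  by rewrite scalerDr scale_scalar_mx mulfV // addrC.
rewrite detZ det_esym // mulr_sumr (reindex_inj rev_ord_inj) /=.
apply: eq_bigr => k _; have kn := ltn_ord k.
rewrite subSS subKn // mulrCA; congr (_ * _).
have -> : t ^+ n = t ^+ k * t ^+ (n - k) by rewrite -exprD subnKC.
by rewrite -mulrA exprVn mulfV ?mulr1 // expf_neq0.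
Qed.

Lemma det_le_scalar A (t : R) : A^T = A -> (forall i, 0 <= eigenvals A 0 i) -> 0 <= t ->
  \det A <= \det (A + t%:M).
Proof.
move=> AT p t0; have -> : \det A = \det (A + 0%:M) by rewrite raddf0 addr0.
rewrite !det_eig //; apply: ler_prod => i _; rewrite add0r p lerDr //.
Qed.

Definition psd A := A^T = A /\ forall v, 0 <= dot (v *m A) v.

Lemma psd_eigenvals A i : psd A -> 0 <= eigenvals A 0 i.
Proof.
move=> [AT pA].
have : root (char_poly A) (eigenvals A 0 i).
  rewrite (eigenvalsP AT) /root horner_prod; apply/prodf_eq0; exists i => //.
  by rewrite !hornerE subrr.
rewrite -eigenvalue_root_char => /eigenvalueP[v vA v0].
have := pA v; rewrite vA dotZl pmulr_lge0 //; exact: dot_gt0.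
Qed.

Lemma psd_esym_ge0 A k : psd A -> 0 <= esym_eig A k.
Proof.
by move=> pA; apply: sumr_ge0 => I _; apply: prodr_ge0 => i _; exact: psd_eigenvals.
Qed.

(* The coefficients of s |-> det (A + s C^2) are those of the positive semidefinite    *)
(* matrix C^-1 A C^-1, up to det C ^ 2; they are nonnegative, so each monomial is      *)
(* dominated by the whole polynomial.                                                  *)
Lemma ext_det_bound A C (j : 'I_n.+1) (s : R) : psd A -> C^T = C -> C \in unitmx -> 0 < s ->
  0 <= ext j (fun t => \det (A + t *: (C *m C))) /\
  ext j (fun t => \det (A + t *: (C *m C))) * s ^+ j <= \det (A + s *: (C *m C)).
Proof.
move=> [AT pA] CT uC s0.
pose B := invmx C *m A *m invmx C.
have iCT : (invmx C)^T = invmx C by rewrite trmx_inv CT.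
have pB : psd B.
  split; first by rewrite /B !trmx_mul iCT AT mulmxA.
  move=> v; have := pA (v *m invmx C); rewrite !dotE_mx trmx_mul iCT !mulmxA.
  by rewrite /B ?mulmxA.
have dE t : \det (A + t *: (C *m C)) = \det C ^+ 2 * \det (B + t%:M).
  have -> : A + t *: (C *m C) = C *m (B + t%:M) *m C.
    rewrite mulmxDr mulmxDl /B !mulmxA mulmxV // mul1mx mulmxKV //.
    by rewrite mul_mx_scalar -scalemxAl.
  by rewrite !det_mulmx expr2; ring.
have [BT _] := pB.
have dE2 t : \det (A + t *: (C *m C)) =
    \sum_(k < n.+1) \det C ^+ 2 * esym_eig B (n - k) * t ^+ k.
  by rewrite dE det_esym // mulr_sumr; apply: eq_bigr => k _; rewrite mulrA.
have cE : ext j (fun t => \det (A + t *: (C *m C))) = \det C ^+ 2 * esym_eig B (n - j).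
  by apply: (@ext_poly _ _ _ (fun k => \det C ^+ 2 * esym_eig B (n - k))) => t _; exact: dE2.
have c0 k : 0 <= \det C ^+ 2 * esym_eig B k by rewrite mulr_ge0 ?sqr_ge0 ?psd_esym_ge0.
rewrite cE; split => //; rewrite dE2 (bigD1 j) //= lerDl.
by apply: sumr_ge0 => k _; rewrite mulr_ge0 // exprn_ge0 // ltW.
Qed.

(** The matrix determinant lemma: the bordered matrix with corner 1 is reduced by eliminating its
    corner or its block [M]. *)
Lemma det_rank1 M (y : 'rV[R]_n) (c : R) : M \in unitmx ->
  \det (M - c *: (y^T *m y)) = \det M * (1 - c * (y *m invmx M *m y^T) 0 0).
Proof.
move=> uM.
pose A : 'M[R]_n.+1 := block_mx (1%:M : 'M[R]_1) (c *: y) y^T M.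
have mdA : md A = M by rewrite /md /A block_mxKdr.
have : \det A = \det (md A) * schur A by rewrite det_schur // mdA.
rewrite mdA /schur /ma /mb /mc mdA /A block_mxKur block_mxKdl -!scalemxAl.
have -> : (block_mx (1%:M : 'M[R]_1) (c *: y) y^T M : 'M[R]_(1 + n)) 0 0 = 1.
  have z : (0 : 'I_(1 + n)) = lshift n (0 : 'I_1) by apply/val_inj.
  by rewrite z block_mxEul mxE eqxx.
rewrite [X in _ * (_ - X)]mxE => <-.
have -> : block_mx (1%:M : 'M[R]_1) (c *: y) y^T M =
   (block_mx (1%:M : 'M[R]_1) 0 y^T 1%:M : 'M[R]_(1 + n)) *m block_mx 1%:M (c *: y) 0 (M - c *: (y^T *m y)).
  rewrite mulmx_block !mul1mx !mulmx1 !mul0mx !addr0 -scalemxAr addrC subrK //.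
by rewrite det_mulmx (@det_lblock _ 1 n) (@det_ublock _ 1 n) !det1 !mul1r.
Qed.

End determinants.

(** * Differentiability from continuous partial derivatives *)

Section calculus.
Context {R : realType}.

Lemma vfre_coord n p (G : 'rV[R]_n -> 'rV[R]_p) x A :
  (forall c, forall e, 0 < e ->
    \forall y \near x, `|G y 0 c - G x 0 c - ((y - x) *m A) 0 c| <= e * `|y - x|) ->
  vfre G x A.
Proof.
move=> h e e0; have H c := h c e e0; move/filter_forall : H.
apply: filterS => y hy; apply: ler_mx_normP => [|i c]; first by rewrite mulr_ge0 // ltW.
by rewrite (ord1 i); have := hy c; rewrite [(G y - G x - _) 0 c]mxE [(G y - G x) 0 c]mxE
  [(- G x) 0 c]mxE [(- ((y - x) *m A)) 0 c]mxE.
Qed.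

Lemma vfreD n p (F G : 'rV[R]_n -> 'rV[R]_p) x A B : vfre F x A -> vfre G x B ->
  vfre (fun y => F y + G y) x (A + B).
Proof.
move=> hF hG e e0; have e2 : 0 < e / 2 by rewrite divr_gt0.
apply: (@filterS2 _ (nbhs x) (nbhs_filter x) _ _ _ _ (hF _ e2) (hG _ e2)) => y h1 h2.
rewrite mulmxDr [X in `|X|](_ : _ = (F y - F x - (y - x) *m A) + (G y - G x - (y - x) *m B)).
  by apply: (le_trans (ler_normD _ _)); rewrite [e]splitr mulrDl lerD.
by apply/rowP => i; rewrite !mxE; ring.
Qed.

Lemma vfreZ n p (F : 'rV[R]_n -> 'rV[R]_p) x A k : vfre F x A ->
  vfre (fun y => k *: F y) x (k *: A).
Proof.
move=> hF e e0.
have k0 : 0 < `|k| + 1 by rewrite ltr_wpDl.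
have e2 : 0 < e / (`|k| + 1) by rewrite divr_gt0.
apply: (@filterS _ (nbhs x) (nbhs_filter x) _ _ _ (hF _ e2)) => y h1.
rewrite -scalemxAr -!scalerBr normrZ.
apply: (@le_trans _ _ ((`|k| + 1) * (e / (`|k| + 1) * `|y - x|))).
  by apply: ler_pM => //; rewrite lerDl.
by rewrite mulrA mulrCA mulfV ?gt_eqF // mulr1.
Qed.

Lemma vfre_id n (x : 'rV[R]_n) : vfre (fun y => y) x 1%:M.
Proof.
move=> e e0; apply: (@filterE _ (nbhs x) (nbhs_filter x)) => y; rewrite mulmx1 subrr normr0 mulr_ge0 //; exact: ltW.
Qed.

Section partials.
Context {n : nat} (F : 'rV[R]_n -> R).
Hypothesis dF : forall i x, derivable F x (delta_mx 0 i).
Hypothesis cF : forall i, continuous (partial i F).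

Lemma is_derive_line v i (t : R) :
  is_derive t (1 : R) (fun s => F (v + s *: delta_mx 0 i)) (partial i F (v + t *: delta_mx 0 i)).
Proof.
have E : (fun h : R => h^-1 *: (((fun s => F (v + s *: delta_mx 0 i)) \o shift t) (h *: (1 : R)) -
     F (v + t *: delta_mx 0 i))) =
   (fun h => h^-1 *: ((F \o shift (v + t *: delta_mx 0 i)) (h *: delta_mx 0 i) -
     F (v + t *: delta_mx 0 i))).
  apply/funext => h /=; congr (_ *: (F _ - _)).
  have -> : h *: (1 : R) = h by exact: mulr1.
  by rewrite scalerDl addrCA.
apply: DeriveDef.
  by rewrite /derivable E; exact: dF.
by rewrite /derive E.
Qed.

Lemma mvt_line v i (h : R) : exists2 s, `|s| <= `|h| &
  F (v + h *: delta_mx 0 i) - F v = h * partial i F (v + s *: delta_mx 0 i).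
Proof.
pose phi s := F (v + s *: delta_mx 0 i).
have cphi : continuous phi.
  by move=> t; apply/differentiable_continuous/derivable1_diffP; case: (is_derive_line v i t).
have phi0 : phi 0 = F v by rewrite /phi scale0r addr0.
have [h0|h0|->] := ltgtP h 0.
- have [c] := @MVT R phi (fun t => partial i F (v + t *: delta_mx 0 i)) h 0 h0
    (fun x _ => is_derive_line v i x) (continuous_subspaceT cphi).
  rewrite in_itv /= => /andP[c1 c2]; rewrite phi0 sub0r => E; exists c.
    by rewrite !ltr0_norm // lerN2 ltW.
  by rewrite -opprB E mulrN opprK mulrC.
- have [c] := @MVT R phi (fun t => partial i F (v + t *: delta_mx 0 i)) 0 h h0
    (fun x _ => is_derive_line v i x) (continuous_subspaceT cphi).
  rewrite in_itv /= => /andP[c1 c2]; rewrite phi0 subr0 => E; exists c.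
    by rewrite !gtr0_norm // ltW.
  by rewrite E mulrC.
- by exists 0 => //; rewrite scale0r addr0 subrr mul0r.
Qed.

(** The coordinates are changed one at a time, through the hybrid points [hyb k], and the mean value
    theorem is applied to each change. *)
Lemma partials_fre x e : 0 < e ->
  \forall y \near x, `|F y - F x - dot (y - x) (gradient F x)| <= e * `|y - x|.
Proof.
move=> e0.
have q0 : 0 < e / n.+1%:R by rewrite divr_gt0.
have H i : \forall y \near x, `|partial i F x - partial i F y| < e / n.+1%:R.
  by have /(@cvgrPdist_lt _ _ _ (nbhs x) (nbhs_filter x)) /(_ _ q0) := @cF i x.
move/filter_forall : H => /nbhs_ballP[d /= d0 hd].
apply: filterS (near_dist x d0) => y yd.
pose hyb (k : nat) : 'rV[R]_n := \row_i (if (i < k)%N then y 0 i else x 0 i).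
have hyb0 : hyb 0%N = x by apply/rowP => i; rewrite mxE.
have hybn : hyb n = y by apply/rowP => i; rewrite mxE ltn_ord.
have hybS (k : 'I_n) : hyb k.+1 = hyb k + (y 0 k - x 0 k) *: delta_mx 0 k.
  apply/rowP => i; rewrite !mxE eqxx /=.
  have [->|ik] := eqVneq i k; first by rewrite leqnn ltnn mulr1; ring.
  have -> : (i < k.+1)%N = (i < k)%N.
    by rewrite ltnS leq_eqVlt; move: ik; rewrite -val_eqE => /negbTE /= ->.
  by rewrite mulr0 addr0.
have tel : F y - F x = \sum_(k < n) (F (hyb k.+1) - F (hyb k)).
  rewrite -{1}hybn -{1}hyb0 -(telescope_sumr (fun k => F (hyb k)) (leq0n n)).
  by rewrite big_mkord.
rewrite tel /dot -sumrB; apply: (le_trans (ler_norm_sum _ _ _)).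
apply: (@le_trans _ _ (\sum_(k < n) e / n.+1%:R * `|y - x|)); last first.
  rewrite sumr_const card_ord -[X in X <= _]mulr_natl mulrA ler_wpM2r //.
  by rewrite mulrCA ler_piMr //; [exact: ltW|rewrite ler_pdivrMr // mul1r ler_nat].
apply: ler_sum => k _; rewrite hybS.
have [s hs ->] := mvt_line (hyb k) k (y 0 k - x 0 k).
have -> : gradient F x 0 k = partial k F x by rewrite mxE.
have yk : `|y 0 k - x 0 k| <= `|y - x|.
  by have := ler_mx_norm_coord (y - x) 0 k; rewrite !mxE.
have -> : (y - x) 0 k = y 0 k - x 0 k by rewrite !mxE.
rewrite -mulrBr normrM mulrC distrC; apply: ler_pM => //; apply: ltW.
apply: (hd (hyb k + s *: delta_mx 0 k)).
rewrite mx_norm_ball /ball_ /= distrC; apply: le_lt_trans yd.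
apply: ler_mx_normP => // i0 i; rewrite (ord1 i0) !mxE eqxx /=.
have [->|ik] := eqVneq i k.
  by rewrite ltnn mulr1 addrAC subrr add0r; exact: le_trans yk.
rewrite mulr0 addr0; case: ifP => _; last by rewrite subrr normr0.
by have := ler_mx_norm_coord (y - x) 0 i; rewrite !mxE.
Qed.

End partials.

Section C2functions.
Context {n : nat} (f : 'rV[R]_n -> R).
Hypothesis f2 : C2plus f.

Lemma hessian_sym x : (hessian f x)^T = hessian f x.
Proof. by case: f2 => _ /(_ x) []. Qed.

(** Symmetry of the Hessian, contained in [posdef], reconciles the index order of [hessian] with the
    row-vector convention of [vfre]. *)
Lemma gradient_vfre x : vfre (gradient f) x (hessian f x).
Proof.
case: f2 => -[_ _ h2] _; apply: vfre_coord => c e e0.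
have := partials_fre (fun i y => (h2 c i).1 y) (fun i => (h2 c i).2) x e0.
apply: filterS => y; rewrite !mxE; congr (`|_ - _| <= _).
rewrite -hessian_sym; apply: eq_bigr => i _.
by rewrite [(_^T) _ _]mxE [hessian _ _ _ _]mxE [gradient _ _ _ _]mxE.
Qed.

Lemma hessian_cts i j : continuous (fun x => hessian f x i j).
Proof.
case: f2 => -[_ _ h2] _; have [_ c] := h2 i j.
by rewrite (_ : (fun x => _) = partial j (partial i f)) //; apply/funext => x; rewrite mxE.
Qed.

Lemma gradient_cts : continuous (gradient f).
Proof. by move=> x; exact: (vfre_cvg (gradient_vfre x)). Qed.

Lemma gradient_subgrad x : convex_ereal (EFin \o f) -> subgrad (EFin \o f) x (gradient f x).
Proof.
move=> cv; exists (f x) => // x'; rewrite lee_fin.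
pose d := x' - x.
apply/ler_addgt0Pl => e e0.
have q0 : 0 < e / (`|d| + 1) by rewrite divr_gt0 // ltr_wpDl.
case: f2 => -[_ h1 _] _.
have /nbhs_ballP[r /= r0 hr] := partials_fre (fun i y => (h1 i).1 y) (fun i => (h1 i).2) x q0.
pose t := Num.min (2^-1) (r / 2 / (`|d| + 1)).
have N0 : 0 < `|d| + 1 by rewrite ltr_wpDl.
have t0 : 0 < t by rewrite lt_min invr_gt0 ltr0n !divr_gt0.
have t1 : t < 1 by rewrite gt_min invf_lt1 // ltr1n.
have /hr : ball x r (x + t *: d).
  rewrite mx_norm_ball /ball_ /= opprD addrA subrr sub0r normrN normrZ gtr0_norm //.
  apply: (@le_lt_trans _ _ (t * (`|d| + 1))); first by rewrite ler_wpM2l ?ltW // ltrDl.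
  apply: (@le_lt_trans _ _ (r / 2 / (`|d| + 1) * (`|d| + 1))).
    by rewrite ler_wpM2r // ?ge_min ?lexx ?orbT // ltW.
  by rewrite divfK ?gt_eqF //; lra.
rewrite [x + _ - x]addrC addKr dotZl normrZ gtr0_norm // (dotC d) => h.
have := cv x' x t; rewrite t0 t1 => /(_ isT).
have -> : t *: x' + (1 - t) *: x = x + t *: d.
  by apply/rowP => i; rewrite !mxE; ring.
rewrite /= -!EFinM -EFinD lee_fin => h'.
have : e / (`|d| + 1) * (t * `|d|) <= t * e.
  rewrite mulrCA ler_wpM2l //; first exact: ltW.
  by rewrite mulrAC ler_pdivrMr // ler_wpM2l //; [exact: ltW|rewrite lerDl].
move: h; rewrite ler_norml => /andP[h _] h2.
rewrite -(ler_pM2l t0) -/d; nra.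
Qed.

End C2functions.
End calculus.

(** * Integral formulas for smooth functions in primal and dual variables *)

Section formulas.
Context {R : realType}.

Lemma ccs_ex n r (F : 'rV[R]_n -> R) : continuous F -> 0 <= r ->
  (forall x, r < `|x| -> F x = 0) -> exists C, ccs C r F.
Proof.
move=> cF r0 sF.
have cK : compact [set x : 'rV[R]_n | 0 <= enorm (x - 0) <= n%:R * r].
  exact: compact_enorm.
have K0 : [set x : 'rV[R]_n | 0 <= enorm (x - 0) <= n%:R * r] !=set0.
  by exists 0; rewrite /= subr0 enorm0 lexx mulr_ge0.
have cn : continuous (fun x => `|F x|) by exact: ctsNorm.
have [c _ hc] := EVT_max_rV K0 cK (continuous_subspaceT cn).
exists `|F c|; split => // y.
have [yr|yr] := leP `|y| r; last by rewrite sF // normr0.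
apply: hc; rewrite inE /= subr0 enorm_ge0 /=.
by apply: (le_trans (enorm_le_norm _)); rewrite ler_wpM2l.
Qed.

Lemma rint_lin n (I : finType) (c : I -> R) r (F : I -> 'rV[R]_n -> R) : 0 <= r ->
  (forall i, exists C, ccs C r (F i)) ->
  rint (fun x => \sum_i c i * F i x) = \sum_i c i * rint (F i).
Proof.
move=> r0 h.
suff H (s : seq I) : (exists C, ccs C r (fun x => \sum_(i <- s) c i * F i x)) /\
    rint (fun x => \sum_(i <- s) c i * F i x) = \sum_(i <- s) c i * rint (F i).
  by have [_] := H (index_enum I).
elim: s => [|i s [[C hC] IH]].
  split; first by exists 0; under eq_fun do rewrite big_nil; exact: ccs0.
  by rewrite big_nil -[RHS](rint0 n); apply: eq_rint => x; rewrite big_nil.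
have [Ci hi] := h i; split.
  exists (`|c i| * Ci + C); under eq_fun do rewrite big_cons.
  exact: (ccsD (ccsZ (c i) hi) hC).
rewrite big_cons -IH -(rintZ _ hi) -(rintD (ccsZ (c i) hi) hC).
by apply: eq_rint => x; rewrite big_cons.
Qed.

Definition proxext n (j : 'I_n.+1) (phi : 'rV[R]_n -> R) u := ext j (fun e => proxint phi e u).

Lemma proxint_cov n r1 C phi e (u : 'rV[R]_n -> \bar R) G J y : tfun r1 C phi -> 0 < e ->
  conv_sc u -> C1mono y G J ->
  proxint phi e u = rint (fun x => phi (yprox e u (G x)) * \det (J x)).
Proof.
move=> tp e0 cu GJ; rewrite /proxint /rint; congr fine.
rewrite -(change_of_variables_signed GJ) //.
exact: (cts_comp (tf_cts tp) (yprox_cts e0 cu)).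
Qed.

Section xspace.
Context {n : nat} (f : 'rV[R]_n -> R).
Hypotheses (cf : conv_sc (EFin \o f)) (f2 : C2plus f).

Lemma gradient_mono x y : 0 <= dot (gradient f x - gradient f y) (x - y).
Proof.
apply: (@subgrad_mono _ _ (EFin \o f)); apply: gradient_subgrad => //;
  exact: conv_sc_convex.
Qed.

Lemma gradient_C1mono e : 0 < e ->
  C1mono e (fun x => gradient f x + e *: x) (fun x => hessian f x + e%:M).
Proof.
move=> e0; split => //.
- move=> x; rewrite -[e%:M]scalemx1; apply: vfreD; first exact: gradient_vfre.
  by apply: vfreZ; exact: vfre_id.
- move=> i k; under eq_fun do rewrite mxE; apply: ctsD; first exact: hessian_cts.
  exact: ctsC.
- move=> x y; have h := gradient_mono x y.
  have -> : gradient f x + e *: x - (gradient f y + e *: y) =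
     (gradient f x - gradient f y) + e *: (x - y).
    by apply/rowP => i; rewrite !mxE; ring.
  move: h; move: (gradient f x - gradient f y) (x - y) => g d h.
  by rewrite dotDl dotZl ler_wpDl // ler_pM2l // sqr_norm_le_dot.
Qed.

Lemma yprox_gradient e x : 0 < e -> yprox e (EFin \o f) (gradient f x + e *: x) = gradient f x.
Proof.
move=> e0; rewrite /yprox (@prox_uniq _ _ _ _ _ x) //; first by rewrite addrK.
by rewrite addrK; apply: gradient_subgrad => //; exact: conv_sc_convex.
Qed.

Lemma gradient_ccs r1 C phi (q : 'rV[R]_n -> R) : tfun r1 C phi -> continuous q ->
  exists2 r, 0 <= r & exists C', ccs C' r (fun x => phi (gradient f x) * q x).
Proof.
move=> tp cq; have [a [m [r [r0 cfu]]]] := confined_exists (tf_r tp) cf.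
have r2 : 0 <= r + 1 + enorm a by rewrite addr_ge0 ?enorm_ge0 // addr_ge0 // ltW.
exists (r + 1 + enorm a) => //; apply: ccs_ex => //.
  apply: ctsM => //; exact: (cts_comp (tf_cts tp) (gradient_cts f2)).
move=> x hx; rewrite (tf_supp tp) ?mul0r // ltNge; apply/negP => hy.
have uN : forall x, (EFin \o f) x != -oo%E by case: cf.
have := confined_bound uN (conv_sc_convex cf) r0 cfu hy
  (gradient_subgrad f2 x (conv_sc_convex cf)).
apply/negP; rewrite -ltNge; have := norm_le_enorm x; have := enormD (x - a) a.
by rewrite subrK; lra.
Qed.

(** Under [z = grad f(x) + e x] the point [yprox] becomes [grad f(x)] and the Jacobian
    [det (D^2 f + e)], whose coefficient of [e ^ j] is [[D^2 f]_(n-j)]. *)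
Lemma proxext_gradient (j : 'I_n.+1) r1 C phi : tfun r1 C phi ->
  proxext j phi (EFin \o f) =
  rint (fun x => phi (gradient f x) * esym_eig (hessian f x) (n - j)).
Proof.
move=> tp; pose F (i : 'I_n.+1) x := phi (gradient f x) * \det (hessian f x + (i.+1%:R)%:M).
transitivity (\sum_i excoef j i * rint (F i)).
  apply: eq_bigr => i _; congr (_ * _).
  have i0 : (0 : R) < i.+1%:R by rewrite ltr0n.
  rewrite (proxint_cov tp i0 cf (gradient_C1mono i0)); apply: eq_rint => x.
  by rewrite yprox_gradient.
have cF (i : 'I_n.+1) : exists2 r, 0 <= r & exists C', ccs C' r (F i).
  apply: (gradient_ccs tp); apply: cts_det => k l; under eq_fun do rewrite mxE.
  by apply: ctsD; [exact: hessian_cts|exact: ctsC].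
(* The [F i] come with different support radii; the sum of these serves for all. *)
have [r r0 cr] : exists2 r, 0 <= r & forall i, exists C', ccs C' r (F i).
  have /choice[rr hr] : forall i, exists r, 0 <= r /\ exists C', ccs C' r (F i).
    by move=> i; have [r] := cF i; exists r.
  exists (\sum_i rr i); first by apply: sumr_ge0 => i _; exact: (hr i).1.
  move=> i; have [C' [h1 h2 h3 h4 h5]] := (hr i).2; exists C'; split => //.
    by apply: sumr_ge0 => k _; exact: (hr k).1.
  move=> x hx; apply: h5; apply: le_lt_trans hx.
  by rewrite (bigD1 i) //= lerDl; apply: sumr_ge0 => k _; exact: (hr k).1.
rewrite -(rint_lin _ r0 cr); apply: eq_rint => x.
rewrite -(esym_ext j (hessian_sym f2 x)) /ext mulr_sumr; apply: eq_bigr => i _.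
by rewrite /F mulrCA.
Qed.

End xspace.

Section yspace.
Context {n : nat} (f : 'rV[R]_n -> R) (mu : R).
Hypotheses (cf : conv_sc (EFin \o f)) (f2 : C2plus f).
Hypothesis fm : C1mono mu (gradient f) (hessian f).
Context {h : 'rV[R]_n -> 'rV[R]_n}.
Hypothesis hK : cancel h (gradient f).

(** The derivative of [h] at [y]; as [h] is the gradient of the convex conjugate of [f], this is the
    Hessian of the conjugate. *)
Definition dinv y := invmx (hessian f (h y)).

Lemma hinv_vfre y : vfre h y (dinv y).
Proof. exact: (C1mono_inv_fre fm hK). Qed.

Lemma hinv_cts : continuous h.
Proof. exact: (C1mono_inv_cts fm hK). Qed.

Lemma dinv_cts i k : continuous (fun y => dinv y i k).
Proof.
apply: cts_invmx => [a b|y]; last exact: (C1mono_unit fm).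
by apply: (cts_comp (g := h) (hessian_cts f2 (i := a) (j := b))); exact: hinv_cts.
Qed.

Lemma dinv_psd y : psd (dinv y).
Proof.
have sH := hessian_sym f2 (h y).
have uH : hessian f (h y) \in unitmx := C1mono_unit fm _.
have sB : (dinv y)^T = dinv y by rewrite /dinv trmx_inv sH.
split => // v; have := C1mono_pos fm (h y) (v *m dinv y).
rewrite mulmxKV // dotC; apply: le_trans.
by rewrite mulr_ge0 ?sqr_ge0 // ltW // (c1_gt0 fm).
Qed.

Lemma hinv_mono y y' : 0 <= dot (h y - h y') (y - y').
Proof.
have := c1_mono fm (h y) (h y'); rewrite !hK dotC; apply: le_trans.
by rewrite mulr_ge0 ?sqr_ge0 // ltW // (c1_gt0 fm).
Qed.

Lemma hinv_subgrad y : subgrad (EFin \o f) (h y) y.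
Proof.
by rewrite -{2}(hK y); apply: gradient_subgrad => //; exact: conv_sc_convex.
Qed.

(** Dual form of [proxext_gradient], from the substitution [z = y + e h(y)] with Jacobian
    [det (1 + e Dh)]. Here [phi] is evaluated at the integration variable itself, so a radial
    structure of [phi] can be used. *)
Lemma proxext_hinv (j : 'I_n.+1) r1 C phi : tfun r1 C phi ->
  proxext j phi (EFin \o f) = rint (fun y => phi y * esym_eig (dinv y) j).
Proof.
move=> tp; pose F (i : 'I_n.+1) y := phi y * \det (1%:M + i.+1%:R *: dinv y).
transitivity (\sum_i excoef j i * rint (F i)).
  apply: eq_bigr => i _; congr (_ * _).
  have i0 : (0 : R) < i.+1%:R by rewrite ltr0n.
  have GJ : C1mono 1 (fun y => y + i.+1%:R *: h y) (fun y => 1%:M + i.+1%:R *: dinv y).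
    split => //.
    - by move=> y; apply: vfreD; [exact: vfre_id|apply: vfreZ; exact: hinv_vfre].
    - move=> a b; under eq_fun do rewrite mxE [X in _ + X]mxE.
      apply: ctsD; first exact: ctsC.
      by apply: ctsM; [exact: ctsC|exact: dinv_cts].
    - move=> x y; have := hinv_mono x y.
      have -> : x + i.+1%:R *: h x - (y + i.+1%:R *: h y) = (x - y) + i.+1%:R *: (h x - h y).
        by apply/rowP => k; rewrite !mxE; ring.
      move: (x - y) (h x - h y) => d g gd; rewrite mul1r dotDl dotZl.
      by rewrite ler_wpDr ?sqr_norm_le_dot // mulr_ge0.
  rewrite (proxint_cov tp i0 cf GJ); apply: eq_rint => y; rewrite /F; congr (phi _ * _).
  rewrite /yprox (@prox_uniq _ _ _ _ _ (h y)) //; first by rewrite addrK.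
  by rewrite addrK; exact: hinv_subgrad.
have cr (i : 'I_n.+1) : exists C', ccs C' r1 (F i).
  apply: ccs_ex; last by move=> y hy; rewrite /F (tf_supp tp) ?mul0r //;
    exact: lt_le_trans hy (norm_le_enorm _).
  - apply: ctsM; first exact: tf_cts tp.
    apply: cts_det => a b; under eq_fun do rewrite mxE [X in _ + X]mxE.
    apply: ctsD; first exact: ctsC.
    by apply: ctsM; [exact: ctsC|exact: dinv_cts].
  - exact: tf_r tp.
rewrite -(rint_lin _ (tf_r tp) cr); apply: eq_rint => y.
have [sB _] := dinv_psd y.
rewrite -(esym_ext1 j sB) /ext mulr_sumr; apply: eq_bigr => i _.
by rewrite /F mulrCA.
Qed.

End yspace.
End formulas.

(** * Invariance of volume under compactly supported perturbations *)

Section perturbation.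
Context {R : realType}.

Lemma bounded_on_ball n (F : 'rV[R]_n -> R) r : continuous F -> 0 <= r ->
  exists b, forall y, enorm y <= r -> F y <= b.
Proof.
move=> cF r0; have cK := @compact_enorm R n 0 0 r.
have K0 : [set x : 'rV[R]_n | 0 <= enorm (x - 0) <= r] !=set0.
  by exists 0; rewrite /= subr0 enorm0 lexx.
have [c _ hc] := EVT_max_rV K0 cK (continuous_subspaceT cF).
by exists (F c) => y hy; apply: hc; rewrite inE /= subr0 enorm_ge0.
Qed.

Lemma ccs_weaken n C r r' (F : 'rV[R]_n -> R) : ccs C r F -> r <= r' -> ccs C r' F.
Proof.
move=> [C0 r0 cF bF sF] rr; split => //; first exact: le_trans rr.
by move=> x /(le_lt_trans rr); exact: sF.
Qed.

Lemma vfre_line n (X : 'rV[R]_n -> 'rV[R]_n) JX x d w s : vfre X (x + s *: d) JX ->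
  is_derive s (1 : R) (fun s => dot (X (x + s *: d)) w) (dot (d *m JX) w).
Proof.
move=> hX; apply: is_derive_eps => e e0.
pose N := n%:R * (`|d| * `|w|) + 1.
have N0 : 0 < N by rewrite ltr_wpDl // !mulr_ge0.
have q0 : 0 < e / N by rewrite divr_gt0.
have /nbhs_ballP[r /= r0 hr] := hX _ q0.
have D0 : 0 < `|d| + 1 by rewrite ltr_wpDl.
have rd : 0 < r / (`|d| + 1) by rewrite divr_gt0.
have /cvgrPdist_lt /(_ _ rd) := @cvg_id _ (nbhs s).
apply: filterS => t; rewrite distrC => ht.
have E : x + t *: d - (x + s *: d) = (t - s) *: d.
  by apply/rowP => i; rewrite !mxE; ring.
have /hr : ball (x + s *: d) r (x + t *: d).
  rewrite mx_norm_ball /ball_ /= distrC E normrZ.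
  apply: (@le_lt_trans _ _ (`|t - s| * (`|d| + 1))); first by rewrite ler_wpM2l // lerDl.
  by rewrite -ltr_pdivlMr.
rewrite E -scalemxAl -dotBl -dotZl -dotBl => h.
apply: (le_trans (dot_le_norm _ _)).
apply: (@le_trans _ _ (n%:R * (e / N * `|(t - s) *: d| * `|w|))).
  by rewrite ler_wpM2l // ler_wpM2r.
rewrite normrZ.
have -> : n%:R * (e / N * (`|t - s| * `|d|) * `|w|) = e / N * `|t - s| * (n%:R * (`|d| * `|w|)).
  by ring.
apply: (@le_trans _ _ (e / N * `|t - s| * N)).
  by rewrite ler_wpM2l ?lerDl // mulr_ge0 // ltW.
by rewrite mulrAC divfK // gt_eqF.
Qed.

Lemma vfre_dot_lip n (X : 'rV[R]_n -> 'rV[R]_n) JX K : (forall y, vfre X y (JX y)) ->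
  (forall y, `|JX y| <= K) ->
  forall x y, `|dot (X x - X y) (x - y)| <= n%:R ^+ 2 * K * `|x - y| ^+ 2.
Proof.
move=> hX hK x y; pose d := x - y.
pose phi s := dot (X (y + s *: d)) d.
have dphi (s : R) : is_derive s (1 : R) phi (dot (d *m JX (y + s *: d)) d).
  exact: vfre_line (hX _).
have cphi : continuous phi.
  by move=> t; apply/differentiable_continuous/derivable1_diffP; case: (dphi t).
have [c _] := @MVT R phi (fun s => dot (d *m JX (y + s *: d)) d) 0 1 ltr01
  (fun s _ => dphi s) (continuous_subspaceT cphi).
have -> : phi 1 = dot (X x) d by rewrite /phi scale1r /d addrC subrK.
have -> : phi 0 = dot (X y) d by rewrite /phi scale0r addr0.
rewrite subr0 mulr1 -dotBl -/d => ->.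
apply: (le_trans (dot_le_norm _ _)).
apply: (@le_trans _ _ (n%:R * (n%:R * (`|d| * K) * `|d|))).
  rewrite ler_wpM2l // ler_wpM2r // (le_trans (norm_mulmx _ _)) // ler_wpM2l // ler_wpM2l //.
by rewrite le_eqVlt; apply/orP; left; apply/eqP; ring.
Qed.

(** A continuous substitute for the indicator of the ball of radius [K], as the change of variables
    is stated for continuous integrands. *)
Definition cutoff n (K : R) (z : 'rV[R]_n) : R := Num.max 0 (Num.min 1 (K + 1 - enorm z)).

Lemma cts_min (U : topologicalType) (f g : U -> R) :
  continuous f -> continuous g -> continuous (fun x => Num.min (f x) (g x)).
Proof.
by move=> cf cg x; apply: (@continuous_min _ _ _ _ _); [exact: cf|exact: cg].
Qed.

Lemma cutoff_cts n K : continuous (@cutoff n K).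
Proof.
apply: cts_max; first exact: ctsC.
apply: cts_min; first exact: ctsC.
by apply: ctsB; [exact: ctsC|exact: cts_enorm].
Qed.

Lemma cutoff_ge0 n K z : 0 <= @cutoff n K z.
Proof. by rewrite le_max lexx. Qed.

Lemma cutoff_le1 n K z : @cutoff n K z <= 1.
Proof. by rewrite ge_max ler01 ge_min lexx. Qed.

Lemma cutoff1 n K z : enorm z <= K -> @cutoff n K z = 1.
Proof.
move=> h; have h1 : 1 <= K + 1 - enorm z by lra.
by rewrite /cutoff (min_idPl h1) (max_idPr ler01).
Qed.

Lemma cutoff0 n K z : K + 1 <= enorm z -> @cutoff n K z = 0.
Proof.
move=> h; apply/max_idPl; rewrite ge_min; apply/orP; right; lra.
Qed.

Lemma cutoff_ccs n K : 0 <= K -> ccs 1 (K + 1) (@cutoff n K).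
Proof.
move=> K0; split => //; first by rewrite addr_ge0.
- exact: cutoff_cts.
- by move=> x; rewrite ger0_norm ?cutoff_ge0 // cutoff_le1.
- move=> x hx; apply: cutoff0; exact: le_trans (ltW hx) (norm_le_enorm _).
Qed.

Lemma cutoff_C1mono_ccs n e (G : 'rV[R]_n -> 'rV[R]_n) J K : C1mono e G J -> 0 <= K ->
  exists2 r, 0 <= r & exists C, ccs C r (fun y => cutoff K (G y) * \det (J y)).
Proof.
move=> GJ K0; have e0 := c1_gt0 GJ.
have r0 : 0 <= n%:R / e * (K + 1 + `|G 0|).
  by rewrite mulr_ge0 ?divr_ge0 ?addr_ge0 // ltW.
exists (n%:R / e * (K + 1 + `|G 0|)) => //; apply: ccs_ex => //.
  apply: ctsM; first exact: (cts_comp (@cutoff_cts n K) (C1mono_cts GJ)).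
  by apply: cts_det => i k; exact: (c1_cts GJ i k).
move=> y hy; rewrite cutoff0 ?mul0r // leNgt; apply/negP => hG.
move: hy; apply/negP; rewrite -leNgt; have := C1mono_lip GJ y 0.
rewrite subr0 => h; apply: (le_trans h); rewrite ler_wpM2l //; first by rewrite divr_ge0 // ltW.
apply: (le_trans (ler_normB _ _)); rewrite lerD2r.
by rewrite (le_trans (norm_le_enorm _)) // ltW.
Qed.

Lemma rint_cutoff_cov n e (G : 'rV[R]_n -> 'rV[R]_n) J K : C1mono e G J ->
  rint (fun y => cutoff K (G y) * \det (J y)) = rint (@cutoff n K).
Proof.
move=> GJ; rewrite /rint (change_of_variables_signed GJ) //; exact: cutoff_cts.
Qed.

(* The volume of the image of a large ball does not change when G is perturbed to     *)
(* G + t X with X compactly supported; the term of order t of the integral vanishes.   *)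
Lemma cov_perturb n e (G : 'rV[R]_n -> 'rV[R]_n) J X JX r1 : (0 < n)%N -> C1mono e G J ->
  0 <= r1 -> (forall y, vfre X y (JX y)) -> (forall i k, continuous (fun y => JX y i k)) ->
  (forall y, r1 < enorm y -> X y = 0) -> (forall y, r1 < enorm y -> JX y = 0) ->
  rint (fun y => \det (J y) * \tr (invmx (J y) *m JX y)) = 0.
Proof.
move=> n0 GJ r10 hX cJX X0 JX0; have e0 := c1_gt0 GJ.
have [K KK] : exists K, forall y, `|JX y| <= K.
  have /choice[C hC] : forall ik : 'I_n * 'I_n, exists C, ccs C r1 (fun y => JX y ik.1 ik.2).
    move=> [i k]; apply: ccs_ex => // y hy /=; rewrite JX0 ?mxE //.
    exact: lt_le_trans hy (norm_le_enorm _).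
  exists (\sum_ik C ik) => y; apply: ler_mx_normP => [|i k].
    by apply: sumr_ge0 => ik _; exact: (ccs_C (hC ik)).
  apply: (le_trans (ccs_bd (hC (i, k)) y)); rewrite (bigD1 (i, k)) //= lerDl.
  by apply: sumr_ge0 => ik _; exact: (ccs_C (hC ik)).
have K0 : 0 <= K by apply: le_trans (KK 0).
have cX : continuous X by move=> x; exact: (vfre_cvg (hX x)).
pose Q := n%:R ^+ 2 * K.
have Q0 : 0 <= Q by rewrite mulr_ge0.
have pert t : 0 <= t <= 1 -> t * Q <= e / 2 ->
    C1mono (e / 2) (fun y => G y + t *: X y) (fun y => J y + t *: JX y).
  move=> /andP[t0 t1] tQ; split.
  - by rewrite divr_gt0.
  - by move=> x; apply: vfreD; [exact: (c1_fre GJ x)|apply: vfreZ].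
  - move=> i k; under eq_fun do rewrite mxE [X in _ + X]mxE.
    apply: ctsD; first exact: (c1_cts GJ i k).
    by apply: ctsM; [exact: ctsC|exact: cJX].
  - move=> x y; have h1 := c1_mono GJ x y; have h2 := vfre_dot_lip hX KK x y.
    have -> : G x + t *: X x - (G y + t *: X y) = (G x - G y) + t *: (X x - X y).
      by apply/rowP => i; rewrite !mxE; ring.
    rewrite dotDl dotZl; move: h2; rewrite ler_norml => /andP[h2 _].
    have : t * Q * `|x - y| ^+ 2 <= e / 2 * `|x - y| ^+ 2 by rewrite ler_wpM2r // sqr_ge0.
    have : t * - (Q * `|x - y| ^+ 2) <= t * dot (X x - X y) (x - y) by rewrite ler_wpM2l.
    have -> : e / 2 * `|x - y| ^+ 2 = e * `|x - y| ^+ 2 - e / 2 * `|x - y| ^+ 2 by field.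
    rewrite mulrN mulrA; lra.
have [bG hG] := bounded_on_ball (cts_comp (@cts_enorm R n) (C1mono_cts GJ)) r10.
have [bX hbX] := bounded_on_ball (cts_comp (@cts_enorm R n) cX) r10.
(* For [0 <= t <= 1] the map [G + t X] sends the ball of radius [r1] into the ball of radius [L],
   where the cutoff is 1. Outside the ball of radius [r1] the perturbation vanishes and both
   integrands agree. *)
pose L := Num.max 0 (bG + bX).
have L0 : 0 <= L by rewrite le_max lexx.
have bX0 : 0 <= bX by apply: le_trans (enorm_ge0 _) (hbX 0 _); rewrite enorm0.
have pertL t y : 0 <= t <= 1 -> enorm y <= r1 -> enorm (G y + t *: X y) <= L.
  move=> /andP[t0 t1] hy; apply: (le_trans (enormD _ _)).
  rewrite le_max; apply/orP; right; rewrite enormZ ger0_norm //; apply: lerD; first exact: hG.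
  by apply: le_trans (hbX _ hy); rewrite ler_piMl // enorm_ge0.
have step t : 0 <= t <= 1 -> t * Q <= e / 2 ->
    (exists C, ccs C r1 (fun y => \det (J y + t *: JX y) - \det (J y))) /\
    rint (fun y => \det (J y + t *: JX y) - \det (J y)) = 0.
  move=> t01 tQ; have Gt := pert t t01 tQ.
  have s0 : r1 >= 0 by [].
  split.
    apply: ccs_ex => //.
      apply: ctsB; last by apply: cts_det => i k; exact: (c1_cts GJ i k).
      by apply: cts_det => i k; exact: (c1_cts Gt i k).
    move=> y hy; rewrite JX0 ?scaler0 ?addr0 ?subrr //.
    exact: lt_le_trans hy (norm_le_enorm _).
  have [ra ra0 [Ca ha]] := cutoff_C1mono_ccs GJ L0.
  have [rb rb0 [Cb hb]] := cutoff_C1mono_ccs Gt L0.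
  have ha' := ccs_weaken ha (ler_wpDr rb0 (lexx ra)).
  have hb' := ccs_weaken hb (ler_wpDl ra0 (lexx rb)).
  transitivity (rint (fun y => cutoff L (G y + t *: X y) * \det (J y + t *: JX y) -
    cutoff L (G y) * \det (J y))).
    apply: eq_rint => y; have [hy|hy] := leP (enorm y) r1.
      rewrite cutoff1 ?pertL // cutoff1 ?mul1r //.
      by rewrite le_max; apply/orP; right; apply: le_trans (hG _ hy) _; rewrite lerDl.
    by rewrite X0 // JX0 // !scaler0 !addr0 !subrr.
  by rewrite (rintB hb' ha') (rint_cutoff_cov L Gt) (rint_cutoff_cov L GJ) subrr.
(* Scaled so that all the nodes [(i + 1) tau] used to extract a coefficient are admissible for
   [pert]. *)
pose tau := Num.min 1 (e / 2 / (Q + 1)) / n.+1%:R.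
have Q1 : 0 < Q + 1 by rewrite ltr_wpDl.
have tau0 : 0 < tau by rewrite divr_gt0 // lt_min ltr01 !divr_gt0.
have tauE (i : 'I_n.+1) : 0 <= i.+1%:R * tau <= 1 /\ i.+1%:R * tau * Q <= e / 2.
  have h : i.+1%:R * tau <= Num.min 1 (e / 2 / (Q + 1)).
    rewrite /tau mulrCA ler_piMr //; first by rewrite ltW // lt_min ltr01 !divr_gt0.
    by rewrite ler_pdivrMr // mul1r ler_nat.
  have itau : 0 <= i.+1%:R * tau by rewrite mulr_ge0 // ltW.
  split; first by rewrite itau (le_trans h) // ge_min lexx.
  apply: (@le_trans _ _ (e / 2 / (Q + 1) * (Q + 1))); last by rewrite divfK // gt_eqF.
  apply: ler_pM => //.
    by rewrite (le_trans h) // ge_min lexx orbT.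
  by rewrite lerDl.
have j1 : (1 < n.+1)%N by rewrite ltnS.
pose j := Ordinal j1.
pose F (i : 'I_n.+1) y := \det (J y + (i.+1%:R * tau) *: JX y) - \det (J y).
have cr (i : 'I_n.+1) : exists C, ccs C r1 (F i) by exact: (step _ (tauE i).1 (tauE i).2).1.
have : rint (fun y => \sum_i excoef j i * F i y) = 0.
  rewrite (rint_lin _ r10 cr) big1 // => i _.
  by rewrite (step _ (tauE i).1 (tauE i).2).2 mulr0.
(* The first-order coefficient: the constant [det (J y)] contributes nothing to it, and Jacobi's
   formula gives the rest. *)
have E y : \sum_i excoef j i * F i y = tau * (\det (J y) * \tr (invmx (J y) *m JX y)).
  transitivity (ext j (fun s => \det (J y + s *: (tau *: JX y)) - \det (J y) * 1)).
    by apply: eq_bigr => i _; rewrite /F scalerA mulr1.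
  rewrite extB extZ (@ext_poly _ _ j (fun k => (k == 0%N)%:R) (fun=> 1)); last first.
    move=> s _; rewrite big_ord_recl /= expr0 mulr1 big1 ?addr0 // => i _.
    by rewrite mul0r.
  rewrite mulr0 subr0 ext_det_1 //; last exact: (C1mono_unit GJ).
  by rewrite -scalemxAr mxtraceZ mulrCA.
rewrite (eq_rint E) => h.
have [C hC] : exists C, ccs C r1 (fun y => \det (J y) * \tr (invmx (J y) *m JX y)).
  apply: ccs_ex => //.
    apply: ctsM; first by apply: cts_det => i k; exact: (c1_cts GJ i k).
    apply: cts_sum => i _; apply: cts_mulmx => a b //.
    by apply: cts_invmx => [c d|y]; [exact: (c1_cts GJ c d)|exact: (C1mono_unit GJ)].
  move=> y hy; rewrite JX0 ?mulmx0 ?mxtrace0 ?mulr0 //.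
  exact: lt_le_trans hy (norm_le_enorm _).
move: h; rewrite (rintZ tau hC) => /eqP; rewrite mulf_eq0 gt_eqF //=.
by move/eqP.
Qed.

End perturbation.

(** * Rules for directional derivatives *)

Section directional.
Context {R : realType} {n : nat}.
Implicit Types (F : 'rV[R]_n -> R) (x v : 'rV[R]_n).

Lemma is_derive_of_line F x v d :
  is_derive (0 : R) (1 : R) (fun s => F (x + s *: v)) d -> is_derive x v F d.
Proof.
have E : (fun h : R => h^-1 *: (((fun s => F (x + s *: v)) \o shift 0) (h *: (1 : R)) -
     F (x + 0 *: v))) = (fun h => h^-1 *: ((F \o shift x) (h *: v) - F x)).
  apply/funext => h /=; rewrite scale0r !addr0; congr (_ *: (F _ - _)).
  have -> : h *: (1 : R) = h by exact: mulr1.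
  by rewrite addrC.
move=> [h1 h2]; apply: DeriveDef; first by rewrite /derivable -E.
by rewrite /derive -E.
Qed.

Lemma line_of_is_derive F x v d :
  is_derive x v F d -> is_derive (0 : R) (1 : R) (fun s => F (x + s *: v)) d.
Proof.
have E : (fun h : R => h^-1 *: (((fun s => F (x + s *: v)) \o shift 0) (h *: (1 : R)) -
     F (x + 0 *: v))) = (fun h => h^-1 *: ((F \o shift x) (h *: v) - F x)).
  apply/funext => h /=; rewrite scale0r !addr0; congr (_ *: (F _ - _)).
  have -> : h *: (1 : R) = h by exact: mulr1.
  by rewrite addrC.
move=> [h1 h2]; apply: DeriveDef; first by rewrite /derivable E.
by rewrite /derive E.
Qed.

Lemma deriveD_fun F G x v a b : is_derive x v F a -> is_derive x v G b ->
  is_derive x v (fun y => F y + G y) (a + b).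
Proof. by move=> hF hG; exact: (is_deriveD hF hG). Qed.

Lemma deriveM_fun F G x v a b : is_derive x v F a -> is_derive x v G b ->
  is_derive x v (fun y => F y * G y) (F x * b + G x * a).
Proof. by move=> hF hG; exact: (is_deriveM hF hG). Qed.

Lemma derive_cst_fun x v (c : R) : is_derive x v (fun _ => c) 0.
Proof. exact: is_derive_cst. Qed.

Lemma derive_sum_fun (I : Type) (r : seq I) (F : I -> 'rV[R]_n -> R) x v (d : I -> R) :
  (forall i, is_derive x v (F i) (d i)) ->
  is_derive x v (fun y => \sum_(i <- r) F i y) (\sum_(i <- r) d i).
Proof.
move=> h; elim: r => [|i r IH].
  by rewrite big_nil; under eq_fun do rewrite big_nil; exact: derive_cst_fun.
by rewrite big_cons; under eq_fun do rewrite big_cons; exact: deriveD_fun.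
Qed.

Lemma derive_comp_fun (phi : R -> R) F x v a b : is_derive (F x) (1 : R) phi a ->
  is_derive x v F b -> is_derive x v (fun y => phi (F y)) (a * b).
Proof.
move=> hphi /line_of_is_derive hF; apply: is_derive_of_line.
apply: (@is_derive1_comp _ phi (fun s => F (x + s *: v))) => //.
by rewrite scale0r addr0.
Qed.

Lemma derive_coord x v c : is_derive x v (fun y => y 0 c) (v 0 c).
Proof.
apply: is_derive_of_line.
apply: is_derive_eps => e e0; apply: (@filterE _ (nbhs (0 : R)) (nbhs_filter _)) => s.
rewrite !mxE (_ : _ - _ = 0); first by rewrite normr0 mulr_ge0 // ltW.
by ring.
Qed.

Lemma vfre_partials p (X : 'rV[R]_n -> 'rV[R]_p) (JX : 'rV[R]_n -> 'M[R]_(n, p)) :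
  (forall i c x, is_derive x (delta_mx 0 i) (fun y => X y 0 c) (JX x i c)) ->
  (forall i c, continuous (fun x => JX x i c)) -> forall x, vfre X x (JX x).
Proof.
move=> dX cJ x; apply: vfre_coord => c e e0.
have pE i : partial i (fun y => X y 0 c) = fun x => JX x i c.
  by apply/funext => y; exact: derive_val.
have d1 i y : derivable (fun y => X y 0 c) y (delta_mx 0 i) by case: (dX i c y).
have c1 i : continuous (partial i (fun y => X y 0 c)) by rewrite pE; exact: cJ.
have := partials_fre d1 c1 x e0; apply: filterS => y.
congr (`|_ - _| <= _); rewrite mxE; apply: eq_bigr => i _.
by rewrite [gradient _ _ _ _]mxE pE.
Qed.

End directional.

(** * The smoothed norm and its Hessian *)

Section radial.
Context {R : realType} {n : nat} (k : R).
Hypothesis k0 : 0 < k.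
Implicit Types x y : 'rV[R]_n.

Definition radius y := Num.sqrt (dot y y + k ^+ 2).

Lemma radius_arg_gt0 y : 0 < dot y y + k ^+ 2.
Proof. by rewrite ltr_wpDl ?dot_ge0 // exprn_gt0. Qed.

Lemma radius_gt0 y : 0 < radius y.
Proof. by rewrite sqrtr_gt0 radius_arg_gt0. Qed.

Lemma sqr_radius y : radius y ^+ 2 = dot y y + k ^+ 2.
Proof. by rewrite sqr_sqrtr // ltW // radius_arg_gt0. Qed.

Lemma radius_ge y : k <= radius y.
Proof.
rewrite -(@ler_pXn2r _ 2) ?nnegrE ?(ltW k0) ?(ltW (radius_gt0 y)) // sqr_radius lerDr.
exact: dot_ge0.
Qed.

Lemma enorm_le_radius y : enorm y <= radius y.
Proof.
rewrite -(@ler_pXn2r _ 2) ?nnegrE ?enorm_ge0 ?(ltW (radius_gt0 y)) // sqr_enorm sqr_radius.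
by rewrite lerDl sqr_ge0.
Qed.

Lemma radius_cts : continuous radius.
Proof.
apply: (cts_comp (@cts_sqrt R)); apply: ctsD; last exact: ctsC.
by apply: cts_dot => i; exact: cts_coord.
Qed.

Lemma derive_radius x i : is_derive x (delta_mx 0 i) radius (x 0 i / radius x).
Proof.
have hd : is_derive x (delta_mx 0 i) (fun y => dot y y + k ^+ 2) (2 * x 0 i).
  suff hdot : is_derive x (delta_mx 0 i) (fun y => dot y y) (2 * x 0 i).
    by have := deriveD_fun hdot (derive_cst_fun x (delta_mx 0 i) (k ^+ 2)); rewrite addr0.
  have h (l : 'I_n) : is_derive x (delta_mx 0 i) (fun y => y 0 l * y 0 l)
      (2 * (x 0 l * (delta_mx 0 i : 'rV[R]_n) 0 l)).
    apply: is_derive_eq.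
      exact: (deriveM_fun (derive_coord x (delta_mx 0 i) l) (derive_coord x (delta_mx 0 i) l)).
    by rewrite [RHS]mulr_natl mulr2n.
  apply: is_derive_eq; first exact: (derive_sum_fun (index_enum 'I_n) h).
  rewrite -mulr_sumr (bigD1 i) //= big1 ?addr0 => [|l li].
    by rewrite mxE !eqxx mulr1.
  by rewrite mxE eqxx /= (negbTE li) mulr0.
apply: is_derive_eq.
  exact: (derive_comp_fun (is_derive1_sqrt (radius_arg_gt0 x)) hd).
by rewrite -/(radius x) invfM mulrACA mulVf // mul1r mulrC.
Qed.

Lemma derive_radial (psi : R -> R) d x i : is_derive (radius x) (1 : R) psi d ->
  is_derive x (delta_mx 0 i) (fun y => psi (radius y)) (d * (x 0 i / radius x)).
Proof. by move=> h; exact: (derive_comp_fun h (derive_radius x i)). Qed.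

Lemma cts_radial (psi : R -> R) : (forall s, k <= s -> psi @ s --> psi s) ->
  continuous (fun y => psi (radius y)).
Proof.
move=> h y; apply: (@continuous_comp _ _ _ radius psi); first exact: radius_cts.
by apply: h; exact: radius_ge.
Qed.

(** The Hessian of [radius] multiplied by [radius]; compare [unit_radial_vfre]. *)
Definition rhess y : 'M[R]_n := 1%:M - (radius y ^- 2) *: (y^T *m y).

Lemma rhessE y i c : rhess y i c = (i == c)%:R - radius y ^- 2 * (y 0 i * y 0 c).
Proof. by rewrite !mxE big_ord1 !mxE. Qed.

Lemma rhess_cts i c : continuous (fun y => rhess y i c).
Proof.
under eq_fun do rewrite rhessE; apply: ctsB; first exact: ctsC.
apply: ctsM; last by apply: ctsM; exact: cts_coord.
apply: ctsV => [y|]; first by rewrite expf_neq0 // gt_eqF // radius_gt0.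
rewrite (_ : (fun _ => _) = fun y => radius y * radius y).
  by apply: ctsM; exact: radius_cts.
by apply/funext => y; rewrite expr2.
Qed.

Lemma unit_radial_vfre x : vfre (fun y => (radius y)^-1 *: y) x ((radius x)^-1 *: rhess x).
Proof.
apply: (vfre_partials (JX := fun x => (radius x)^-1 *: rhess x)) => [i c y|i c].
  have r0 : radius y != 0 by rewrite gt_eqF // radius_gt0.
  rewrite (_ : (fun _ => _) = fun y => (radius y)^-1 * y 0 c); last first.
    by apply/funext => z; rewrite mxE.
  have hV : is_derive (radius y) (1 : R) (fun s => s^-1) (- radius y ^- 2).
    by apply: is_derive_eq; [exact: is_deriveV|rewrite /GRing.scale /= mulr1].
  apply: is_derive_eq.
    exact: (deriveM_fun (derive_radial i hV) (derive_coord y (delta_mx 0 i) c)).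
  rewrite [((radius y)^-1 *: rhess y) i c]mxE rhessE mxE eqxx /= [c == i]eq_sym.
  by case: (i == c); field.
under eq_fun do rewrite mxE; apply: ctsM; last exact: rhess_cts.
by apply: ctsV => [y|]; [rewrite gt_eqF // radius_gt0|exact: radius_cts].
Qed.

(** With [a], [b] the two radii, the inner product equals [(1/a + 1/b)(a b - k^2 - <x, y>)], which
    is nonnegative by Cauchy-Schwarz for the vectors [(x, k)] and [(y, k)]. *)
Lemma unit_radial_mono x y : 0 <= dot ((radius x)^-1 *: x - (radius y)^-1 *: y) (x - y).
Proof.
set a := radius x; set b := radius y.
have a0 : 0 < a := radius_gt0 x; have b0 : 0 < b := radius_gt0 y.
have ax : dot x x = a ^+ 2 - k ^+ 2 by rewrite sqr_radius addrK.
have bx : dot y y = b ^+ 2 - k ^+ 2 by rewrite sqr_radius addrK.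
have xy : dot x y <= a * b - k ^+ 2.
  have h := cauchy_schwarz x y.
  suff : enorm x * enorm y + k ^+ 2 <= a * b by lra.
  have ab0 : 0 <= a * b by rewrite ltW // mulr_gt0.
  have en0 : 0 <= enorm x * enorm y + k ^+ 2 by rewrite addr_ge0 ?sqr_ge0 ?mulr_ge0 ?enorm_ge0.
  rewrite -(@ler_pXn2r _ 2) ?nnegrE //.
  rewrite [in leRHS]exprMn !sqr_radius -!sqr_enorm.
  have := sqr_ge0 (enorm x - enorm y); have := sqr_ge0 k; move: (enorm x) (enorm y) => u w; nra.
have -> : dot (a^-1 *: x - b^-1 *: y) (x - y) = (a^-1 + b^-1) * (a * b - k ^+ 2 - dot x y).
  by rewrite !dotE (dotC y x) ax bx; field; rewrite !gt_eqF.
by rewrite mulr_ge0 ?subr_ge0 // addr_ge0 // invr_ge0 ltW.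
Qed.

(** An explicit root [1 - t y^T y]: on the line of [y] its eigenvalue is [k / c], the square root of
    [1 - |y|^2 / c^2], and it is the identity on the orthogonal complement. *)
Lemma rhess_sqrt y : exists C : 'M[R]_n, [/\ C^T = C, C \in unitmx & C *m C = rhess y].
Proof.
set c := radius y; have c0 : 0 < c := radius_gt0 y.
pose t := (c * (c + k))^-1.
have ck : 0 < c + k by rewrite addr_gt0.
have yy : dot y y = c ^+ 2 - k ^+ 2 by rewrite sqr_radius addrK.
exists (1%:M - t *: (y^T *m y)); split.
- by rewrite raddfB /= trmx1 linearZ /= trmx_mul trmxK.
- apply: (@mxpos_unit _ _ (k / c)); first by rewrite divr_gt0.
  move=> v; rewrite mulmxBr mulmx1 dotBl -scalemxAr dotZl.
  have -> : dot (v *m (y^T *m y)) v = dot v y ^+ 2.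
    by rewrite mulmxA [v *m y^T]mx11_scalar -dotE_mx mul_scalar_mx dotZl (dotC y) expr2.
  apply: (@le_trans _ _ (k / c * dot v v)).
    by rewrite ler_wpM2l ?sqr_norm_le_dot // divr_ge0 // ltW.
  have cs : dot v y ^+ 2 <= dot v v * dot y y.
    rewrite -!sqr_enorm -exprMn -(@ger0_norm _ (dot v y ^+ 2)) ?sqr_ge0 // normrX.
    rewrite ler_pXn2r ?nnegrE ?mulr_ge0 ?enorm_ge0 // ler_norml cauchy_schwarzN.
    exact: cauchy_schwarz.
  have t0 : 0 <= t by rewrite invr_ge0 mulr_ge0 // ltW.
  have : t * dot v y ^+ 2 <= t * (dot v v * dot y y) by rewrite ler_wpM2l.
  have -> : t * (dot v v * dot y y) = dot v v - k / c * dot v v.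
    by rewrite yy /t; field; rewrite !gt_eqF.
  lra.
- have yyE : y^T *m y *m (y^T *m y) = dot y y *: (y^T *m y).
    rewrite mulmxA -(mulmxA y^T) [y *m y^T]mx11_scalar -dotE_mx mul_mx_scalar.
    by rewrite -scalemxAl.
  rewrite mulmxBl mul1mx mulmxBr mulmx1 -scalemxAl -scalemxAr yyE !scalerA.
  rewrite /rhess -/c; move: (y^T *m y) => Y.
  have -> : c ^- 2 = 2 * t - t * t * dot y y.
    by rewrite yy /t; field; rewrite !gt_eqF.
  by apply/matrixP => a b; rewrite !mxE; ring.
Qed.

End radial.

(** * Antiderivatives with bounded support *)

Section primitive.
Context {R : realType}.

Lemma primitive_exists (g : R -> R) (r1 : R) : 0 < r1 -> continuous g -> (forall t, r1 <= t -> g t = 0) ->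
  exists A : R -> R, (forall s : R, 0 < s -> is_derive s (1 : R) A (- g s)) /\
    (forall s : R, r1 <= s -> A s = 0).
Proof.
move=> r0 cg g0.
pose I (x : R) : R := (\int[@lebesgue_measure R]_(t in `[0, x]) g t)%R.
have dI (s : R) : 0 < s -> is_derive s (1 : R) I (g s).
  move=> s0; have su : s < s + 1 by rewrite ltrDl.
  have ig : (@lebesgue_measure R).-integrable `[0, s + 1] (EFin \o g).
    apply: continuous_compact_integrable; first exact: segment_compact.
    exact: continuous_subspaceT.
  have [h1 h2] := continuous_FTC1_closed su ig s0 (cg s).
  by apply: DeriveDef; [exact: h1|rewrite -derive1E; exact: h2].
exists (fun s => I r1 - I s); split.
  move=> s s0; rewrite -[- g s]add0r.
  exact: (@is_deriveB _ _ _ (cst (I r1)) I s 1 0 (g s) (is_derive_cst _ _ _) (dI s s0)).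
move=> s; rewrite le_eqVlt => /predU1P[<-|rs]; first by rewrite subrr.
have d1 (x : R) : x \in `]r1, s[%R -> is_derive x (1 : R) I (g x).
  by rewrite in_itv /= => /andP[h _]; apply: dI; exact: lt_trans h.
have c1 : {within `[r1, s], continuous I}.
  apply: derivable_within_continuous => x; rewrite in_itv /= => /andP[h _].
  by case: (dI x (lt_le_trans r0 h)).
have [c] := MVT rs d1 c1.
rewrite in_itv /= => /andP[h _] /eqP; rewrite g0; last exact: ltW.
by rewrite mul0r subr_eq0 => /eqP ->; rewrite subrr.
Qed.

End primitive.

(** * Traces of inverses as polynomial coefficients *)

Section trace_expansion.
Context {R : realType} {n : nat}.
Implicit Types (B M : 'M[R]_n).

Lemma ext_shift_pow (j : 'I_n.+1) (e : R) (k : 'I_n.+1) : j = 1%N :> nat ->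
  ext j (fun t => (e + t) ^+ k) = k%:R * e ^+ k.-1.
Proof.
move=> j1; rewrite (@ext_poly _ _ _ (fun l => 'C(k, l)%:R * e ^+ (k - l))).
  by rewrite j1 bin1 subn1.
move=> t _; rewrite exprDn (big_ord_widen n.+1 (fun l => e ^+ (k - l) * t ^+ l *+ 'C(k, l))) //.
rewrite [RHS](bigID (fun l : 'I_n.+1 => (l < k.+1)%N)) /= [X in _ = _ + X]big1 ?addr0.
  by apply: eq_bigr => l _; rewrite -mulr_natl mulrA.
by move=> l; rewrite -leqNgt => h; rewrite bin_small // !mul0r.
Qed.

(** By Jacobi's formula the left side is the derivative of [det (B + e)] in [e]. Multiplied by [e],
    as in the next lemma, it has the coefficients of [det (B + e)], each weighted by its degree. *)
Lemma det_trace_inv B (e : R) : (0 < n)%N -> B^T = B -> B + e%:M \in unitmx ->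
  \det (B + e%:M) * \tr (invmx (B + e%:M)) =
  \sum_(k < n.+1) esym_eig B (n - k) * (k%:R * e ^+ k.-1).
Proof.
move=> n0 BT u; have j1 : (1 < n.+1)%N by rewrite ltnS.
pose j := Ordinal j1.
rewrite -[invmx _]mulmx1 -(@ext_det_1 _ _ _ _ j) //.
transitivity (ext j (fun t => \sum_(k < n.+1) esym_eig B (n - k) * (e + t) ^+ k)).
  by apply: eq_ext => t _; rewrite -det_esym // scalemx1 -addrA -raddfD.
rewrite /ext; under eq_bigr do rewrite mulr_sumr.
rewrite exchange_big; apply: eq_bigr => k _ /=.
rewrite -(@ext_shift_pow j e k) // /ext mulr_sumr.
by apply: eq_bigr => i _; rewrite mulrCA.
Qed.

Lemma ext_det_trace_inv B (j : 'I_n.+1) : (0 < n)%N -> B^T = B ->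
  (forall e, 0 < e -> B + e%:M \in unitmx) ->
  ext j (fun e => e * (\det (B + e%:M) * \tr (invmx (B + e%:M)))) = j%:R * esym_eig B (n - j).
Proof.
move=> n0 BT u; apply: (@ext_poly _ _ _ (fun k => k%:R * esym_eig B (n - k))) => e e0.
rewrite det_trace_inv //; last exact: u.
rewrite mulr_sumr; apply: eq_bigr => -[[|k] hk] _ /=; first by rewrite !mul0r mulr0 mulr0.
by rewrite exprS; ring.
Qed.

(** The two terms [p e_a^T y] and [- p y^T e_a] cancel, since they have opposite traces against a
    symmetric matrix. *)
Lemma trace_radial_field M (y : 'rV[R]_n) (a : 'I_n) (p w : R) (D : 'M[R]_n) : M^T = M ->
  (forall i c, D i c = w * (y 0 i * y 0 a * y 0 c) + p * ((i == a)%:R * y 0 c) +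
     p * y 0 a * (i == c)%:R - p * y 0 i * (c == a)%:R) ->
  \tr (invmx M *m D) = y 0 a * (p * \tr (invmx M) + w * (y *m invmx M *m y^T) 0 0).
Proof.
move=> MT hD.
pose ea : 'rV[R]_n := delta_mx 0 a.
have -> : D = (w * y 0 a) *: (y^T *m y) + p *: (ea^T *m y) + (p * y 0 a)%:M - p *: (y^T *m ea).
  apply/matrixP => i c; rewrite hD !mxE !big_ord1 !mxE /= -[p * y 0 a *+ _]mulr_natr.
  by rewrite -/(0 : 'I_1); ring.
have iT : (invmx M)^T = invmx M by rewrite trmx_inv MT.
have tr1 (u v : 'rV[R]_n) : \tr (invmx M *m (u^T *m v)) = (v *m invmx M *m u^T) 0 0.
  by rewrite mulmxA mxtrace_mulC mulmxA trace_mx11 -?mulmxA.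
have sym (u v : 'rV[R]_n) : (v *m invmx M *m u^T) 0 0 = (u *m invmx M *m v^T) 0 0.
  have -> : (v *m invmx M *m u^T) 0 0 = (v *m invmx M *m u^T)^T 0 0 by rewrite [RHS]mxE.
  by rewrite !trmx_mul trmxK iT mulmxA.
rewrite mulmxBr !mulmxDr -!scalemxAr mul_mx_scalar raddfB !raddfD /= !mxtraceZ !tr1.
by rewrite (sym ea y); ring.
Qed.

End trace_expansion.

(** * The weighted estimate on smooth functions *)

Section radial_profile.
Context {R : realType}.

Lemma derive1M_fun (F G : R -> R) (s a b : R) : is_derive s (1 : R) F a ->
  is_derive s (1 : R) G b -> is_derive s (1 : R) (fun t => F t * G t) (F s * b + G s * a).
Proof. by move=> hF hG; exact: (is_deriveM hF hG). Qed.

Lemma derive_pow_inv m (s : R) : 0 < s ->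
  is_derive s (1 : R) (fun t => t^-1 ^+ m) (- (m%:R * s^-1 ^+ m / s)).
Proof.
move=> s0; have sn : s != 0 by rewrite gt_eqF.
elim: m => [|m IH].
  rewrite !mul0r oppr0 (_ : (fun t => _) = cst 1); first exact: is_derive_cst.
  by apply/funext => t; rewrite expr0.
have hV : is_derive s (1 : R) (fun t => t^-1) (- s ^- 2).
  by apply: is_derive_eq; [exact: is_deriveV|rewrite /GRing.scale /= mulr1].
have H := derive1M_fun hV IH.
suff E : (fun t : R => t^-1 ^+ m.+1) = (fun t : R => t^-1 * t^-1 ^+ m).
  rewrite E; apply: (is_derive_eq H).
  by rewrite [s^-1 ^+ m.+1]exprS -natr1; move: (s^-1 ^+ m) => q; field.
by apply/funext => t; rewrite exprS.
Qed.

Lemma max_ge_r (k t : R) : k <= Num.max t k.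
Proof. by rewrite le_max lexx orbT. Qed.

(** [A - eta / t] is nondecreasing for [t >= k] and nonpositive at [s + r1], where [A] vanishes. *)
Lemma decay_bound (A g : R -> R) (k r1 eta : R) : 0 < k -> 0 < r1 -> 0 <= eta ->
  (forall s : R, 0 < s -> is_derive s (1 : R) A (g s)) ->
  (forall s : R, k <= s -> - g s <= eta / s ^+ 2) -> (forall s : R, r1 <= s -> A s = 0) ->
  forall s, k <= s -> s * A s <= eta.
Proof.
move=> k0 r0 eta0 dA gb A0 s ks; have s0 := lt_le_trans k0 ks.
pose F t := A t - eta * t^-1.
have dF (t : R) : 0 < t -> is_derive t (1 : R) F (g t + eta / t ^+ 2).
  move=> t0; have tn : t != 0 by rewrite gt_eqF.
  have hV : is_derive t (1 : R) (fun t => t^-1) (- t ^- 2).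
    by apply: is_derive_eq; [exact: is_deriveV|rewrite /GRing.scale /= mulr1].
  have hM := derive1M_fun (is_derive_cst eta t (1 : R)) hV.
  apply: (is_derive_eq (is_deriveB (dA t t0) hM)).
  by rewrite /= mulr0 addr0; ring.
have sT : s < s + r1 by rewrite ltrDl.
have d1 (x : R) : x \in `]s, (s + r1)[%R -> is_derive x (1 : R) F (g x + eta / x ^+ 2).
  by rewrite in_itv /= => /andP[h _]; apply: dF; exact: lt_trans h.
have c1 : {within `[s, (s + r1)], continuous F}.
  apply: derivable_within_continuous => x; rewrite in_itv /= => /andP[h _].
  by case: (dF x (lt_le_trans s0 h)).
have [x] := MVT sT d1 c1.
rewrite in_itv /= => /andP[sx _] E.
have D0 : 0 <= F (s + r1) - F s.
  have sr : s + r1 - s = r1 by rewrite addrC addKr.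
  rewrite E sr mulr_ge0 //; last exact: ltW.
  by have := gb x (ltW (le_lt_trans ks sx)); lra.
have FT : F (s + r1) <= 0.
  by rewrite /F A0 ?lerDr ?(ltW s0) // sub0r oppr_le0 mulr_ge0 // invr_ge0 addr_ge0 // ltW.
have : A s <= eta * s^-1 by move: D0 FT; rewrite /F; lra.
by rewrite -ler_pdivlMl // mulrC.
Qed.

(* P and Q are chosen so that P(|y|) y_a y + Q(|y|) e_a has derivative with trace part    *)
(* balanced against its radial part; the equations are s P' + m P = - zh and Q' = - s P.  *)
Lemma radial_profile m (zh : R -> R) (k r1 eta : R) : 0 < k -> 0 < r1 -> continuous zh ->
  (forall t, r1 <= t -> zh t = 0) -> (forall t, k <= t -> t ^+ m.+1 * `|zh t| <= eta) ->
  exists P Q : R -> R,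
  [/\ forall s, k <= s -> is_derive s (1 : R) P (- (m%:R * P s + zh s) / s),
      forall s, k <= s -> is_derive s (1 : R) Q (- (s * P s)),
      forall s, k <= s -> r1 <= s -> P s = 0,
      forall s, k <= s -> r1 <= s -> Q s = 0
    & forall s, k <= s -> s ^+ m.+1 * `|P s| <= eta].
Proof.
move=> k0 r0 cz z0 zb.
have eta0 : 0 <= eta.
  by apply: le_trans (zb _ (lexx k)); rewrite mulr_ge0 // exprn_ge0 // ltW.
have cmax : continuous (fun t : R => Num.max t k).
  by apply: cts_max; [exact: cts_id|exact: ctsC].
have mx t : 0 < Num.max t k by exact: lt_le_trans (max_ge_r _ _).
have maxE t : k <= t -> Num.max t k = t by move=> h; exact/max_idPl.
have cpow : continuous (fun t : R => t ^+ m) by move=> t; exact: exprn_continuous.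
have cg : continuous (fun t : R => t ^+ m * zh t / Num.max t k).
  by apply: ctsM; [exact: ctsM|apply: ctsV => // t; rewrite gt_eqF].
have gz t : r1 <= t -> t ^+ m * zh t / Num.max t k = 0 by move=> h; rewrite z0 // mulr0 mul0r.
have [A [dA A0]] := primitive_exists r0 cg gz.
(* For [s >= k] this is [s^(-m)] times the integral of [t^(m-1) zh t] from [s] to [r1], the solution
   of the first equation that vanishes past [r1]. The maxima with [k] only serve continuity on the
   whole line. *)
pose P s := A s * s^-1 ^+ m.
have dP s : k <= s -> is_derive s (1 : R) P (- (m%:R * P s + zh s) / s).
  move=> ks; have s0 := lt_le_trans k0 ks; have sn : s != 0 by rewrite gt_eqF.
  apply: (is_derive_eq (derive1M_fun (dA s s0) (derive_pow_inv m s0))).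
  rewrite maxE // /P exprVn.
  have pn : s ^+ m != 0 by rewrite expf_neq0.
  by move: (s ^+ m) pn => q pn; field; apply/andP; split.
have cP : continuous (fun t => P (Num.max t k)).
  move=> t; apply: (@continuous_comp _ _ _ (fun t : R => Num.max t k) P); first exact: cmax.
  by apply/differentiable_continuous/derivable1_diffP; case: (dP _ (max_ge_r k t)).
have cq : continuous (fun t : R => t * P (Num.max t k)) by apply: ctsM => //; exact: cts_id.
have qz t : r1 <= t -> t * P (Num.max t k) = 0.
  by move=> h; rewrite /P A0 ?mul0r ?mulr0 // le_max h.
have [Q [dQ Q0]] := primitive_exists r0 cq qz.
exists P, Q; split => //.
- by move=> s ks; have := dQ s (lt_le_trans k0 ks); rewrite maxE.
- by move=> s ks h; rewrite /P A0 // mul0r.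
- by move=> s ks h; exact: Q0.
move=> s ks; have s0 := lt_le_trans k0 ks.
have -> : s ^+ m.+1 * `|P s| = `|s * A s|.
  rewrite /P !normrM (gtr0_norm s0) normrX normrV ?unitfE ?gt_eqF // (gtr0_norm s0).
  have pn : s ^+ m != 0 by rewrite expf_neq0 // gt_eqF.
  by rewrite [s ^+ m.+1]exprS exprVn; move: (s ^+ m) pn => q pn; field.
have gb t : k <= t -> `|t ^+ m * zh t / Num.max t k| <= eta / t ^+ 2.
  move=> kt; have t0 := lt_le_trans k0 kt; rewrite maxE // ler_pdivlMr ?exprn_gt0 //.
  apply: le_trans (zb t kt).
  rewrite !normrM normrV ?unitfE ?gt_eqF // (gtr0_norm t0) normrX (gtr0_norm t0) [t ^+ m.+1]exprS.
  by rewrite le_eqVlt; apply/orP; left; apply/eqP; field; rewrite gt_eqF.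
rewrite ler_norml lerNl -mulrN; apply/andP; split.
  apply: (@decay_bound (fun s => - A s) (fun t => t ^+ m * zh t / Num.max t k) k r1) => //.
  - by move=> t t0; rewrite -[X in is_derive _ _ _ X]opprK; exact: (is_deriveN (dA t t0)).
  - by move=> t kt; have := gb t kt; rewrite ler_norml => /andP[]; lra.
  - by move=> t h; rewrite A0 // oppr0.
apply: (@decay_bound A (fun t => - (t ^+ m * zh t / Num.max t k)) k r1) => //.
by move=> t kt; have := gb t kt; rewrite ler_norml => /andP[]; lra.
Qed.

End radial_profile.

(** * The divergence identity and the volume bound *)

Section key_estimate.
Context {R : realType} {n : nat}.

Lemma cts_esym (A : 'rV[R]_n -> 'M[R]_n) (j : 'I_n.+1) : (forall x, (A x)^T = A x) ->
  (forall i l, continuous (fun x => A x i l)) -> continuous (fun x => esym_eig (A x) (n - j)).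
Proof.
move=> sA cA.
rewrite (_ : (fun _ => _) = fun x => ext j (fun e => \det (A x + e%:M))).
  apply: cts_sum => i _; apply: ctsM; first exact: ctsC.
  by apply: cts_det => a b; under eq_fun do rewrite mxE; apply: ctsD => //; exact: ctsC.
by apply/funext => x; rewrite esym_ext.
Qed.

Lemma mono_shift (h : 'rV[R]_n -> 'rV[R]_n) (B : 'rV[R]_n -> 'M[R]_n) (e : R) :
  (forall y, vfre h y (B y)) -> (forall i c, continuous (fun y => B y i c)) ->
  (forall x y, 0 <= dot (h x - h y) (x - y)) -> 0 < e ->
  C1mono e (fun y => h y + e *: y) (fun y => B y + e%:M).
Proof.
move=> hB cB mh e0; split => //.
- move=> x; rewrite -[e%:M]scalemx1; apply: vfreD; first exact: hB.
  by apply: vfreZ; exact: vfre_id.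
- move=> i k; under eq_fun do rewrite mxE; apply: ctsD; first exact: cB.
  exact: ctsC.
- move=> x y; have H := mh x y.
  have -> : h x + e *: x - (h y + e *: y) = (h x - h y) + e *: (x - y).
    by apply/rowP => i; rewrite !mxE; ring.
  move: H; move: (h x - h y) (x - y) => g d H.
  by rewrite dotDl dotZl ler_wpDl // ler_pM2l // sqr_norm_le_dot.
Qed.

Context (h : 'rV[R]_n -> 'rV[R]_n) (B : 'rV[R]_n -> 'M[R]_n).
Hypotheses (hB : forall y, vfre h y (B y)) (cB : forall i c, continuous (fun y => B y i c)).
Hypotheses (pB : forall y, psd (B y)) (mh : forall x y, 0 <= dot (h x - h y) (x - y)).
Hypothesis n0 : (0 < n)%N.
Context (k r1 eta : R) (zh : R -> R) (j : 'I_n.+1) (a : 'I_n).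
Hypotheses (k0 : 0 < k) (r0 : 0 < r1) (cz : continuous zh).
Hypotheses (z0 : forall t, r1 <= t -> zh t = 0)
  (zb : forall t, k <= t -> t ^+ (n - j).+1 * `|zh t| <= eta).

Let m : 'I_n.+1 := rev_ord j.
Let mE : m = (n - j)%N :> nat. Proof. by rewrite /= subSS. Qed.
Local Notation rad := (@radius R n k).
Local Notation N := (@rhess R n k).

Let unitB (e : R) y : 0 < e -> B y + e%:M \in unitmx.
Proof. by move=> e0; exact: (C1mono_unit (mono_shift hB cB mh e0) y). Qed.

Let symB y : (B y)^T = B y. Proof. by case: (pB y). Qed.

(** Up to a constant factor, the mixed discriminant of [j] copies of [B y] and [n - j] copies of
    [N y]. *)
Let b y := ext m (fun e => \det (B y + e *: N y)).

(** [cov_perturb] for [h + e id] and the field [P y_a y + Q e_a], multiplied by [e]. Since [B + e N]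
    differs from [B + e] by a rank-one matrix, the radial part of the trace becomes a multiple of
    [det (B + e) - det (B + e N)]. *)
Lemma radial_divergence : exists P : R -> R,
  [/\ forall s, k <= s -> {for s, continuous P},
      forall s, k <= s -> r1 <= s -> P s = 0,
      forall s, k <= s -> s ^+ (n - j).+1 * `|P s| <= eta
    & forall e, 0 < e -> rint (fun y => y 0 a *
        (P (rad y) * (e * (\det (B y + e%:M) * \tr (invmx (B y + e%:M))))
         - ((n - j)%:R * P (rad y) + zh (rad y)) *
            (\det (B y + e%:M) - \det (B y + e *: N y)))) = 0].
Proof.
have [P [Q [dP dQ P0 Q0 bP]]] := radial_profile k0 r0 cz z0 zb.
have cP s : k <= s -> {for s, continuous P}.
  by move=> ks; apply/differentiable_continuous/derivable1_diffP; case: (dP s ks).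
exists P; split => // e e0.
pose dp s := - ((n - j)%:R * P s + zh s) / s.
pose X y : 'rV[R]_n := \row_c (P (rad y) * (y 0 a * y 0 c) + Q (rad y) * (c == a)%:R).
pose JX y : 'M[R]_n := \matrix_(i, c) (dp (rad y) / rad y * (y 0 i * y 0 a * y 0 c) +
  P (rad y) * ((i == a)%:R * y 0 c) + P (rad y) * y 0 a * (i == c)%:R
  - P (rad y) * y 0 i * (c == a)%:R).
have rn y : rad y != 0 by rewrite gt_eqF // radius_gt0.
have cPr : continuous (fun y => P (rad y)) by apply: (@cts_radial R n k k0 P) => s; exact: cP.
have cdp : continuous (fun y => dp (rad y)).
  apply: ctsM; last by apply: ctsV => //; exact: radius_cts.
  apply: ctsN; apply: ctsD; first by apply: ctsM => //; exact: ctsC.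
  exact: (cts_comp cz (@radius_cts _ _ k)).
have cJX i c : continuous (fun y => JX y i c).
  under eq_fun do rewrite mxE.
  have cy l : continuous (fun y : 'rV[R]_n => y 0 l) by exact: cts_coord.
  apply: ctsB; last by apply: ctsM; [exact: ctsM|exact: ctsC].
  apply: ctsD; last by apply: ctsM; [exact: ctsM|exact: ctsC].
  apply: ctsD; last by apply: ctsM => //; apply: ctsM => //; exact: ctsC.
  apply: ctsM; last by apply: ctsM => //; exact: ctsM.
  by apply: ctsM => //; apply: ctsV => //; exact: radius_cts.
have dX y : vfre X y (JX y).
  apply: vfre_partials => // i c x.
  rewrite (_ : (fun y => X y 0 c) =
    fun y => P (rad y) * (y 0 a * y 0 c) + Q (rad y) * (c == a)%:R); last first.
    by apply/funext => z; rewrite mxE.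
  have kx : k <= rad x by exact: radius_ge.
  have d1 := deriveM_fun (derive_radial k0 i (dP _ kx))
    (deriveM_fun (derive_coord x (delta_mx 0 i) a) (derive_coord x (delta_mx 0 i) c)).
  have d2 := deriveM_fun (derive_radial k0 i (dQ _ kx))
    (derive_cst_fun x (delta_mx 0 i) (c == a)%:R).
  apply: (is_derive_eq (deriveD_fun d1 d2)).
  rewrite !mxE eqxx /= -/(dp (rad x)) [a == i]eq_sym [c == i]eq_sym.
  have := rn x; move: (rad x) => s sn; by field.
have X0 y : r1 < enorm y -> X y = 0.
  move=> hy; have h1 : r1 <= rad y by rewrite (le_trans (ltW hy)) // enorm_le_radius.
  by apply/rowP => c; rewrite !mxE P0 ?Q0 ?radius_ge // !mul0r addr0.
have JX0 y : r1 < enorm y -> JX y = 0.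
  move=> hy; have h1 : r1 <= rad y by rewrite (le_trans (ltW hy)) // enorm_le_radius.
  by apply/matrixP => i c; rewrite !mxE /dp P0 ?radius_ge // z0 //; ring.
have GJ := mono_shift hB cB mh e0.
have H := cov_perturb n0 GJ (ltW r0) dX cJX X0 JX0.
have cW : continuous (fun y => \det (B y + e%:M) * \tr (invmx (B y + e%:M) *m JX y)).
  have cM i c : continuous (fun y => (B y + e%:M) i c) by exact: (c1_cts GJ i c).
  apply: ctsM; first exact: cts_det.
  rewrite /mxtrace; apply: cts_sum => i _; apply: cts_mulmx => // i' c.
  by apply: cts_invmx => // y; exact: unitB.
have [C hC] : exists C, ccs C r1 (fun y => \det (B y + e%:M) * \tr (invmx (B y + e%:M) *m JX y)).
  apply: ccs_ex => //; first exact: ltW.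
  move=> y hy; rewrite JX0 ?mulmx0 ?mxtrace0 ?mulr0 //.
  exact: lt_le_trans hy (norm_le_enorm _).
have := rintZ e hC; rewrite H mulr0 => <-; apply: eq_rint => y.
rewrite (@trace_radial_field _ _ _ y a (P (rad y)) (dp (rad y) / rad y)); last first.
- by move=> i c; rewrite mxE.
- by rewrite raddfD /= tr_scalar_mx symB.
have -> : B y + e *: N y = (B y + e%:M) - (e / rad y ^+ 2) *: (y^T *m y).
  by rewrite /rhess scalerBr scalerA addrA scalemx1.
rewrite det_rank1; last exact: unitB.
rewrite /dp; have := rn y; move: (rad y) => s sn.
by move: (\det _) (\tr _) (_ 0 0) (y 0 a) => x1 x2 x3 x4; field.
Qed.

Let c0 := (n - j).+1%:R * eta.

Let eta0 : 0 <= eta.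
Proof. by apply: le_trans (zb (lexx k)); rewrite mulr_ge0 // exprn_ge0 // ltW. Qed.

Let cdet (c : R) : continuous (fun y => \det (B y + c *: N y)).
Proof.
apply: cts_det => i l; under eq_fun do rewrite mxE [X in _ + X]mxE.
apply: ctsD => //; apply: ctsM; first exact: ctsC.
exact: rhess_cts.
Qed.

Let cb : continuous b.
Proof. by apply: cts_sum => i _; apply: ctsM; [exact: ctsC|exact: cdet]. Qed.

Let cesym : continuous (fun y => esym_eig (B y) j).
Proof.
have nm : (n - m)%N = j by rewrite mE subKn // -ltnS.
by rewrite -nm; exact: cts_esym.
Qed.

Let rhess_psd y : psd (B y + (rad y)^-1 *: N y).
Proof.
have [C [CT _ CC]] := rhess_sqrt k0 y; have [BT pBy] := pB y.
split=> [|v]; first by rewrite raddfD /= linearZ /= -CC trmx_mul CT BT.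
rewrite mulmxDr dotDl addr_ge0 // -scalemxAr dotZl mulr_ge0 //.
  by rewrite invr_ge0 ltW // radius_gt0.
have -> : dot (v *m N y) v = dot (v *m C) (v *m C) by rewrite -CC !dotE_mx trmx_mul CT !mulmxA.
exact: dot_ge0.
Qed.

(** The sum of [h], the gradient of [radius] and the identity, the last one making the map strongly
    monotone so that its Jacobian integrates to a volume. *)
Let G3 y := h y + (rad y)^-1 *: y + 1 *: y.
Let J3 y := B y + (rad y)^-1 *: N y + 1%:M.

Let GJ3 : C1mono 1 G3 J3.
Proof.
apply: (@mono_shift (fun y => h y + (rad y)^-1 *: y) (fun y => B y + (rad y)^-1 *: N y)) => //.
- by move=> y; apply: vfreD => //; exact: unit_radial_vfre.
- move=> i c; under eq_fun do rewrite mxE [X in _ + X]mxE.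
  apply: ctsD => //; apply: ctsM; last exact: rhess_cts.
  by apply: ctsV => [y|]; [rewrite gt_eqF // radius_gt0|exact: radius_cts].
- move=> x y; have -> : h x + (rad x)^-1 *: x - (h y + (rad y)^-1 *: y) =
    (h x - h y) + ((rad x)^-1 *: x - (rad y)^-1 *: y).
    by apply/rowP => i; rewrite !mxE; ring.
  by rewrite dotDl addr_ge0 // unit_radial_mono.
Qed.

(** Since [N] is a square, [ext_det_bound] applies at [s = 1 / rad y]; adding the identity to a
    positive semidefinite matrix then only increases the determinant. *)
Let b_bound y : 0 <= b y <= rad y ^+ (n - j) * \det (J3 y).
Proof.
have [C [CT uC CC]] := rhess_sqrt k0 y.
have c0' := radius_gt0 k0 y; have ci : 0 < (rad y)^-1 by rewrite invr_gt0.
have [b0 b1] := ext_det_bound m (pB y) CT uC ci.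
rewrite CC mE -/(b y) in b0 b1; rewrite b0 /=.
have d0 : \det (B y + (rad y)^-1 *: N y) <= \det (J3 y).
  by apply: det_le_scalar => //; [case: (rhess_psd y)|move=> i; exact: psd_eigenvals].
rewrite mulrC -ler_pdivrMr ?exprn_gt0 //.
by rewrite exprVn in b1; exact: le_trans b1 d0.
Qed.

(** In the coefficient of [e^(n-j)] of [radial_divergence] the terms [(n-j) P [B]_j] cancel, so [zh
    y_a [B]_j] and [y_a ((n-j) P + zh) b] have the same integral. In the second, the factor
    [rad^(n-j)] of [b_bound] meets the weighted bounds on [P] and [zh], leaving [c0] times the
    Jacobian of [G3]. *)
Lemma key_bound (L : R) : 0 <= L -> (forall y, enorm y <= r1 -> enorm (h y) <= L) ->
  `|rint (fun y => zh (rad y) * y 0 a * esym_eig (B y) j)| <= c0 * (2 * (L + r1 + 2)) ^+ n.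
Proof.
move=> L0 hL; have [P [cP P0 bP H]] := radial_divergence.
pose E (y : 'rV[R]_n) := (n - j)%:R * P (rad y) + zh (rad y).
pose F0 (y : 'rV[R]_n) := zh (rad y) * y 0 a * esym_eig (B y) j.
pose F1 (y : 'rV[R]_n) := y 0 a * E y * b y.
pose W (e : R) (y : 'rV[R]_n) := y 0 a * (P (rad y) * (e * (\det (B y + e%:M) * \tr (invmx (B y + e%:M)))) -
   E y * (\det (B y + e%:M) - \det (B y + e *: N y))).
have nm : (n - m)%N = j by rewrite mE subKn // -ltnS.
have cPr : continuous (fun y => P (rad y)) by apply: (@cts_radial R n k k0 P) => s; exact: cP.
have czr : continuous (fun y => zh (rad y)) by exact: (cts_comp cz (@radius_cts _ _ k)).
have cE : continuous E by apply: ctsD => //; apply: ctsM => //; exact: ctsC.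
have ca : continuous (fun y : 'rV[R]_n => y 0 a) by exact: cts_coord.
have out y : r1 < enorm y -> P (rad y) = 0 /\ zh (rad y) = 0.
  move=> hy; have h1 : r1 <= rad y by rewrite (le_trans (ltW hy)) // enorm_le_radius.
  by rewrite P0 ?radius_ge // z0.
have out' y : r1 < `|y| -> P (rad y) = 0 /\ zh (rad y) = 0.
  by move=> hy; apply: out; exact: lt_le_trans hy (norm_le_enorm _).
have cW (i : 'I_n.+1) : exists C, ccs C r1 (W i.+1%:R).
  have e0 : (0 : R) < i.+1%:R by rewrite ltr0n.
  have GJ := mono_shift hB cB mh e0.
  have cM p q : continuous (fun y => (B y + i.+1%:R%:M) p q) by exact: (c1_cts GJ p q).
  apply: ccs_ex; [|exact: ltW|]; last first.
    move=> y hy; have [p1 p2] := out' y hy; by rewrite /W /E p1 p2; ring.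
  apply: ctsM => //; apply: ctsB; last by apply: ctsM => //; apply: ctsB => //; exact: cts_det.
  apply: ctsM => //; apply: ctsM; first exact: ctsC.
  apply: ctsM; first exact: cts_det.
  rewrite /mxtrace; apply: cts_sum => p _.
  by apply: cts_invmx => // y; exact: unitB.
have WE y : \sum_i excoef m i * W i.+1%:R y = F1 y - F0 y.
  rewrite -/(ext m (fun e : R => W e y)).
  transitivity (ext m (fun e : R => y 0 a * P (rad y) *
      (e * (\det (B y + e%:M) * \tr (invmx (B y + e%:M)))) - y 0 a * E y *
      (\det (B y + e%:M) - \det (B y + e *: N y)))).
    by apply: eq_ext => e _; rewrite /W; ring.
  rewrite extB !extZ extB ext_det_trace_inv //; last by move=> e; exact: unitB.
  by rewrite esym_ext // nm mE -/(b y) /F1 /F0 /E; ring.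
have [C0 hF0] : exists C, ccs C r1 F0.
  apply: ccs_ex; [|exact: ltW|].
    by apply: ctsM => //; exact: ctsM.
  by move=> y hy; have [p1 p2] := out' y hy; rewrite /F0 p2; ring.
have [C1 hF1] : exists C, ccs C r1 F1.
  apply: ccs_ex; [|exact: ltW|].
    by apply: ctsM => //; exact: ctsM.
  by move=> y hy; have [p1 p2] := out' y hy; rewrite /F1 /E p1 p2; ring.
have FF : rint F0 = rint F1.
  apply/eqP; rewrite eq_sym -subr_eq0 -(rintB hF1 hF0) -(eq_rint WE).
  rewrite (rint_lin _ (ltW r0) cW) big1 // => i _.
  by rewrite [rint _]H ?mulr0 // ltr0n.
(* [G3] sends the ball of radius [r1] into the ball of radius [K]: [L] comes from [h], [1] from the
   unit radial field and [r1] from the identity. *)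
rewrite -/F0 FF; pose K := L + 1 + r1.
have K0 : 0 <= K by rewrite !addr_ge0 // ltW.
have [r3 r30 [C3 h3]] := cutoff_C1mono_ccs GJ3 K0.
have c00 : 0 <= c0 by rewrite mulr_ge0.
have bd y : `|F1 y| <= c0 * (cutoff K (G3 y) * \det (J3 y)).
  have dJ : 0 <= \det (J3 y) by rewrite ltW // (mxpos_det ltr01 (C1mono_pos GJ3 y)).
  have [hy|hy] := ltP r1 (enorm y).
    have [p1 p2] := out y hy; rewrite /F1 /E p1 p2 mulr0 addr0 mulr0 mul0r normr0.
    by rewrite !mulr_ge0 // cutoff_ge0.
  have ra := radius_gt0 k0 y; have ka := radius_ge k0 y.
  rewrite cutoff1 ?mul1r; last first.
    apply: (le_trans (enormD _ _)); rewrite scale1r lerD //.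
    apply: (le_trans (enormD _ _)); rewrite lerD ?hL // enormZ gtr0_norm ?invr_gt0 //.
    by rewrite ler_pdivrMl // mulr1 enorm_le_radius.
  have /andP[b0 b1] := b_bound y.
  rewrite /F1 normrM (ger0_norm b0).
  apply: (@le_trans _ _ (`|y 0 a * E y| * (rad y ^+ (n - j) * \det (J3 y)))).
    by rewrite ler_wpM2l.
  rewrite mulrA ler_wpM2r //.
  apply: (@le_trans _ _ (rad y ^+ (n - j).+1 * `|E y|)).
    rewrite normrM exprSr mulrAC [X in X * _]mulrC ler_wpM2r //.
    rewrite ler_wpM2l ?exprn_ge0 ?(ltW ra) //.
    exact: le_trans (coord_le_enorm _ _) (enorm_le_radius k0 _).
  apply: (@le_trans _ _ (rad y ^+ (n - j).+1 * ((n - j)%:R * `|P (rad y)| + `|zh (rad y)|))).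
    rewrite ler_wpM2l ?exprn_ge0 ?(ltW ra) //; apply: (le_trans (ler_normD _ _)).
    by rewrite normrM ger0_norm.
  rewrite mulrDr mulrCA /c0 -natr1 mulrDl mul1r lerD ?zb //.
  by rewrite ler_wpM2l // bP.
have h3' := ccsZ c0 h3.
have E3 : rint (fun y => c0 * (cutoff K (G3 y) * \det (J3 y))) <= c0 * (2 * (L + r1 + 2)) ^+ n.
  rewrite (rintZ c0 h3) (rint_cutoff_cov K GJ3) ler_wpM2l //.
  apply: (le_trans (ler_norm _)); apply: (le_trans (rint_le_cube (@cutoff_ccs R n K K0))).
  by rewrite mul1r (_ : K + 1 = L + r1 + 2) // /K; ring.
rewrite ler_norml; apply/andP; split.
  rewrite lerNl -mulN1r -(rintZ (-1) hF1); apply: le_trans E3.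
  apply: (le_rint (ccsZ (-1) hF1) h3') => y; rewrite mulN1r.
  by apply: le_trans (bd y); rewrite -normrN ler_norm.
apply: le_trans E3; apply: (le_rint hF1 h3') => y; apply: le_trans (bd y); exact: ler_norm.
Qed.

End key_estimate.

Section smooth_estimate.
Context {R : realType} {n : nat}.

Lemma gradient_inv (f : 'rV[R]_n -> R) (mu : R) : C1mono mu (gradient f) (hessian f) ->
  exists h, cancel h (gradient f).
Proof. by move=> /change_of_variables[[h [_ hK]] _]; exists h. Qed.

(* [zt] is read off [zh] through zh t = zt (sqrt (t^2 - k^2)), so that zh (radius k y) is *)
(* exactly zt (enorm y); the weight condition on zh costs a factor 2 ^ (n - j + 1).       *)
Lemma smooth_bound (f : 'rV[R]_n -> R) (mu : R) (j : 'I_n.+1) (a : 'I_n) (zt : R -> R)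
    (r1 eta L : R) : (0 < n)%N -> conv_sc (EFin \o f) -> C2plus f ->
  C1mono mu (gradient f) (hessian f) -> continuous zt -> 0 < r1 -> 0 < eta -> 0 <= L ->
  (forall s : R, r1 <= s -> zt s = 0) -> (forall s : R, 0 < s -> s ^+ (n - j).+1 * `|zt s| <= eta) ->
  (forall x y, subgrad (EFin \o f) x y -> enorm y <= r1 + 1 -> enorm x <= L) ->
  `|proxext j (fun y : 'rV[R]_n => zt (enorm y) * y 0 a) (EFin \o f)| <=
    (n - j).+1%:R * (2 ^+ (n - j).+1 * eta) * (2 * (L + (r1 + 1) + 2)) ^+ n.
Proof.
move=> n0 cf f2 fm cz r0 eta0 L0 z0 zb hL.
have [h hK] := gradient_inv fm.
have [M M0 zM] : exists2 M : R, 0 < M & forall s : R, 0 <= s -> `|zt s| <= M.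
  have cN : {within `[0, r1], continuous (fun s => `|zt s|)}.
    by apply: continuous_subspaceT; exact: ctsNorm.
  have [c _ hc] := EVT_max (ltW r0) cN.
  exists (`|zt c| + 1) => [|s s0]; first by rewrite ltr_wpDl.
  have [h1|h1] := leP r1 s; first by rewrite z0 // normr0 addr_ge0.
  by rewrite (le_trans (hc s _)) ?lerDl // in_itv /= s0 ltW.
(* From [k <= 1] and [k M <= eta] follows [k^(n-j+1) M <= eta], which covers the arguments of [zt]
   below [k]. *)
pose k := Num.min 1 (eta / M).
have k0 : 0 < k by rewrite lt_min ltr01 divr_gt0.
have k1 : k <= 1 by rewrite ge_min lexx.
have kM : k * M <= eta by rewrite -ler_pdivlMr // ge_min lexx orbT.
pose zh t := zt (Num.sqrt (t ^+ 2 - k ^+ 2)).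
have czh : continuous zh.
  apply: (cts_comp cz); apply: (cts_comp (@cts_sqrt R)); apply: ctsB; last exact: ctsC.
  by move=> t; exact: exprn_continuous.
have zhE (y : 'rV[R]_n) : zh (radius k y) = zt (enorm y).
  by rewrite /zh sqr_radius // addrK.
have zh0 t : r1 + 1 <= t -> zh t = 0.
  move=> ht; apply: z0; rewrite -(ger0_norm (ltW r0)) -sqrtr_sqr ler_wsqrtr //.
  have : (r1 + 1) ^+ 2 <= t ^+ 2.
    by rewrite ler_pXn2r // nnegrE ?addr_ge0 // ?(ltW r0) // (le_trans _ ht) // addr_ge0 // ltW.
  have : k ^+ 2 <= 1 by rewrite expr_le1 // ltW.
  by rewrite sqrrD expr1n mulr1; lra.
have zhb t : k <= t -> t ^+ (n - j).+1 * `|zh t| <= 2 ^+ (n - j).+1 * eta.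
  move=> kt; have t0 := lt_le_trans k0 kt; rewrite /zh; set s := Num.sqrt _.
  have s0 : 0 <= s by exact: sqrtr_ge0.
  have st : t ^+ 2 = s ^+ 2 + k ^+ 2.
    by rewrite sqr_sqrtr ?subrK // subr_ge0 ler_pXn2r ?nnegrE ?(ltW k0) ?(ltW t0).
  have [sk|sk] := leP k s.
    have ts : t <= 2 * s.
      by rewrite -(@ler_pXn2r _ 2) ?nnegrE ?mulr_ge0 ?(ltW t0) // st; nra.
    apply: (@le_trans _ _ ((2 * s) ^+ (n - j).+1 * `|zt s|)).
      by rewrite ler_wpM2r // ler_pXn2r ?nnegrE ?mulr_ge0 ?(ltW t0).
    by rewrite exprMn -mulrA ler_wpM2l ?exprn_ge0 // zb // (lt_le_trans k0).
  have ts : t <= 2 * k.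
    by rewrite -(@ler_pXn2r _ 2) ?nnegrE ?mulr_ge0 ?(ltW t0) ?(ltW k0) // st; nra.
  apply: (@le_trans _ _ ((2 * k) ^+ (n - j).+1 * M)).
    rewrite ler_pM ?exprn_ge0 ?(ltW t0) ?zM //.
    by rewrite ler_pXn2r ?nnegrE ?mulr_ge0 ?(ltW t0) ?(ltW k0).
  rewrite exprMn -mulrA ler_wpM2l ?exprn_ge0 //; apply: le_trans kM.
  rewrite ler_wpM2r ?(ltW M0) // exprS ler_piMr ?exprn_ile1 ?(ltW k0) //.
have [C tp] : exists C, tfun r1 C (fun y : 'rV[R]_n => zt (enorm y) * y 0 a).
  apply: tfunP; first exact: ltW.
    apply: ctsM; last exact: cts_coord.
    exact: (cts_comp cz (@cts_enorm _ _)).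
  by move=> y hy; rewrite z0 ?mul0r // ltW.
rewrite (proxext_hinv cf f2 fm hK j tp).
rewrite (eq_rint (G := fun y => zh (radius k y) * y 0 a * esym_eig (@dinv R n f h y) j)); last first.
  by move=> y; rewrite zhE.
have r10 : 0 < r1 + 1 by rewrite addr_gt0.
apply: (key_bound (hinv_vfre fm hK) (dinv_cts f2 fm hK) (dinv_psd f2 fm) (hinv_mono fm hK) n0
  a k0 r10 czh zh0 zhb L0) => y hy.
exact: (hL _ _ (hinv_subgrad cf f2 hK y) hy).
Qed.

End smooth_estimate.

(** * Density of smooth strongly convex functions *)

Section smooth_convex.
Context {R : realType} {n : nat}.

Lemma dot_delta (x : 'rV[R]_n) i : dot x (delta_mx 0 i) = x 0 i.
Proof.
rewrite /dot (bigD1 i) //= mxE !eqxx mulr1 big1 ?addr0 // => k ki.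
by rewrite mxE (negbTE ki) andbF mulr0.
Qed.

Lemma derive_eq (F : 'rV[R]_n -> R) x v d : is_derive x v F d -> 'D_v F x = d.
Proof. by case. Qed.

Lemma derive_line (F : 'rV[R]_n -> R) x v (t d : R) : is_derive (x + t *: v) v F d ->
  is_derive t (1 : R) (fun s => F (x + s *: v)) d.
Proof.
have E : (fun h : R => h^-1 *: (((fun s => F (x + s *: v)) \o shift t) (h *: (1 : R)) -
     F (x + t *: v))) = (fun h => h^-1 *: ((F \o shift (x + t *: v)) (h *: v) - F (x + t *: v))).
  apply/funext => h /=; congr (_ *: (F _ - _)).
  have -> : h *: (1 : R) = h by exact: mulr1.
  by rewrite scalerDl addrCA.
move=> [h1 h2]; apply: DeriveDef; first by rewrite /derivable E.
by rewrite /derive E.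
Qed.

Context (f : 'rV[R]_n -> R) (G : 'rV[R]_n -> 'rV[R]_n) (J : 'rV[R]_n -> 'M[R]_n) (mu : R).
Hypotheses (dF : forall x v, is_derive x v f (dot (G x) v))
  (dG : forall x v c, is_derive x v (fun y => G y 0 c) ((v *m J x) 0 c))
  (cf : continuous f) (cJ : forall i c, continuous (fun x => J x i c))
  (symJ : forall x, (J x)^T = J x) (mu0 : 0 < mu)
  (posJ : forall x v, mu * dot v v <= dot (v *m J x) v).

Let partialE i : partial i f = fun x => G x 0 i.
Proof.
by apply/funext => x; rewrite /partial (derive_eq (dF x (delta_mx 0 i))) dot_delta.
Qed.

Lemma smooth_gradient : gradient f = G.
Proof. by apply/funext => x; apply/rowP => i; rewrite mxE partialE. Qed.

Let dGi x i c : is_derive x (delta_mx 0 i) (fun y => G y 0 c) (J x i c).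
Proof. by apply: (is_derive_eq (dG x (delta_mx 0 i) c)); rewrite -rowE mxE. Qed.

Lemma smooth_hessian : hessian f = J.
Proof.
apply/funext => x; apply/matrixP => i c; rewrite mxE partialE /partial.
by rewrite (derive_eq (dGi x c i)) -[in RHS]symJ mxE.
Qed.

Let fre_G x : vfre G x (J x).
Proof. by apply: vfre_partials => // i c y; exact: dGi. Qed.

Lemma smooth_C1mono : C1mono mu (gradient f) (hessian f).
Proof.
rewrite smooth_gradient smooth_hessian; split => // x y.
pose d := x - y; pose phi s := dot (G (y + s *: d)) d.
have dphi (s : R) : is_derive s (1 : R) phi (dot (d *m J (y + s *: d)) d).
  exact: vfre_line (fre_G _).
have cphi : continuous phi.
  by move=> t; apply/differentiable_continuous/derivable1_diffP; case: (dphi t).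
have [c _] := @MVT R phi (fun s => dot (d *m J (y + s *: d)) d) 0 1 ltr01
  (fun s _ => dphi s) (continuous_subspaceT cphi).
rewrite /phi scale1r scale0r addr0 subr0 mulr1 -dotBl [y + d]addrC subrK -/d => ->.
by apply: le_trans (posJ _ _); rewrite ler_pM2l // sqr_norm_le_dot.
Qed.

Lemma smooth_first_order x y : f x + dot (G x) (y - x) <= f y.
Proof.
pose d := y - x; pose phi s := f (x + s *: d).
have dphi (s : R) : is_derive s (1 : R) phi (dot (G (x + s *: d)) d).
  exact: derive_line (dF _ _).
have cphi : continuous phi.
  by move=> t; apply/differentiable_continuous/derivable1_diffP; case: (dphi t).
have [c] := @MVT R phi (fun s => dot (G (x + s *: d)) d) 0 1 ltr01
  (fun s _ => dphi s) (continuous_subspaceT cphi).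
rewrite in_itv /= => /andP[c0 _].
rewrite /phi scale1r scale0r addr0 subr0 mulr1 [x + d]addrC subrK -/d => E.
have := c1_mono smooth_C1mono (x + c *: d) x; rewrite smooth_gradient addrAC subrr add0r dotZr.
have h0 : 0 <= mu * `|c *: d| ^+ 2 by rewrite mulr_ge0 ?sqr_ge0 // ltW.
move=> /(le_trans h0); rewrite pmulr_rge0 // dotBl; lra.
Qed.

Lemma smooth_C2plus : C2plus f.
Proof.
have cG c : continuous (fun x => G x 0 c).
  move=> x; apply: (@continuous_comp _ _ _ G (fun y : 'rV[R]_n => y 0 c)).
    by apply: vfre_cvg (fre_G x).
  exact: cts_coord.
split; last first.
  move=> x; rewrite smooth_hessian; split => // v v0; rewrite -dotE_mx.
  by apply: lt_le_trans (posJ x v); rewrite mulr_gt0 // dot_gt0.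
split => // [i|i j]; rewrite partialE.
  by split => // x; case: (dF x (delta_mx 0 i)).
split; first by move=> x; case: (dG x (delta_mx 0 j) i).
rewrite (_ : partial j _ = fun x => J x j i) //.
by apply/funext => x; exact: (derive_eq (dGi x j i)).
Qed.

Lemma smooth_conv_sc (b0 b1 b2 : R) : 0 < b2 ->
  (forall x, b0 - b1 * enorm x + b2 * enorm x ^+ 2 <= f x) -> conv_sc (EFin \o f).
Proof.
move=> b20 lb; split => //.
- by exists 0.
- move=> x s; rewrite /= lte_fin => sf.
  have /(@cvgrPdist_lt _ _ _ (nbhs x) (nbhs_filter x) f) := @cf x.
  have e0 : 0 < f x - s by rewrite subr_gt0.
  move=> /(_ _ e0) h; exists [set y | `|f x - f y| < f x - s] => // y /= hy.
  by rewrite lte_fin; move: hy; rewrite ltr_norml => /andP[_]; lra.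
- move=> x y t /andP[t0 t1]; rewrite /= -!EFinM -EFinD lee_fin.
  set z := t *: x + _.
  have hx := smooth_first_order z x; have hy := smooth_first_order z y.
  have E : t * dot (G z) (x - z) + (1 - t) * dot (G z) (y - z) = 0.
    rewrite -!dotZr -dotDr (_ : _ + _ = 0) ?dot0r //.
    by apply/rowP => i; rewrite !mxE; ring.
  have t1' : 0 < 1 - t by rewrite subr_gt0.
  nra.
- move=> M; exists (Num.max 1 ((M + `|b0| + `|b1|) / b2)) => x.
  rewrite gt_max => /andP[x1 x2] /=.
  have x0 : 0 < enorm x by exact: lt_trans x1.
  rewrite -EFinM lee_fin ler_pdivlMr //; apply: le_trans (lb x).
  rewrite ltr_pdivrMr // in x2.
  have h1 := ler_norm b1; have h2 := ler_norm (- b0); rewrite normrN in h2.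
  have : (M + `|b0| + `|b1|) * enorm x <= enorm x * b2 * enorm x by rewrite ler_wpM2r // ltW.
  have : `|b0| <= `|b0| * enorm x by rewrite ler_peMr // ltW.
  have : b1 * enorm x <= `|b1| * enorm x by rewrite ler_wpM2r // ltW.
  rewrite expr2; lra.
Qed.

End smooth_convex.

(** * Countable families of affine minorants *)

Section affine_minorants.
Context {R : realType} {n : nat}.

Lemma rat_dense (x : 'rV[R]_n) (e : R) : 0 < e ->
  exists q : 'rV[rat]_n, `|map_mx ratr q - x| < e.
Proof.
move=> e0.
have /choice[q hq] : forall i : 'I_n, exists q : rat, `|ratr q - x 0 i| < e / 2.
  move=> i; have lt : x 0 i < x 0 i + e / 2 by rewrite ltrDl divr_gt0.
  have [q] := rat_in_itvoo lt; rewrite in_itv /= => /andP[q1 q2]; exists q.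
  by rewrite ger0_norm ?subr_ge0 ?(ltW q1) // ltrBlDl.
exists (\row_i q i); apply: (@le_lt_trans _ _ (e / 2)).
  apply: ler_mx_normP => [|i k]; first by rewrite ltW // divr_gt0.
  by rewrite (ord1 i) !mxE ltW.
by rewrite ltr_pdivrMr // ltr_pMr // ltr1n.
Qed.

Lemma moreau_arith (M s s0 D W N Y Z K aM aD : R) : s0 + (D - W) <= s -> W <= N -> Y + Z <= K ->
  N <= Y -> aM + aD + 1 <= Z -> M <= aM -> - (s0 + D) <= aD -> M < s + K.
Proof. by lra. Qed.

Section minorants.
Context (u : 'rV[R]_n -> \bar R).
Hypothesis cu : conv_sc u.

Let lam (l : nat) : R := l.+1%:R.
Let lam0 l : 0 < lam l. Proof. by rewrite ltr0n. Qed.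
(** The Moreau proximal point of [u] at [z], minimizing [u x + (l+1)/2 |x - z|^2]; the factor on [z]
    adapts to the parametrisation of [prox]. *)
Let p l (z : 'rV[R]_n) := prox (lam l) u (lam l *: z).
Let v l z := lam l *: (z - p l z).

Let pv l z : subgrad u (p l z) (v l z).
Proof. by rewrite /v scalerBr; exact: proxP. Qed.

Let cp l : continuous (p l).
Proof.
apply: (cts_comp (prox_cts (lam0 l) cu)).
by apply: ctsZv; exact: cts_id.
Qed.

Let supporting l z x := (fine (u (p l z)) + dot (v l z) (x - p l z)).

Let supporting_le l z x : ((supporting l z x)%:E <= u x)%E.
Proof. by have [s us h] := pv l z; rewrite /supporting us; exact: h. Qed.

(** At [x] the supporting function equals [u p + lam |x - p|^2]. If [p] is within [d] of [x], lower
    semicontinuity suffices. Otherwise the affine minorant at [p 0 x] lets [u p] fall only linearly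
    in [|x - p|], and the square wins for large [lam]. *)
Let moreau_cvg x (M : R) : (M%:E < u x)%E -> exists l, M < supporting l x x.
Proof.
move=> Mu; have [uN _ lu _ _] := cu.
have /nbhs_ballP[d /= d0 hd] := lsc_gt lu (@ctsC R 'rV[R]_n M) Mu.
have [s0 us0 h0] := pv 0 x; set p0 := p 0 x in us0 h0; set v0 := v 0 x in h0.
pose B := (`|v0| * n%:R) / d + (`|M| + `|s0 + dot v0 (x - p0)| + 1) / d ^+ 2.
have [l hl] : exists l, B <= lam l.
  have [l hl] : exists l : nat, B < l%:R.
    by exists (Num.bound `|B|); exact: le_lt_trans (ler_norm _) (archi_boundP (normr_ge0 B)).
  by exists l; rewrite (ltW (lt_le_trans hl _)) // ler_nat.
exists l; have [s us h] := pv l x; rewrite /supporting us /=.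
have -> : dot (v l x) (x - p l x) = lam l * dot (x - p l x) (x - p l x) by rewrite /v dotZl.
set w := x - p l x.
have [wd|wd] := ltP `|w| d.
  have := hd (p l x); rewrite mx_norm_ball /ball_ /= -/w => /(_ wd).
  rewrite us lte_fin => Ms; apply: (lt_le_trans Ms).
  by rewrite lerDl mulr_ge0 ?dot_ge0 // ltW.
have := h0 (p l x); rewrite us lee_fin.
have -> : p l x - p0 = (x - p0) - w by rewrite /w; apply/rowP => i; rewrite !mxE; ring.
rewrite dotBr => hs.
have hw := le_trans (ler_norm _) (dot_le_norm v0 w).
have sw := sqr_norm_le_dot w.
have lw : B * `|w| ^+ 2 <= lam l * dot w w.
  apply: ler_pM => //.
  by rewrite /B addr_ge0 // divr_ge0 ?mulr_ge0 ?addr_ge0 ?sqr_ge0 // ltW.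
have w1 : n%:R * (`|v0| * `|w|) <= `|v0| * n%:R / d * `|w| ^+ 2.
  rewrite mulrA [n%:R * _]mulrC.
  rewrite expr2 mulrA ler_wpM2r // mulrAC -mulrA ler_peMr ?mulr_ge0 //.
  by rewrite ler_pdivlMr // mul1r.
have w2 : `|M| + `|s0 + dot v0 (x - p0)| + 1 <=
    (`|M| + `|s0 + dot v0 (x - p0)| + 1) / d ^+ 2 * `|w| ^+ 2.
  rewrite mulrAC -mulrA ler_peMr ?addr_ge0 //.
  rewrite ler_pdivlMr ?exprn_gt0 // mul1r ler_pXn2r ?nnegrE ?(ltW d0) //.
have hD := ler_norm (- (s0 + dot v0 (x - p0))); rewrite normrN in hD.
rewrite /B mulrDl in lw.
exact: (moreau_arith hs hw lw w1 w2 (ler_norm M) hD).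
Qed.

(** Moving the centre [z] off [x] loses little, so countably many rational centres suffice. *)
Let supporting_near l x (M : R) : M < supporting l x x ->
  \forall z \near x, M < supporting l z x.
Proof.
move=> Ms; have [uN _ lu _ _] := cu.
have [s us _] := pv l x.
pose e := (supporting l x x - M) / 2.
have e0 : 0 < e by rewrite divr_gt0 // subr_gt0.
have h1 : \forall z \near x, ((s - e)%:E < u (p l z))%E.
  have H : ((s - e)%:E < u (p l x))%E by rewrite us lte_fin ltrBlDr ltrDl.
  exact: (@cp l x _ (lsc_gt lu (@ctsC R 'rV[R]_n (s - e)) H)).
have cd : continuous (fun z => dot (v l z) (x - p l z)).
  have cpi i : continuous (fun z => p l z 0 i).
    exact: (cts_comp (@cts_coord R 1 n 0 i) (@cp l)).
  apply: cts_dot => i.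
    under eq_fun do rewrite !mxE; apply: ctsM; first exact: ctsC.
    by apply: ctsB => //; exact: cts_coord.
  by under eq_fun do rewrite !mxE; apply: ctsB => //; exact: ctsC.
have /(@cvgrPdist_lt _ _ _ (nbhs x) (nbhs_filter x)) /(_ e e0) h2 := cd x.
apply: (@filterS2 _ (nbhs x) (nbhs_filter x) _ _ _ _ h1 h2) => z.
have [sz usz _] := pv l z; rewrite /supporting usz lte_fin /= ltr_norml => k1 /andP[_ k2].
have : supporting l x x = s + dot (v l x) (x - p l x) by rewrite /supporting us.
move: k1 k2; rewrite /e; lra.
Qed.

Lemma affine_minorants : exists (c : nat -> R) (w : nat -> 'rV[R]_n),
  (forall i x, ((c i + dot (w i) x)%:E <= u x)%E) /\
  (forall x (M : R), (M%:E < u x)%E -> exists i, M < c i + dot (w i) x).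
Proof.
pose idx i : 'rV[rat]_n * nat := odflt (0, 0%N) (unpickle i).
pose q i : 'rV[R]_n := map_mx ratr (idx i).1; pose l i := (idx i).2.
exists (fun i => fine (u (p (l i) (q i))) - dot (v (l i) (q i)) (p (l i) (q i))),
  (fun i => v (l i) (q i)).
have E i x : fine (u (p (l i) (q i))) - dot (v (l i) (q i)) (p (l i) (q i)) +
    dot (v (l i) (q i)) x = supporting (l i) (q i) x.
  by rewrite /supporting dotBr; ring.
split => [i x|x M Mu]; first by rewrite E.
have [k hk] := moreau_cvg Mu.
have /nbhs_ballP[d /= d0 hd] := supporting_near hk.
have [r hr] := rat_dense x d0.
exists (pickle (r, k)); rewrite E /q /l /idx pickleK /=; apply: hd.
by rewrite mx_norm_ball /ball_ /= distrC.
Qed.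

End minorants.
End affine_minorants.

(** * Log-sum-exp smoothing *)

Section log_sum_exp.
Context {R : realType} {n : nat} (c : nat -> R) (w : nat -> 'rV[R]_n) (k : nat).

(** With sharpness [(k+1)^2] the log-sum-exp of [k+1] terms exceeds their maximum by at most
    [ln (k+1) / lam <= 1/(k+1)]; [mu] is a strong convexity constant that tends to zero. *)
Let lam : R := k.+1%:R ^+ 2.
Let mu : R := k.+1%:R^-1.
Let lam0 : 0 < lam. Proof. by rewrite exprn_gt0. Qed.
Let mu0 : 0 < mu. Proof. by rewrite invr_gt0. Qed.

Definition affine i (x : 'rV[R]_n) := c i + dot (w i) x.
Let ex i x := expR (lam * affine i x).
Let S x := \sum_(i < k.+1) ex i x.
Let pr i x := ex i x / S x.
Let mean x := \sum_(i < k.+1) pr i x *: w i.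

Definition lse (x : 'rV[R]_n) := lam^-1 * ln (S x) + mu / 2 * dot x x.

Let G x := mean x + mu *: x.
(** The weights [pr] sum to one, and the matrix multiplied by [lam] is the covariance of the slopes
    [w i] under them, hence positive semidefinite. *)
Let J x := lam *: (\sum_(i < k.+1) pr i x *: ((w i)^T *m w i) - (mean x)^T *m mean x) + mu%:M.

Let S_gt i x : (i < k.+1)%N -> ex i x <= S x.
Proof.
move=> ik; rewrite /S (bigD1 (Ordinal ik)) //= lerDl; apply: sumr_ge0 => l _.
exact: expR_ge0.
Qed.

Let S0 x : 0 < S x.
Proof. exact: lt_le_trans (expR_gt0 _) (S_gt x (ltn0Sn k)). Qed.

Let sum_pr x : \sum_(i < k.+1) pr i x = 1.
Proof. by rewrite -mulr_suml mulfV // (gt_eqF (S0 x)). Qed.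

Let pr_ge0 i x : 0 <= pr i x.
Proof. by apply: divr_ge0; [exact: expR_ge0|exact: ltW]. Qed.

Let dot_mean x v : dot (mean x) v = \sum_(i < k.+1) pr i x * dot (w i) v.
Proof.
rewrite /mean; elim/big_rec2: _ => [|i y1 y2 _ IH]; first by rewrite dot0l.
by rewrite dotDl dotZl IH.
Qed.

Let mean_coord x l : mean x 0 l = \sum_(i < k.+1) pr i x * w i 0 l.
Proof. by rewrite summxE; apply: eq_bigr => i _; rewrite mxE. Qed.

Let d_affine i x v : is_derive x v (affine i) (dot (w i) v).
Proof.
have h l : is_derive x v (fun y : 'rV[R]_n => w i 0 l * y 0 l) (w i 0 l * v 0 l).
  apply: (is_derive_eq (deriveM_fun (derive_cst_fun x v (w i 0 l)) (derive_coord x v l))).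
  by rewrite mulr0 addr0.
apply: (is_derive_eq (deriveD_fun (derive_cst_fun x v (c i)) (derive_sum_fun (index_enum 'I_n) h))).
by rewrite add0r.
Qed.

Let d_ex i x v : is_derive x v (ex i) (ex i x * (lam * dot (w i) v)).
Proof.
have h : is_derive x v (fun y => lam * affine i y) (lam * dot (w i) v).
  apply: (is_derive_eq (deriveM_fun (derive_cst_fun x v lam) (d_affine i x v))).
  by rewrite mulr0 addr0.
exact: (derive_comp_fun (is_derive_expR _) h).
Qed.

Let d_S x v : is_derive x v S (S x * (lam * dot (mean x) v)).
Proof.
apply: (is_derive_eq (derive_sum_fun (index_enum 'I_k.+1) (fun i : 'I_k.+1 => d_ex i x v))).
rewrite dot_mean !mulr_sumr; apply: eq_bigr => i _; rewrite /pr.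
have := S0 x; move: (S x) => s s0; field; by rewrite gt_eqF.
Qed.

Let d_pr i x v : is_derive x v (pr i) (pr i x * (lam * (dot (w i) v - dot (mean x) v))).
Proof.
have sn : S x != 0 by rewrite gt_eqF.
have hV : is_derive (S x) (1 : R) (fun t => t^-1) (- S x ^- 2).
  by apply: is_derive_eq; [exact: is_deriveV|rewrite /GRing.scale /= mulr1].
apply: (is_derive_eq (deriveM_fun (d_ex i x v) (derive_comp_fun hV (d_S x v)))).
rewrite /pr; move: (S x) sn (dot (mean x) v) => s sn t; by field.
Qed.

Let d_lse x v : is_derive x v lse (dot (G x) v).
Proof.
have hdot : is_derive x v (fun y => dot y y) (2 * dot x v).
  have h l : is_derive x v (fun y : 'rV[R]_n => y 0 l * y 0 l) (2 * (x 0 l * v 0 l)).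
    apply: (is_derive_eq (deriveM_fun (derive_coord x v l) (derive_coord x v l))).
    by ring.
  apply: (is_derive_eq (derive_sum_fun (index_enum 'I_n) h)).
  by rewrite -mulr_sumr.
have hl := derive_comp_fun (is_derive1_ln (S0 x)) (d_S x v).
have h1 := deriveM_fun (derive_cst_fun x v lam^-1) hl.
have h2 := deriveM_fun (derive_cst_fun x v (mu / 2)) hdot.
apply: (is_derive_eq (deriveD_fun h1 h2)); rewrite !mulr0 !addr0 /G dotDl dotZl.
have sn : S x != 0 by rewrite gt_eqF.
have ln0 : lam != 0 by rewrite gt_eqF.
move: (S x) sn (dot (mean x) v) (dot x v) lam ln0 => s sn t q l ln0; field.
by apply/andP.
Qed.

Let d_G x v l : is_derive x v (fun y => G y 0 l) ((v *m J x) 0 l).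
Proof.
have h (i : 'I_k.+1) : is_derive x v (fun y => pr i y * w i 0 l)
    (pr i x * (lam * (dot (w i) v - dot (mean x) v)) * w i 0 l).
  apply: (is_derive_eq (deriveM_fun (d_pr i x v) (derive_cst_fun x v (w i 0 l)))).
  by rewrite mulr0 add0r mulrC.
have h2 : is_derive x v (fun y : 'rV[R]_n => mu * y 0 l) (mu * v 0 l).
  apply: (is_derive_eq (deriveM_fun (derive_cst_fun x v mu) (derive_coord x v l))).
  by rewrite mulr0 addr0.
rewrite (_ : (fun y => G y 0 l) = fun y => \sum_(i < k.+1) pr i y * w i 0 l + mu * y 0 l).
  apply: (is_derive_eq (deriveD_fun (derive_sum_fun (index_enum 'I_k.+1) h) h2)).
  rewrite /J mulmxDr mul_mx_scalar -scalemxAr mulmxBr mulmx_sumr.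
  have F (A B : 'rV[R]_n) : (lam *: (A - B) + mu *: v) 0 l = lam * (A 0 l - B 0 l) + mu * v 0 l.
    by rewrite !mxE.
  rewrite F summxE; congr (_ + _).
  have E (z : 'rV[R]_n) : (v *m (z^T *m z)) 0 l = dot z v * z 0 l.
    rewrite mulmxA mxE big_ord1 (_ : (v *m z^T) 0 0 = dot z v) //.
    by rewrite dotC dotE_mx.
  rewrite E mean_coord mulr_sumr -sumrB mulr_sumr; apply: eq_bigr => i _.
  by rewrite -scalemxAr mxE E; ring.
by apply/funext => y; rewrite /G mxE mean_coord mxE.
Qed.

Let c_affine i : continuous (affine i).
Proof.
apply: ctsD; first exact: ctsC.
by apply: cts_dot => l; [exact: ctsC|exact: cts_coord].
Qed.

Let c_ex i : continuous (ex i).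
Proof.
apply: (cts_comp (@continuous_expR R)); apply: ctsM => //; exact: ctsC.
Qed.

Let c_S : continuous S. Proof. by apply: cts_sum => i _; exact: c_ex. Qed.

Let c_lse : continuous lse.
Proof.
apply: ctsD; apply: ctsM; try exact: ctsC; last by apply: cts_dot => l; exact: cts_coord.
move=> x; apply: (@continuous_comp _ _ _ S (@ln R)); first exact: c_S.
exact: continuous_ln.
Qed.

Let c_pr i : continuous (pr i).
Proof. by apply: ctsM => //; apply: ctsV => // x; rewrite gt_eqF. Qed.

Let c_mean l : continuous (fun x => mean x 0 l).
Proof.
under eq_fun do rewrite mean_coord.
by apply: cts_sum => i _; apply: ctsM => //; exact: ctsC.
Qed.

Let J_coord x i l : J x i l = lam * (\sum_(b < k.+1) pr b x * (w b 0 i * w b 0 l) -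
  mean x 0 i * mean x 0 l) + mu *+ (i == l).
Proof.
rewrite !mxE big_ord1 summxE !mxE; congr (_ * (_ - _) + _).
by apply: eq_bigr => b _; rewrite !mxE big_ord1 !mxE.
Qed.

Let c_J i l : continuous (fun x => J x i l).
Proof.
under eq_fun do rewrite J_coord.
apply: ctsD; last exact: ctsC.
apply: ctsM; first exact: ctsC.
apply: ctsB; last by apply: ctsM; exact: c_mean.
by apply: cts_sum => b _; apply: ctsM => //; exact: ctsC.
Qed.

Let sym_J x : (J x)^T = J x.
Proof.
apply/matrixP => i l; rewrite mxE !J_coord eq_sym [mean x 0 l * _]mulrC.
by congr (_ * (_ - _) + _); apply: eq_bigr => b _; rewrite [w b 0 l * _]mulrC.
Qed.

Let pos_J x v : mu * dot v v <= dot (v *m J x) v.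
Proof.
rewrite /J mulmxDr mul_mx_scalar dotDl dotZl lerDr -scalemxAr dotZl mulr_ge0 ?(ltW lam0) //.
have E (z : 'rV[R]_n) : v *m (z^T *m z) = dot z v *: z.
  by rewrite mulmxA [v *m z^T]mx11_scalar -dotE_mx mul_scalar_mx dotC.
rewrite mulmxBr dotBl E dotZl mulmx_sumr.
have -> : dot (\sum_(i < k.+1) v *m (pr i x *: ((w i)^T *m w i))) v =
    \sum_(i < k.+1) pr i x * dot (w i) v ^+ 2.
  elim/big_rec2: _ => [|i y1 y2 _ IH]; first by rewrite dot0l.
  by rewrite dotDl IH -scalemxAr E !dotZl expr2.
have := dot_mean x v; move: (dot (mean x) v) => T TE.
have -> : \sum_(i < k.+1) pr i x * dot (w i) v ^+ 2 - T * T =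
    \sum_(i < k.+1) pr i x * (dot (w i) v - T) ^+ 2.
  have -> : T * T = 2 * T * (\sum_(i < k.+1) pr i x * dot (w i) v) -
      T ^+ 2 * (\sum_(i < k.+1) pr i x) by rewrite sum_pr -TE; ring.
  rewrite !mulr_sumr -!sumrB; apply: eq_bigr => i _; ring.
by apply: sumr_ge0 => i _; rewrite mulr_ge0 ?sqr_ge0.
Qed.

Lemma lse_ge i x : (i <= k)%N -> affine i x + mu / 2 * dot x x <= lse x.
Proof.
move=> ik; rewrite lerD2r -(ler_pM2l lam0) mulrA mulfV ?gt_eqF // mul1r.
by rewrite -[leLHS]expRK ler_ln ?posrE ?expR_gt0 // S_gt.
Qed.

Lemma lse_le M x : (forall i, affine i x <= M) -> lse x <= M + (k.+1%:R)^-1 * (1 + dot x x).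
Proof.
move=> hM; have hS : S x <= k.+1%:R * expR (lam * M).
  rewrite mulr_natl -[X in _ *+ X]card_ord -sumr_const; apply: ler_sum => i _.
  by rewrite ler_expR ler_pM2l.
have k0 : (0 : R) < k.+1%:R by [].
have hl : ln (S x) <= k.+1%:R + lam * M.
  apply: (@le_trans _ _ (ln (k.+1%:R * expR (lam * M)))).
    by rewrite ler_ln ?posrE // mulr_gt0 // expR_gt0.
  rewrite lnM ?posrE ?expR_gt0 // expRK lerD2r ltW // ln_sublinear //.
have h1 : lam^-1 * ln (S x) <= k.+1%:R^-1 + M.
  apply: (@le_trans _ _ (lam^-1 * (k.+1%:R + lam * M))); first by rewrite ler_pM2l // invr_gt0.
  rewrite le_eqVlt; apply/orP; left; apply/eqP; rewrite /lam.
  by field; rewrite gt_eqF.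
have h2 : mu / 2 * dot x x <= k.+1%:R^-1 * dot x x.
  rewrite ler_wpM2r ?dot_ge0 //; have : 0 < k.+1%:R^-1 :> R := mu0.
  by rewrite -/mu; move: mu => m; lra.
rewrite /lse mulrDr mulr1; move: h1 h2; rewrite -/mu.
by move: (ln (S x)) (lam^-1) (mu * dot x x) (mu / 2 * dot x x) mu => a1 a2 a3 a4 a5; lra.
Qed.

Lemma lse_C2plus : C2plus lse.
Proof. exact: (smooth_C2plus d_lse d_G c_lse c_J sym_J mu0 pos_J). Qed.

Lemma lse_C1mono : C1mono mu (gradient lse) (hessian lse).
Proof. exact: (smooth_C1mono d_lse d_G c_J sym_J mu0 pos_J). Qed.

Lemma lse_conv_sc : conv_sc (EFin \o lse).
Proof.
have m2 : 0 < mu / 2 by rewrite divr_gt0.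
apply: (smooth_conv_sc d_lse d_G c_lse c_J sym_J mu0 pos_J (b0 := c 0%N) (b1 := enorm (w 0%N)) m2).
move=> x; apply: le_trans (lse_ge x (leq0n k)); rewrite sqr_enorm lerD2r /affine lerD2l.
have := cauchy_schwarz (- w 0%N) x; rewrite dotNl enormN; lra.
Qed.

End log_sum_exp.

(** Each affine minorant eventually bounds the smoothings from below, locally uniformly, and
    [lse_le] bounds them at a point by [u x] plus a vanishing error when [u x] is finite. Constant
    sequences therefore serve as recovery sequences. *)
Lemma smooth_dense (R : realType) n (u : 'rV[R]_n -> \bar R) : conv_sc u ->
  exists g : nat -> 'rV[R]_n -> R, [/\ forall k, conv_sc (EFin \o g k), forall k, C2plus (g k),
    forall k, exists mu, C1mono mu (gradient (g k)) (hessian (g k)) &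
    ecv (fun k => EFin \o g k) u].
Proof.
move=> cu; have [c [w [le_u gt_u]]] := affine_minorants cu.
exists (lse c w); split.
- by move=> k; exact: lse_conv_sc.
- by move=> k; exact: lse_C2plus.
- by move=> k; exists (k.+1%:R^-1); exact: lse_C1mono.
have lower x M : (M%:E < u x)%E -> \forall y \near x & k \near \oo, M < lse c w k y.
  move=> /gt_u[i hi].
  have ci : continuous (affine c w i).
    apply: ctsD; first exact: ctsC.
    by apply: cts_dot => l; [exact: ctsC|exact: cts_coord].
  have e0 : 0 < affine c w i x - M by rewrite subr_gt0.
  have /(@cvgrPdist_lt _ _ _ (nbhs x) (nbhs_filter x)) /(_ _ e0) hV := @ci x.
  exists ([set y | `|affine c w i x - affine c w i y| < affine c w i x - M], [set k | (i <= k)%N]).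
    by split => //; exists i.
  move=> [y k] /= [hy ik]; apply: lt_le_trans (lse_ge c w y ik).
  have q0 : 0 <= k.+1%:R^-1 / 2 * dot y y by rewrite mulr_ge0 ?dot_ge0 // divr_ge0 // invr_ge0.
  apply: (@lt_le_trans _ _ (affine c w i y)); last by rewrite lerDl.
  by move: hy; rewrite ltr_norml => /andP[_]; lra.
have lowerx x M : (M%:E < u x)%E -> \forall k \near \oo, M < lse c w k x.
  move=> /lower[[A B] /= [nA [N _ hN]] hAB]; exists N => // k hk.
  by apply: (hAB (x, k)); split; [exact: nbhs_singleton nA|exact: hN].
split => [x M /lower[AB nAB hAB]|x].
  by exists AB => // p hp; rewrite lte_fin; exact: hAB.
exists (fun=> x); first exact: cvg_cst.
have uN : u x != -oo%E by case: cu.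
case E : (u x) uN => [s| |] // _.
  apply: cvg_EFin; first by near=> k.
  have -> : fine \o (fun k => (EFin \o lse c w k) x) = (fun k => lse c w k x) by [].
  apply/cvgrPdist_lt => e e0.
  pose K := (1 + dot x x) / e.
  have h1 : \forall k \near \oo, s - e < lse c w k x.
    by apply: lowerx; rewrite E lte_fin ltrBlDr ltrDl.
  have h2 : \forall k \near \oo, lse c w k x < s + e.
    exists (Num.bound K).+1 => // k /= hk.
    have hM i : affine c w i x <= s by rewrite -lee_fin -E; exact: le_u.
    apply: (le_lt_trans (lse_le k hM)); rewrite ltrD2l.
    rewrite mulrC ltr_pdivrMr // mulrC -ltr_pdivrMr //.
    have K0 : 0 <= K by rewrite divr_ge0 ?(ltW e0) // addr_ge0 // dot_ge0.
    apply: (lt_le_trans (archi_boundP K0)); rewrite ler_nat.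
    exact: leq_trans (leq_trans (leqnSn _) hk) (leqnSn _).
  by apply: filterS2 h1 h2 => k; rewrite ltr_norml => h3 h4; apply/andP; split; lra.
apply/cvgeyPgt => M; have h := lowerx x M; rewrite E ltry in h.
by apply: filterS (h isT) => k; rewrite /= lte_fin.
Unshelve. all: by end_near.
Qed.

(** * The limit functional *)

Section conv_sc_stability.
Context {R : realType} {n : nat}.
Implicit Type u : 'rV[R]_n -> \bar R.

Lemma coercive_sc u : (forall M : R, exists r : R, forall x, r < enorm x ->
  ((M * enorm x)%:E <= u x)%E) -> supercoercive u.
Proof.
move=> h M; have [r hr] := h M; exists (Num.max r 0) => x; rewrite gt_max => /andP[rx x0].
have := hr x rx; case: (u x) => [s| |] //=.
  by rewrite -EFinM !lee_fin ler_pdivlMr.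
by move=> _; rewrite gt0_mulye ?leey // lte_fin invr_gt0.
Qed.

Lemma conv_sc_comp u (g : 'rV[R]_n -> 'rV[R]_n) (c A : R) : conv_sc u -> continuous g ->
  (exists h, cancel h g) ->
  (forall x y t, g (t *: x + (1 - t) *: y) = t *: g x + (1 - t) *: g y) ->
  (forall x, enorm x - A <= enorm (g x)) -> conv_sc (fun x => u (g x) + c%:E)%E.
Proof.
move=> cu cg [h hK] lin gA; have sc := conv_sc_coercive cu.
case: cu => uN [x0 ux0] lu cv _; split.
- by move=> x; case E : (u (g x)) (uN (g x)) => [s| |].
- by exists (h x0); rewrite hK; case: (u x0) ux0.
- move=> x a hx; have hx' : ((a - c)%:E < u (g x))%E.
    by move: hx; case: (u (g x)) => [s| |] //=; rewrite ?ltry // -EFinD !lte_fin ltrBlDr.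
  have [V nV hV] := lu _ _ hx'; exists (g @^-1` V); first exact: cg.
  by move=> y /hV; case: (u (g y)) => [s| |] //=; rewrite ?ltry // -EFinD !lte_fin ltrBlDr.
- move=> x y t t01; rewrite lin; have := cv (g x) (g y) t t01.
  have [t0 t1] := andP t01; have t1' : 0 < 1 - t by rewrite subr_gt0.
  case: (u (g x)) (uN (g x)) => [a| |] // _; case: (u (g y)) (uN (g y)) => [b| |] // _.
  + case: (u (_ + _)%R) => [s| |] /=; rewrite -?EFinM -?EFinD ?leye_eq ?leNye // !lee_fin.
    by rewrite !mulrDr; lra.
  + by move=> _; rewrite [X in (_ <= _ + X)%E]gt0_muley ?lte_fin // addey ?leey.
  + by move=> _; rewrite [X in (_ <= X + _)%E]gt0_muley ?lte_fin // addye ?leey.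
  + by move=> _; rewrite [X in (_ <= X + _)%E]gt0_muley ?lte_fin // addye ?gt0_muley ?lte_fin ?leey.
apply: coercive_sc => M; have [r hr] := sc (`|M| + 1).
exists (Num.max (r + A) ((`|M| + 1) * A - c)) => x; rewrite gt_max => /andP[h1 h2].
have gx := gA x; have rg : r < enorm (g x) by lra.
have := hr _ rg; case: (u (g x)) (uN (g x)) => [s| |] //= _; last by rewrite !leey.
rewrite -EFinD !lee_fin.
have M1 : 0 <= `|M| + 1 by rewrite addr_ge0.
have : (`|M| + 1) * (enorm x - A) <= (`|M| + 1) * enorm (g x) by rewrite ler_wpM2l.
have : M * enorm x <= `|M| * enorm x by rewrite ler_wpM2r ?enorm_ge0 ?ler_norm.
by rewrite mulrBr mulrDl; lra.
Qed.

Lemma conv_sc_translate u a (c : R) : conv_sc u -> conv_sc (fun x => u (x - a)%R + c%:E)%E.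
Proof.
move=> cu; apply: (@conv_sc_comp u (fun x => x - a) c (enorm a)) => //.
- by apply: ctsBv; [exact: cts_id|exact: cst_continuous].
- by exists (fun x => x + a) => x; rewrite addrK.
- by move=> x y t; apply/rowP => i; rewrite !mxE; ring.
- by move=> x; have := enormD (x - a) a; rewrite subrK; lra.
Qed.

Lemma conv_sc_rotate u (Q : 'M[R]_n) : conv_sc u -> On Q -> conv_sc (fun x => u (x *m Q^T)).
Proof.
move=> cu OQ; have OQ' : On Q^T by rewrite /On /= trmxK; exact: On_mulr.
rewrite (_ : (fun x => _) = (fun x => u (x *m Q^T) + 0%:E)%E); last first.
  by apply/funext => x; rewrite adde0.
apply: (@conv_sc_comp u (fun x => x *m Q^T) 0 0) => //.
- exact: cts_mulmxr.
- by exists (fun x => x *m Q) => x; rewrite -mulmxA OQ mulmx1.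
- by move=> x y t; rewrite mulmxDl -!scalemxAl.
- by move=> x; rewrite subr0 enorm_On.
Qed.

End conv_sc_stability.

Section proxext_theory.
Context {R : realType} {n : nat} (j : 'I_n.+1).
Implicit Types (u w : 'rV[R]_n -> \bar R) (phi psi : 'rV[R]_n -> R).

Lemma proxext_cvg r1 C phi (u_ : nat -> 'rV[R]_n -> \bar R) u : tfun r1 C phi ->
  (forall k, conv_sc (u_ k)) -> conv_sc u -> ecv u_ u ->
  proxext j phi (u_ k) @[k --> \oo] --> proxext j phi u.
Proof.
move=> tp cu_ cu uu; rewrite /proxext /ext; elim: (index_enum _) => [|i s IH].
  by under eq_fun do rewrite big_nil; rewrite big_nil; exact: cvg_cst.
under eq_fun do rewrite big_cons; rewrite big_cons; apply: cvgD => //.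
by apply: cvgMr; apply: (proxint_cvg tp) => //; rewrite ltr0n.
Qed.

Lemma proxext_valuation r1 C phi u w : tfun r1 C phi -> conv_sc u -> conv_sc w ->
  conv_sc (fun x => Order.max (u x) (w x)) -> conv_sc (fun x => Order.min (u x) (w x)) ->
  proxext j phi (fun x => Order.max (u x) (w x)) + proxext j phi (fun x => Order.min (u x) (w x))
   = proxext j phi u + proxext j phi w.
Proof.
move=> tp cu cw cM cm; apply: (etrans (esym (extD _ _ _))); apply: (etrans _ (extD _ _ _)).
apply: eq_ext => s s0.
exact: (proxint_valuation tp).
Qed.

Lemma proxext_translate r1 C phi u a (c : R) : tfun r1 C phi -> conv_sc u ->
  proxext j phi (fun x => u (x - a)%R + c%:E)%E = proxext j phi u.
Proof.
move=> tp cu; apply: eq_ext => s s0; apply: (proxint_translate tp) => //.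
exact: conv_sc_translate.
Qed.

Lemma proxext_rotate r1 C phi u (Q : 'M[R]_n) : tfun r1 C phi -> conv_sc u -> On Q ->
  proxext j phi (fun x => u (x *m Q^T)) = proxext j (fun y => phi (y *m Q)) u.
Proof.
move=> tp cu OQ; apply: eq_ext => s s0; apply: (proxint_rotate tp) => //.
exact: conv_sc_rotate.
Qed.

Lemma proxext_sub r1 C phi C' psi u : tfun r1 C phi -> tfun r1 C' psi -> conv_sc u ->
  proxext j (fun y => phi y - psi y) u = proxext j phi u - proxext j psi u.
Proof.
move=> tp tq cu; rewrite /proxext -extB; apply: eq_ext => s s0.
have [r hr] := proxint_ccs_ex tp s0 cu; have [r' hr'] := proxint_ccs_ex tq s0 cu.
by rewrite /proxint -(rintB (ccs_weaken hr (_ : r <= Num.max r r'))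
  (ccs_weaken hr' (_ : r' <= Num.max r r'))) // le_max lexx ?orbT.
Qed.

Lemma proxext_lin r1 (phi : 'I_n -> 'rV[R]_n -> R) (q : 'I_n -> R) u : conv_sc u ->
  (forall b, exists C, tfun r1 C (phi b)) ->
  proxext j (fun y => \sum_b q b * phi b y) u = \sum_b q b * proxext j (phi b) u.
Proof.
move=> cu tp; transitivity (ext j (fun s => \sum_b q b * proxint (phi b) s u)); last first.
  rewrite /proxext /ext; under eq_bigr do rewrite mulr_sumr.
  rewrite exchange_big; apply: eq_bigr => b _ /=; rewrite mulr_sumr.
  by apply: eq_bigr => i _; rewrite mulrCA.
apply: eq_ext => s s0.
have /choice[r hr] : forall b, exists r, exists C, ccs C r (fun z => phi b (yprox s u z)).
  by move=> b; have [C tb] := tp b; have [r hr] := proxint_ccs_ex tb s0 cu; exists r, C.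
pose r2 := \sum_b r b.
have r0 b : 0 <= r b by have [C hC] := hr b; exact: (ccs_r hC).
have r20 : 0 <= r2 by apply: sumr_ge0.
apply: (rint_lin q r20) => b; have [C hC] := hr b; exists C.
apply: (ccs_weaken hC); rewrite /r2 (bigD1 b) //= lerDl.
by apply: sumr_ge0.
Qed.

(* Smooth functions are dense, so the uniform estimate extends by continuity. *)
Lemma proxext_bound (a : 'I_n) (zt : R -> R) (r1 eta m r : R) (a0 : 'rV[R]_n) u : (0 < n)%N ->
  continuous zt -> 0 < r1 -> 0 < eta -> (forall s : R, r1 <= s -> zt s = 0) ->
  (forall s : R, 0 < s -> s ^+ (n - j).+1 * `|zt s| <= eta) ->
  conv_sc u -> 0 < r -> confined (r1 + 1) a0 m r u ->
  `|proxext j (fun y : 'rV[R]_n => zt (enorm y) * y 0 a) u| <=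
    (n - j).+1%:R * (2 ^+ (n - j).+1 * eta) * (2 * (r + 1 + enorm a0 + (r1 + 1) + 2)) ^+ n.
Proof.
move=> n0 cz r10 eta0 z0 zb cu r0 cfu.
have [g [cg g2 gm gu]] := smooth_dense cu.
have [C tp] : exists C, tfun r1 C (fun y : 'rV[R]_n => zt (enorm y) * y 0 a).
  apply: tfunP; first exact: ltW.
    apply: ctsM; last exact: cts_coord.
    exact: (cts_comp cz (@cts_enorm _ _)).
  by move=> y hy; rewrite z0 ?mul0r // ltW.
have /(_ eventually_filter) H := @cvg_norm _ _ _ _ _ _ _ (proxext_cvg tp cg cu gu).
have L0 : 0 <= r + 1 + enorm a0 by rewrite !addr_ge0 ?enorm_ge0 // ltW.
rewrite -(cvg_lim (@Rhausdorff R) H); apply: limr_le; first by apply/cvg_ex; eexists; exact: H.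
have := confined_open gu cfu; apply: filterS => k ck /=; have [mu gmu] := gm k.
apply: (smooth_bound a n0 (cg k) (g2 k) gmu) => // x y sxy hy.
rewrite -(subrK a0 x); apply: (le_trans (enormD _ _)); rewrite lerD2r.
apply: (confined_bound _ (conv_sc_convex (cg k)) r0 ck hy sxy).
by case: (cg k).
Qed.

End proxext_theory.

Section limit_functional.
Context {R : realType} {n : nat} (j : 'I_n.+1) (zeta : R -> R) (r1 : R).
Hypotheses (n0 : (0 < n)%N) (r10 : 0 < r1).
Hypotheses (cz : forall s, 0 < s -> {for s, continuous zeta})
  (z0 : forall s, r1 <= s -> zeta s = 0)
  (lz : s ^+ (n - j).+1 * zeta s @[s --> (0 : R)^'+] --> (0 : R)).

(** Freezing the value below [1/(k+1)], where a cut to zero would break continuity, preserves the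
    weighted bound because the argument only increases. *)
Definition ztrunc k (s : R) := zeta (Num.max s k.+1%:R^-1).
Definition tphi k a (y : 'rV[R]_n) := ztrunc k (enorm y) * y 0 a.

Let kp k : (0 : R) < k.+1%:R^-1. Proof. by rewrite invr_gt0. Qed.

Lemma ztrunc_cts k : continuous (ztrunc k).
Proof.
move=> s; apply: (@continuous_comp _ _ _ (fun s : R => Num.max s k.+1%:R^-1) zeta).
  by apply: cts_max; [exact: cts_id|exact: ctsC].
by apply: cz; rewrite lt_max kp orbT.
Qed.

Lemma ztrunc0 k s : r1 <= s -> ztrunc k s = 0.
Proof. by move=> h; rewrite /ztrunc z0 // le_max h. Qed.

Lemma tphi_tfun k a : exists C, tfun r1 C (tphi k a).
Proof.
apply: tfunP; first exact: ltW.
  apply: ctsM; last exact: cts_coord.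
  exact: (cts_comp (@ztrunc_cts k) (@cts_enorm _ _)).
by move=> y hy; rewrite /tphi ztrunc0 ?mul0r // ltW.
Qed.

Lemma zeta_small e : 0 < e -> exists2 d : R, 0 < d &
  forall s, 0 < s < d -> s ^+ (n - j).+1 * `|zeta s| < e.
Proof.
move=> e0; have /cvgrPdist_lt/(_ e e0)[d /= d0 hd] := lz.
exists d => // s /andP[s0 sd]; have := hd s; rewrite /= sub0r normrN gtr0_norm // => /(_ sd s0).
by rewrite sub0r normrN normrM normrX gtr0_norm.
Qed.

(** From [1/(N+1)] on the truncations agree. Below, the weight at [s] is at most the weight at the
    truncated argument, which still lies where the weighted [zeta] is small. *)
Lemma ztrunc_tail e : 0 < e -> exists N, forall k l, (N <= k)%N -> (N <= l)%N ->
  forall s, 0 < s -> s ^+ (n - j).+1 * `|ztrunc k s - ztrunc l s| <= e.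
Proof.
move=> e0; have e20 : 0 < e / 2 by rewrite divr_gt0.
have [d d0 hd] := zeta_small e20.
have [N hN] : exists N : nat, N.+1%:R^-1 < d.
  exists (Num.bound d^-1); rewrite -[ltRHS]invrK ltf_pV2 ?posrE ?invr_gt0 //.
  apply: (lt_trans (archi_boundP (ltW _))); first by rewrite invr_gt0.
  by rewrite ltr_nat.
exists N => k l Nk Nl s s0.
have small i : (N <= i)%N -> s < N.+1%:R^-1 -> s ^+ (n - j).+1 * `|ztrunc i s| <= e / 2.
  move=> Ni sN; rewrite /ztrunc; set t := Num.max _ _.
  have st : s <= t by rewrite le_max lexx.
  have td : 0 < t < d.
    rewrite (lt_le_trans s0 st) /= gt_max (lt_trans sN hN) /=.
    apply: le_lt_trans hN; rewrite lef_pV2 ?posrE // ler_nat //.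
  apply: le_trans (ltW (hd t td)); rewrite ler_wpM2r //.
  by rewrite ler_pXn2r ?nnegrE ?(ltW s0) // (le_trans (ltW s0)).
have big i : (N <= i)%N -> N.+1%:R^-1 <= s -> ztrunc i s = zeta s.
  move=> Ni sN; rewrite /ztrunc (max_idPl _) //; apply: le_trans sN.
  by rewrite lef_pV2 ?posrE // ler_nat.
have [h|h] := ltP s N.+1%:R^-1; last by rewrite !big // subrr normr0 mulr0 ltW.
have := small k Nk h; have := small l Nl h.
have : s ^+ (n - j).+1 * `|ztrunc k s - ztrunc l s| <=
    s ^+ (n - j).+1 * (`|ztrunc k s| + `|ztrunc l s|).
  by rewrite ler_wpM2l ?exprn_ge0 ?(ltW s0) // ler_normB.
rewrite mulrDr; lra.
Qed.

(** [proxext_bound] for the difference of two truncations; the index [N] depends on [u] only through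
    the confinement data. *)
Lemma proxext_tail a0 m (r : R) a e : 0 < r -> 0 < e -> exists N, forall k l,
  (N <= k)%N -> (N <= l)%N -> forall u, conv_sc u -> confined (r1 + 1) a0 m r u ->
  `|proxext j (tphi k a) u - proxext j (tphi l a) u| <= e.
Proof.
move=> r0 e0.
pose K : R := (n - j).+1%:R * 2 ^+ (n - j).+1 * (2 * (r + 1 + enorm a0 + (r1 + 1) + 2)) ^+ n.
have K0 : 0 <= K.
  by rewrite !mulr_ge0 ?exprn_ge0 // mulr_ge0 // !addr_ge0 ?enorm_ge0 // ltW.
have q0 : 0 < e / (K + 1) by rewrite divr_gt0 // ltr_wpDl.
have [N hN] := ztrunc_tail q0; exists N => k l Nk Nl u cu cfu.
have [C tk] := tphi_tfun k a; have [C' tl] := tphi_tfun l a.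
rewrite -(proxext_sub j tk tl cu).
have -> : (fun y => tphi k a y - tphi l a y) =
    (fun y : 'rV[R]_n => (ztrunc k (enorm y) - ztrunc l (enorm y)) * y 0 a).
  by apply/funext => y; rewrite /tphi mulrBl.
have cd : continuous (fun s => ztrunc k s - ztrunc l s) by apply: ctsB; exact: ztrunc_cts.
have d0 s : r1 <= s -> ztrunc k s - ztrunc l s = 0 by move=> h; rewrite !ztrunc0 // subrr.
apply: (le_trans (proxext_bound a n0 cd r10 q0 d0 (hN k l Nk Nl) cu r0 cfu)).
rewrite (_ : _ * _ = K * (e / (K + 1))); last by rewrite /K; ring.
by rewrite mulrCA ger_pMr // ler_pdivrMr ?ltr_wpDl // mul1r lerDl.
Qed.

Definition tval (u : 'rV[R]_n -> \bar R) : 'rV[R]_n :=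
  \row_a lim (proxext j (tphi k a) u @[k --> \oo]).

Lemma tval_cvg u a : conv_sc u -> proxext j (tphi k a) u @[k --> \oo] --> tval u 0 a.
Proof.
move=> cu; have r11 : 0 <= r1 + 1 by rewrite addr_ge0 // ltW.
have [a0 [m [r [r0 cf]]]] := confined_exists r11 cu.
rewrite mxE; apply: cauchy_cvg; apply: cauchy_exP => e e0.
have e20 : 0 < e / 2 by rewrite divr_gt0.
have [N hN] := proxext_tail a0 m a r0 e20.
exists (proxext j (tphi N a) u); exists N => // k /= Nk.
rewrite /ball /=; apply: (le_lt_trans (hN N k (leqnn N) Nk u cu cf)).
by rewrite ltr_pdivrMr // ltr_pMr // ltr1n.
Qed.

Lemma tval_unif a0 m (r : R) a e : 0 < r -> 0 < e -> exists N, forall k, (N <= k)%N ->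
  forall u, conv_sc u -> confined (r1 + 1) a0 m r u ->
  `|proxext j (tphi k a) u - tval u 0 a| <= e.
Proof.
move=> r0 e0; have [N hN] := proxext_tail a0 m a r0 e0; exists N => k Nk u cu cf.
have h : (fun l => proxext j (tphi k a) u - proxext j (tphi l a) u) @ \oo -->
    proxext j (tphi k a) u - tval u 0 a.
  by apply: cvgB; [exact: cvg_cst|exact: tval_cvg].
have /(_ eventually_filter) H := @cvg_norm _ _ _ _ _ _ _ h.
rewrite -(cvg_lim (@Rhausdorff R) H); apply: limr_le; first by apply/cvg_ex; eexists; exact: H.
by exists N => // l Nl; exact: hN.
Qed.

Lemma tval_uniq u a x : conv_sc u -> proxext j (tphi k a) u @[k --> \oo] --> x -> tval u 0 a = x.
Proof. by move=> cu h; apply: (cvg_unique (@Rhausdorff R) (tval_cvg (a := a) cu) h). Qed.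

Lemma tval_valuation : valuation tval.
Proof.
move=> u w cu cw cM cm; apply/rowP => a; rewrite [LHS]mxE [RHS]mxE.
have E k : proxext j (tphi k a) (fun x => Order.max (u x) (w x)) +
    proxext j (tphi k a) (fun x => Order.min (u x) (w x)) =
    proxext j (tphi k a) u + proxext j (tphi k a) w.
  by have [C tk] := tphi_tfun k a; exact: (proxext_valuation j tk).
have A : (fun k => proxext j (tphi k a) (fun x => Order.max (u x) (w x)) +
    proxext j (tphi k a) (fun x => Order.min (u x) (w x))) @ \oo -->
    tval (fun x => Order.max (u x) (w x)) 0 a + tval (fun x => Order.min (u x) (w x)) 0 a.
  by apply: cvgD; exact: tval_cvg.
have B : (fun k => proxext j (tphi k a) u + proxext j (tphi k a) w) @ \oo -->
    tval u 0 a + tval w 0 a by apply: cvgD; exact: tval_cvg.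
by rewrite (funext E) in A; exact: (cvg_unique (@Rhausdorff R) A B).
Qed.

Lemma tval_translate : epi_translation_invariant tval.
Proof.
move=> u b c cu; apply/rowP => a; apply: (tval_uniq (conv_sc_translate b c cu)).
have E k : proxext j (tphi k a) (fun x => u (x - b)%R + c%:E)%E = proxext j (tphi k a) u.
  by have [C tk] := tphi_tfun k a; exact: (proxext_translate j _ _ tk).
by rewrite (funext E); exact: tval_cvg.
Qed.

(** The radial factor is unchanged by an orthogonal matrix, which thus only mixes the coordinate
    factors [y_a] linearly. *)
Lemma tval_equivariant : equivariant (@On R n) tval.
Proof.
move=> u Q cu OQ.
have QV : invmx Q = Q^T.
  have uQ : Q \in unitmx by have := OQ; rewrite /On /= => /mulmx1_unit[].
  by rewrite -[LHS]mulmx1 -OQ mulKmx.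
rewrite QV; have cu' := conv_sc_rotate cu OQ; apply/rowP => a.
apply: (tval_uniq cu'); rewrite mxE.
have E k : proxext j (tphi k a) (fun x => u (x *m Q^T)) =
    \sum_b Q b a * proxext j (tphi k b) u.
  have [C tk] := tphi_tfun k a.
  rewrite (proxext_rotate j tk cu OQ) -(proxext_lin j (r1 := r1)) //; last first.
    by move=> b; exact: tphi_tfun.
  congr (proxext j _ u); apply/funext => y; rewrite /tphi enorm_On // mxE mulr_sumr.
  by apply: eq_bigr => b _; ring.
rewrite (funext E).
elim: (index_enum _) => [|b s IH].
  by under eq_fun do rewrite big_nil; rewrite big_nil; exact: cvg_cst.
under eq_fun do rewrite big_cons; rewrite big_cons; apply: cvgD => //.
by rewrite mulrC; apply: cvgMr; exact: tval_cvg.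
Qed.

(** Confinement passes to the tail of an epi-convergent sequence, and on confined functions the
    continuous truncated functionals converge uniformly. *)
Lemma tval_continuous : epi_continuous tval.
Proof.
move=> u_ u cu_ cu /epi_ecv uu.
have r11 : 0 <= r1 + 1 by rewrite addr_ge0 // ltW.
have [a0 [m [r [r0 cf]]]] := confined_exists r11 cu.
have cf_ := confined_open uu cf.
apply/cvgrPdist_lt => e e0; have e30 : 0 < e / 4 by rewrite divr_gt0.
have tri (p q s t : R) : `|q - t| <= e / 4 -> `|p - s| <= e / 4 -> `|p - q| < e / 4 ->
    `|s - t| < e.
  rewrite !ler_norml !ltr_norml.
  by move=> /andP[h1 h1'] /andP[h3 h3'] /andP[h4 h4']; apply/andP; split; lra.
have H a : \forall k \near \oo, `|tval u 0 a - tval (u_ k) 0 a| < e.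
  have [N hN] := tval_unif a0 m a r0 e30; have [C tN] := tphi_tfun N a.
  have /cvgrPdist_lt/(_ _ e30) h2 := @proxext_cvg R n j r1 C _ u_ u tN cu_ cu uu.
  apply: filterS2 cf_ h2 => k ck.
  exact: (tri _ _ _ _ (hN N (leqnn N) _ (cu_ k) ck) (hN N (leqnn N) u cu cf)).
move/filter_forall : H; apply: filterS => k hk.
apply: (@le_lt_trans _ _ (\big[Num.max/0]_a `|tval u 0 a - tval (u_ k) 0 a|)).
  apply: ler_mx_normP => [|i a]; first exact: bigmax_ge_id.
  by rewrite (ord1 i) mxE [X in _ + X]mxE; exact: le_bigmax.
by apply/bigmax_ltP; split => // a _; exact: hk.
Qed.

End limit_functional.

(** * The integral formula for singular densities *)

Section dyadic_domination.
Context {R : realType} {n : nat}.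
Local Notation T := (measurableTypeR R).
Local Notation Leb := (lebesgue_tuple R).
Implicit Types r : R.

Definition box (x0 : 'rV[R]_n) r : set (n.-tuple T) := [set t | `|row_of_tuple t - x0| <= r].

Lemma measurable_box x0 r : measurable (box x0 r).
Proof.
have cF : continuous (fun x : 'rV[R]_n => `|x - x0|).
  have cB : continuous (fun x : 'rV[R]_n => x - x0).
    by apply: ctsBv; [exact: cts_id|exact: cst_continuous].
  by move=> x; apply: (@cvg_norm _ _ _ _ _ _ _ (@cB x)); exact: nbhs_filter.
rewrite (_ : box x0 r = (fun t => `|row_of_tuple t - x0|) @^-1` `]-oo, r]%classic).
  by rewrite -[X in measurable X]setTI; exact: (measurable_cts cF).
by apply/seteqP; split => t; rewrite /box /= in_itv.
Qed.

Lemma lebesgue_box x0 r : 0 <= r -> Leb n (box x0 r) = ((2 * r) ^+ n)%:E.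
Proof.
move=> r0.
have -> : box x0 r = [set t | forall i, tnth t i \in `[x0 0 i - r, x0 0 i + r]].
  apply/seteqP; split => t h => [i|].
    have := le_trans (ler_mx_norm_coord _ 0 i) h; rewrite !mxE ler_norml in_itv /=.
    by move=> /andP[h1 h2]; apply/andP; split; lra.
  apply: ler_mx_normP => // i k; rewrite (ord1 i) !mxE ler_norml.
  by have := h k; rewrite in_itv /= => /andP[h1 h2]; apply/andP; split; lra.
rewrite (@lebesgue_tuple_box R n (fun i => `[x0 0 i - r, x0 0 i + r]%classic)) //.
rewrite (eq_bigr (fun=> (2 * r)%:E)) => [|i _]; last first.
  rewrite lebesgue_measure_itv /= lte_fin; case: ifPn => h.
    by rewrite -EFinD; congr _%:E; lra.
  by congr _%:E; lra.
by rewrite prodEFin prodr_const card_ord.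
Qed.

Lemma dyadic_shell (d r : R) : 0 < d -> d <= r ->
  exists i : nat, r / 2 ^+ i.+1 < d <= r / 2 ^+ i.
Proof.
move=> d0 dr; have r0 := lt_le_trans d0 dr.
have p2 i : (0 : R) < 2 ^+ i by rewrite exprn_gt0.
have ex : exists i : nat, r / 2 ^+ i.+1 < d.
  exists (Num.bound (r / d)); rewrite ltr_pdivrMr // mulrC -ltr_pdivrMr //.
  apply: (lt_trans (archi_boundP _)); first by rewrite divr_ge0 // ltW.
  by rewrite -natrX ltr_nat (leq_trans (ltn_expl _ (ltnSn 1))) // leq_exp2l.
case: (ex_minnP ex) => i hi hmin; exists i; rewrite hi /=.
case: i hi hmin => [|i] _ hmin; first by rewrite expr0 divr1.
by rewrite leNgt; apply/negP => /hmin; rewrite ltnn.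
Qed.

(** At least [B / d^m] on the shell [r / 2^(i+1) < d <= r / 2^i], so the sum of weighted boxes
    dominates the power singularity. *)
Let weight (m : nat) (B r : R) i : R := B * (2 / r) ^+ m * (2 ^+ i) ^+ m.

Let majorant m B (x0 : 'rV[R]_n) r (t : n.-tuple T) : \bar R :=
  (\sum_(0 <= i <oo) ((weight m B r i)%:E * (\1_(box x0 (r / 2 ^+ i)) t)%:E))%E.

Section majorant.
Context (m : nat) (B r : R) (x0 : 'rV[R]_n).
Hypotheses (mn : (m < n)%N) (B0 : 0 <= B) (r0 : 0 < r).

Let p2 i : (0 : R) < 2 ^+ i. Proof. by rewrite exprn_gt0. Qed.

Let weight_ge0 i : 0 <= weight m B r i.
Proof. by rewrite !mulr_ge0 ?exprn_ge0 ?divr_ge0 ?(ltW r0) ?(ltW (p2 i)). Qed.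

Let term_ge0 i t : (0 <= (weight m B r i)%:E * (\1_(box x0 (r / 2 ^+ i)) t)%:E)%E.
Proof. by rewrite -EFinM lee_fin mulr_ge0. Qed.

Let mterm i : measurable_fun setT
  (fun t => (weight m B r i)%:E * (\1_(box x0 (r / 2 ^+ i)) t)%:E)%E.
Proof.
apply: measurable_funeM; apply/measurable_EFinP; apply: measurable_indic.
exact: measurable_box.
Qed.

Lemma majorant_ge t : `|row_of_tuple t - x0| <= r -> row_of_tuple t != x0 ->
  ((B / `|row_of_tuple t - x0| ^+ m)%:E <= majorant m B x0 r t)%E.
Proof.
move=> hr tx; have d0 : 0 < `|row_of_tuple t - x0| by rewrite normr_gt0 subr_eq0.
have [i /andP[h1 h2]] := dyadic_shell d0 hr.
apply: (le_trans _ (nneseries_lim_ge i.+1 (fun l _ _ => term_ge0 l t))).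
rewrite big_nat_recr //=; apply: (@le_trans _ _ ((weight m B r i)%:E * (\1_(box x0 (r / 2 ^+ i)) t)%:E)%E).
  rewrite indicE mem_set // mule1 lee_fin /weight -mulrA ler_wpM2l //.
  rewrite -exprMn -exprVn; apply: lerXn2r.
  - by rewrite nnegrE invr_ge0 ltW.
  - by rewrite nnegrE !mulr_ge0 ?invr_ge0 ?(ltW r0) ?(ltW (p2 i)).
  rewrite -[leRHS]invrK lef_pV2 ?posrE ?invr_gt0 ?mulr_gt0 ?invr_gt0 //.
  by rewrite !invfM invrK mulrC mulrA -invfM mulrC -exprSr ltW.
by apply: leeDr; apply: sume_ge0.
Qed.

Lemma majorant_ge0 t : (0 <= majorant m B x0 r t)%E.
Proof. exact: nneseries_ge0. Qed.

(** The volume of box [i] is proportional to [2^(-i n)] and its weight to [2^(i m)]; as [m < n] the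
    terms are at most [C / 2^i]. *)
Lemma majorant_integrable : (Leb n).-integrable setT (majorant m B x0 r).
Proof.
apply/integrableP; split.
  rewrite /majorant.
  rewrite (_ : (fun t => _) = fun t => (\sum_(0 <= i <oo | i \in xpredT)
    ((weight m B r i)%:E * (\1_(box x0 (r / 2 ^+ i)) t)%:E))%E); last first.
    by apply/funext => t; apply: eq_eseriesl.
  by apply: ge0_emeasurable_sum.
under eq_integral => t _ do rewrite gee0_abs ?majorant_ge0 //.
rewrite /majorant integral_nneseries //.
pose C := B * (2 / r) ^+ m * (2 * r) ^+ n.
have C0 : 0 <= C by rewrite !mulr_ge0 ?exprn_ge0 ?divr_ge0 ?mulr_ge0 ?(ltW r0).
have term i : (\int[Leb n]_t ((weight m B r i)%:E * (\1_(box x0 (r / 2 ^+ i)) t)%:E)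
    <= (C / 2 ^+ i)%:E)%E.
  rewrite ge0_integralZl_EFin //; last first.
    by apply/measurable_EFinP; apply: measurable_indic; exact: measurable_box.
  rewrite integral_indic //; last exact: measurable_box.
  rewrite setIT [X in (_ * X <= _)%E](lebesgue_box x0 (divr_ge0 (ltW r0) (ltW (p2 i)))) -EFinM lee_fin.
  have -> : (2 * (r / 2 ^+ i)) ^+ n = (2 * r) ^+ n / (2 ^+ i) ^+ n.
    by rewrite mulrA exprMn exprVn.
  rewrite [leLHS](_ : _ = C * ((2 ^+ i) ^+ m / (2 ^+ i) ^+ n)); last first.
    by rewrite /weight /C -!mulrA [in RHS](mulrCA ((2 * r) ^+ n)).
  rewrite ler_wpM2l //; have q1 : 1 <= 2 ^+ i :> R by rewrite exprn_ege1 // ler1n.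
  move: (2 ^+ i) q1 => q q1; have q0 : 0 < q by apply: lt_le_trans q1.
  rewrite ler_pdivrMr ?exprn_gt0 // mulrC ler_pdivlMr // -exprSr.
  exact: ler_weXn2l.
apply: (@le_lt_trans _ _ (\sum_(0 <= i <oo) (C / 2 ^+ i)%:E)%E).
  by apply: lee_nneseries => // i _ _; apply: integral_ge0.
apply: (@le_lt_trans _ _ (C * 2)%:E); last exact: ltry.
apply: lime_le.
  by apply: is_cvg_nneseries => i _ _; rewrite lee_fin divr_ge0 // ltW.
apply: nearW => N; rewrite sumEFin lee_fin.
have -> : \sum_(0 <= i < N) C / 2 ^+ i = C * (2 - 2 / 2 ^+ N).
  elim: N => [|N IH]; first by rewrite big_nil expr0 divr1 subrr mulr0.
  rewrite big_nat_recr //= IH [2 ^+ N.+1]exprS.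
  by have := p2 N; move: (2 ^+ N) => q q0; field; rewrite gt_eqF.
by rewrite ler_wpM2l // lerBlDr lerDl divr_ge0 // ltW.
Qed.

Lemma dyadic_dominated_cvg (F_ : nat -> 'rV[R]_n -> R) (F : 'rV[R]_n -> R) :
  (forall k, continuous (F_ k)) -> (forall x, F_ k x @[k --> \oo] --> F x) ->
  (forall k x, r < `|x - x0| -> F_ k x = 0) -> (forall k, F_ k x0 = 0) ->
  (forall k x, `|x - x0| ^+ m * `|F_ k x| <= B) ->
  (Leb n).-integrable setT (fun t => (F (row_of_tuple t))%:E) /\
  rint (F_ k) @[k --> \oo] --> \int[Leb n]_t F (row_of_tuple t).
Proof.
move=> cF FF supp F0 bd.
pose f_ k (t : n.-tuple T) := (F_ k (row_of_tuple t))%:E.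
pose f (t : n.-tuple T) := (F (row_of_tuple t))%:E.
have mf_ k : measurable_fun setT (f_ k) by apply/measurable_EFinP; exact: measurable_cts.
have ff t : f_ ^~ t @ \oo --> f t.
  by apply: cvg_EFin; [exact: nearW|exact: FF].
have mf : measurable_fun setT f by apply: (@emeasurable_fun_cvg _ _ _ _ f_ f mf_) => t _; exact: ff.
have le k t : (`|f_ k t| <= majorant m B x0 r t)%E.
  have [tx|tx] := eqVneq (row_of_tuple t) x0; rewrite /f_.
    by rewrite tx F0 abse0 majorant_ge0.
  have [hr|hr] := leP `|row_of_tuple t - x0| r; last first.
    by rewrite supp // abse0 majorant_ge0.
  apply: le_trans (majorant_ge hr tx); rewrite lee_fin ler_pdivlMr ?exprn_gt0 ?normr_gt0 ?subr_eq0 //.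
  by rewrite mulrC.
have [If _ cvI] := dominated_convergence measurableT mf_ mf (aeW _ (fun t _ => ff t))
  majorant_integrable (aeW _ (fun t k _ => le k t)).
split => //; apply: fine_cvg.
by rewrite fineK //; exact: (integrable_fin_num measurableT If).
Qed.

End majorant.
End dyadic_domination.

(** * Growth of the gradient away from a critical point *)

Section gradient_growth.
Context {R : realType} {n : nat}.

Lemma nonvanishing_lower (G : 'rV[R]_n -> 'rV[R]_n) (K : set 'rV[R]_n) : compact K ->
  continuous G -> (forall x, K x -> G x != 0) ->
  exists2 c, 0 < c & forall x, K x -> c <= enorm (G x).
Proof.
move=> cK cG nz; have [K0|K0] := pselect (K !=set0); last first.
  by exists 1 => // x Kx; case: K0; exists x.
have cN : continuous (fun x => enorm (G x)) by exact: (cts_comp (@cts_enorm R n) cG).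
have [c Kc hc] := EVT_min_rV K0 cK (continuous_subspaceT cN).
exists (enorm (G c)); first by apply: enorm_gt0; apply: nz; rewrite inE in Kc.
by move=> x Kx; apply: hc; rewrite inE.
Qed.

Context (f : 'rV[R]_n -> R).
Hypothesis f2 : C2plus f.

Let hess_pos x v : v != 0 -> 0 < dot (v *m hessian f x) v.
Proof. by case: f2 => _ /(_ x)[_ h] /h; rewrite -dotE_mx. Qed.

Lemma critical_uniq x y : gradient f x = 0 -> gradient f y = 0 -> x = y.
Proof.
move=> gx gy; apply/eqP; rewrite -subr_eq0; apply/negP => /negP d0.
pose d := x - y; pose phi s := dot (gradient f (y + s *: d)) d.
have dphi (s : R) : is_derive s (1 : R) phi (dot (d *m hessian f (y + s *: d)) d).
  by apply: vfre_line; exact: gradient_vfre.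
have cphi : continuous phi.
  by move=> t; apply/differentiable_continuous/derivable1_diffP; case: (dphi t).
have [c _] := @MVT R phi (fun s => dot (d *m hessian f (y + s *: d)) d) 0 1 ltr01
  (fun s _ => dphi s) (continuous_subspaceT cphi).
rewrite /phi scale1r scale0r addr0 subr0 mulr1 [y + d]addrC subrK gx gy dot0l subrr => E.
by have := hess_pos (y + c *: d) d0; rewrite -E ltxx.
Qed.

Lemma gradient_near_critical x : gradient f x = 0 -> exists c d : R, [/\ 0 < c, 0 < d &
  forall y, `|y - x| < d -> c * `|y - x| <= enorm (gradient f y)].
Proof.
move=> gx; pose H := hessian f x.
have uH : H \in unitmx.
  rewrite -row_free_unit -kermx_eq0; apply/eqP/row_matrixP => i; rewrite row0; set v := row i _.
  have vH : v *m H = 0 by apply/sub_kermxP; exact: row_sub.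
  by apply/eqP/negPn/negP => /(hess_pos x); rewrite -/H vH dot0l ltxx.
pose C := n%:R * `|invmx H| + 1.
have C0 : 0 < C by rewrite ltr_wpDl // mulr_ge0.
have lowH (v : 'rV[R]_n) : `|v| / C <= `|v *m H|.
  rewrite ler_pdivrMr //; have := norm_mulmx (v *m H) (invmx H); rewrite mulmxK //.
  move=> h; apply: (le_trans h); rewrite mulrCA ler_wpM2l // /C lerDl //.
have q0 : 0 < C^-1 / 2 by rewrite divr_gt0 // invr_gt0.
have /nbhs_ballP[d /= d0 hd] := gradient_vfre f2 x q0.
exists (C^-1 / 2), d; split => // y yd.
have := hd y; rewrite mx_norm_ball /ball_ /= distrC => /(_ yd); rewrite gx subr0 -/H => h.
apply: le_trans (norm_le_enorm _); have l1 := lowH (y - x).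
have l2 := ler_normB (gradient f y) (gradient f y - (y - x) *m H).
rewrite opprB addrC subrK in l2.
by move: l1 l2 h; rewrite [C^-1 / 2]mulrC -mulrA [C^-1 * _]mulrC; lra.
Qed.

(** A critical point is unique because the Hessian is positive definite; near it invertibility of
    the Hessian gives linear growth, and elsewhere compactness gives a positive lower bound. Without
    critical points any [x0] outside the ball will do, as [|x - x0|] is bounded on the ball. *)
Lemma gradient_lower (rho : R) : (0 < n)%N -> 0 < rho -> exists (x0 : 'rV[R]_n) (c : R),
  [/\ 0 < c, enorm x0 <= rho -> gradient f x0 = 0 &
  forall x, enorm x <= rho -> c * `|x - x0| <= enorm (gradient f x)].
Proof.
move=> n0 rho0; have cG := gradient_cts f2.
have [[x0 gx]|nz] := pselect (exists x, gradient f x = 0).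
  have [c1 [d [c10 d0 h1]]] := gradient_near_critical gx.
  pose D := rho + enorm x0 + 1.
  have D0 : 0 < D by rewrite ltr_wpDl // addr_ge0 ?enorm_ge0 // ltW.
  have nz x : [set x | d <= enorm (x - x0) <= D] x -> gradient f x != 0.
    move=> /= /andP[dx _]; apply/negP => /eqP gx'; move: dx.
    by rewrite (critical_uniq gx' gx) subrr enorm0 leNgt d0.
  have [c2 c20 h2] := nonvanishing_lower (@compact_enorm R n x0 d D) cG nz.
  exists x0, (Num.min c1 (c2 / D)); split => // [|x xr]; first by rewrite lt_min c10 divr_gt0.
  have [xd|xd] := ltP `|x - x0| d.
    by apply: le_trans (h1 x xd); rewrite ler_wpM2r // ge_min lexx.
  have xD : enorm (x - x0) <= D.
    by apply: (le_trans (enormB _ _)); rewrite /D; lra.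
  apply: le_trans (h2 x _); last by rewrite /= xD (le_trans xd) ?norm_le_enorm.
  apply: (@le_trans _ _ (c2 / D * D)); last by rewrite divfK // gt_eqF.
  apply: ler_pM => //; [by rewrite le_min (ltW c10) divr_ge0 // ltW|by rewrite ge_min lexx orbT|].
  exact: le_trans (norm_le_enorm _) xD.
have nz' x : [set x | 0 <= enorm (x - 0) <= rho] x -> gradient f x != 0.
  by move=> _; apply/negP => /eqP gx; apply: nz; exists x.
have [c2 c20 h2] := nonvanishing_lower (@compact_enorm R n 0 0 rho) cG nz'.
(* A point outside the ball, which makes the condition on the gradient at [x0] vacuous. *)
pose x0 : 'rV[R]_n := const_mx (rho + 1).
pose D := rho + enorm x0 + 1.
have D0 : 0 < D by rewrite ltr_wpDl // addr_ge0 ?enorm_ge0 // ltW.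
have x0r : rho < enorm x0.
  apply: lt_le_trans (le_trans (ler_mx_norm_coord x0 0 (Ordinal n0)) (norm_le_enorm _)).
  by rewrite mxE ger0_norm ?addr_ge0 ?(ltW rho0) // ltrDl.
exists x0, (c2 / D); split => [||x xr]; first by rewrite divr_gt0.
  by move=> /(lt_le_trans x0r); rewrite ltxx.
apply: le_trans (h2 x _); last by rewrite /= subr0 enorm_ge0.
apply: (@le_trans _ _ (c2 / D * D)); last by rewrite divfK // gt_eqF.
rewrite ler_wpM2l ?divr_ge0 ?(ltW c20) ?(ltW D0) //; apply: (le_trans (norm_le_enorm _)).
by apply: (le_trans (enormB _ _)); rewrite /D; lra.
Qed.

End gradient_growth.

(** * Passage to the limit in the integral formula *)

Section integral_formula.
Context {R : realType} {n : nat} (j : 'I_n.+1) (zeta : R -> R) (r1 : R).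
Hypotheses (n0 : (0 < n)%N) (j0 : (0 < j)%N) (r10 : 0 < r1).
Hypotheses (cz : forall s, 0 < s -> {for s, continuous zeta})
  (z0 : forall s, r1 <= s -> zeta s = 0)
  (lz : s ^+ (n - j).+1 * zeta s @[s --> (0 : R)^'+] --> (0 : R)).

Lemma weighted_bound : exists2 B, 0 <= B &
  forall s, 0 < s -> s ^+ (n - j).+1 * `|zeta s| <= B.
Proof.
have [d d0 hd] := zeta_small lz ltr01.
pose k := Num.bound d^-1.
have kd : k.+1%:R^-1 < d.
  rewrite -[ltRHS]invrK ltf_pV2 ?posrE ?invr_gt0 //.
  apply: (lt_trans (archi_boundP (ltW _))); first by rewrite invr_gt0.
  by rewrite ltr_nat.
pose w (s : R) := s ^+ (n - j).+1 * `|ztrunc zeta k s|.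
have cw : continuous w.
  apply: ctsM; first by move=> s; exact: exprn_continuous.
  by apply: ctsNorm; exact: ztrunc_cts.
have [c _ hc] := EVT_max (ltW r10) (continuous_subspaceT cw).
exists (Num.max 1 (w c)) => [|s s0]; first by rewrite le_max ler01.
have [sd|sd] := ltP s d.
  by rewrite le_max; apply/orP; left; rewrite ltW // hd // s0.
have [sr|sr] := leP r1 s; first by rewrite z0 // normr0 mulr0 le_max ler01.
rewrite le_max; apply/orP; right; apply: le_trans (hc s _); last first.
  by rewrite in_itv /= (ltW s0) ltW.
by rewrite /w /ztrunc (max_idPl _) // (le_trans (ltW kd)).
Qed.

(** The coordinate factor [y_a] absorbs one power of [|y|], lowering the order of the singularity
    from [n - j + 1] to [n - j]. *)
Lemma tphi_weighted_bound B k a (y : 'rV[R]_n) :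
  (forall s, 0 < s -> s ^+ (n - j).+1 * `|zeta s| <= B) ->
  enorm y ^+ (n - j) * `|tphi zeta k a y| <= B.
Proof.
move=> hB; rewrite /tphi /ztrunc normrM; set t := Num.max _ _.
have t0 : 0 < t by rewrite lt_max invr_gt0 ltr0n orbT.
apply: le_trans (hB t t0).
apply: (@le_trans _ _ (enorm y ^+ (n - j).+1 * `|zeta t|)).
  rewrite exprSr mulrA mulrAC ler_wpM2r // ler_wpM2l ?exprn_ge0 ?enorm_ge0 //.
  exact: coord_le_enorm.
rewrite ler_wpM2r // ler_pXn2r ?nnegrE ?enorm_ge0 ?(ltW t0) //.
by rewrite le_max lexx.
Qed.

(** On the support [|grad f(x)| >= c |x - x0|], so the weighted bound on the density dominates all
    truncated integrands by a multiple of [|x - x0|^(-(n-j))], which is integrable there since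
    [j > 0]. *)
Lemma tval_formula f : conv_sc (EFin \o f) -> C2plus f ->
  vintegrable (tintegrand j zeta f) /\
  tval j zeta (EFin \o f) = vintegral (tintegrand j zeta f).
Proof.
move=> cf f2; have [B B0 hB] := weighted_bound.
have [a0 [m [r [r0 cfu]]]] := confined_exists (ltW r10) cf.
pose rho := r + 1 + enorm a0.
have rho0 : 0 < rho by rewrite ltr_wpDr ?enorm_ge0 // addr_gt0.
have gout x : rho < enorm x -> r1 < enorm (gradient f x).
  move=> hx; rewrite ltNge; apply/negP => hy; move: hx; apply/negP; rewrite -leNgt.
  rewrite -(subrK a0 x); apply: (le_trans (enormD _ _)); rewrite lerD2r.
  have cv := conv_sc_convex cf.
  apply: (confined_bound _ cv r0 cfu hy (gradient_subgrad f2 x cv)).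
  by case: (cf).
have [x0 [c [c0 gx0 lower]]] := gradient_lower f2 n0 rho0.
pose q x := esym_eig (hessian f x) (n - j).
have cq : continuous q by apply: cts_esym; [exact: hessian_sym|exact: hessian_cts].
have [E hE] := bounded_on_ball (ctsNorm cq) (ltW rho0).
have E0 : 0 <= E by apply: le_trans (hE 0 _); rewrite ?enorm0 // ltW.
pose F_ a k x := tphi zeta k a (gradient f x) * q x.
pose F a x := tintegrand j zeta f x 0 a.
have tout k a y : r1 < enorm y -> tphi zeta k a y = 0.
  by move=> h; rewrite /tphi (ztrunc0 z0) ?mul0r // ltW.
have key a : (lebesgue_tuple R n).-integrable setT (fun t => (F a (row_of_tuple t))%:E) /\
    rint (F_ a k) @[k --> \oo] --> \int[lebesgue_tuple R n]_t F a (row_of_tuple t).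
  have mn : (n - j < n)%N by rewrite ltn_subrL j0 n0.
  have BE0 : 0 <= B * E / c ^+ (n - j) by rewrite divr_ge0 ?mulr_ge0 ?exprn_ge0 // ltW.
  have rr0 : 0 < rho + enorm x0 by rewrite ltr_wpDr ?enorm_ge0.
  apply: (dyadic_dominated_cvg mn BE0 rr0 (x0 := x0)).
  - move=> k; apply: ctsM => //; have [C tk] := tphi_tfun r10 cz z0 k a.
    exact: (cts_comp (tf_cts tk) (gradient_cts f2)).
  - move=> x; rewrite /F /F_ /tintegrand mxE /q -mulrA [_ * gradient f x 0 a]mulrC mulrA.
    have [g0|g0] := eqVneq (enorm (gradient f x)) 0.
      rewrite (enorm_eq0 g0) mxE !mulr0 mul0r.
      by under eq_fun do rewrite /tphi mxE mulr0 mul0r; exact: cvg_cst.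
    have g1 : 0 < enorm (gradient f x) by rewrite lt_def g0 enorm_ge0.
    apply: (@cvg_trans _ ((fun=> zeta (enorm (gradient f x)) * gradient f x 0 a *
      esym_eig (hessian f x) (n - j)) @ \oo)); last exact: cvg_cst.
    apply: near_eq_cvg; exists (Num.bound (enorm (gradient f x))^-1) => // k /= hk.
    rewrite /tphi /ztrunc (max_idPl _) //.
    rewrite -[leRHS]invrK lef_pV2 ?posrE ?invr_gt0 //.
    apply: (le_trans (ltW (archi_boundP _))); first by rewrite invr_ge0 ltW.
    by rewrite ler_nat (leq_trans hk).
  - move=> k x hx; rewrite /F_ tout ?mul0r //; apply: gout.
    have := le_trans (norm_le_enorm _) (enormB x x0); lra.
  - move=> k; rewrite /F_; have [h|h] := ltP rho (enorm x0); first by rewrite tout ?mul0r // gout.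
    by rewrite gx0 // /tphi mxE mulr0 mul0r.
  - move=> k x; have [h|h] := ltP rho (enorm x).
      by rewrite /F_ tout ?mul0r ?normr0 ?mulr0 // gout.
    rewrite ler_pdivlMr ?exprn_gt0 // /F_ normrM mulrA mulrAC.
    apply: ler_pM => //; last exact: hE.
      by rewrite !mulr_ge0 ?exprn_ge0 // ltW.
    apply: le_trans (tphi_weighted_bound k a (gradient f x) hB).
    rewrite mulrAC ler_wpM2r // mulrC -exprMn; apply: lerXn2r; rewrite ?nnegrE ?enorm_ge0 //.
      by rewrite mulr_ge0 // ltW.
    exact: lower.
split=> [a|]; first by have [] := key a.
apply/rowP => a; rewrite [RHS]mxE; apply: (tval_uniq n0 r10 cz z0 lz cf).
have pE k : proxext j (tphi zeta k a) (EFin \o f) = rint (F_ a k).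
  have [C tk] := tphi_tfun r10 cz z0 k a; exact: (proxext_gradient cf f2 j tk).
by rewrite (funext pE); exact: (key a).2.
Qed.

End integral_formula.

Theorem theorem1 (R : realType) (n j : nat) (zeta : R -> R) :
  (1 <= n)%N -> (1 <= j <= n)%N -> Tclass n j zeta ->
  exists t : ('rV[R]_n -> \bar R) -> 'rV[R]_n,
    [/\ is_t j zeta t,
        forall t' : ('rV[R]_n -> \bar R) -> 'rV[R]_n,
          is_t j zeta t' -> forall u, conv_sc u -> t' u = t u
      & equivariant (@On R n) t].
Proof.
move=> n0 /andP[j0 jn] [[cz [M zM]] lz].
pose J : 'I_n.+1 := Ordinal (jn : (j < n.+1)%N).
pose r1 := `|M| + 1; have r10 : 0 < r1 by rewrite ltr_wpDl.
have z0 s : r1 <= s -> zeta s = 0.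
  move=> h; apply: zM; apply: lt_le_trans h; apply: (le_lt_trans (ler_norm M)).
  by rewrite ltrDl.
rewrite addn1 in lz; have lz' : s ^+ (n - J).+1 * zeta s @[s --> (0 : R)^'+] --> (0 : R) := lz.
have ct := tval_continuous n0 r10 cz z0 lz'.
have rt := tval_equivariant n0 r10 cz z0 lz'.
have ft f cf f2 := @tval_formula R n J zeta r1 n0 j0 r10 cz z0 lz' f cf f2.
exists (tval J zeta); split; [split| |exact: rt].
- exact: (tval_valuation n0 r10 cz z0 lz').
- exact: ct.
- exact: (tval_translate n0 r10 cz z0 lz').
- by move=> u Q cu [OQ _]; exact: (rt _ _ cu OQ).
- exact: ft.
(* Both functionals are given by the same integral on smooth functions and are continuous, so
   density forces equality on [conv_sc]. *)
move=> t' [_ ct' _ _ ft'] u cu; have [g [cg g2 _ gu]] := smooth_dense cu.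
have h1 := ct' _ _ cg cu (ecv_epi gu); have h2 := ct _ _ cg cu (ecv_epi gu).
have E k : t' (EFin \o g k) = tval J zeta (EFin \o g k).
  exact: (etrans (ft' _ (cg k) (g2 k)).2 (esym (ft _ (cg k) (g2 k)).2)).
rewrite (funext E) in h1.
exact: (cvg_unique (@norm_hausdorff _ _) h1 h2).
Qed.
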